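(* Consider the scaled Markov-modulated infinite-server queue (Model I or Model II) with identical service rates $\mu_i=\mu>0$ for all $i\in\{1,\dots,d\}$ and scaling exponent $\alpha>0$. Let $\gamma:=\max\{1-\alpha/2,\,1/2\}$. For every $t\ge 0$, as $N\to\infty$ the random variable $$\frac{M^{(N)}(t)-N\varrho(t)}{N^\gamma}$$ converges in distribution to a Normal distribution with zero mean and variance $$\sigma^2(t):=\sigma_m^2(t)1_{\{\alpha\le 1\}}+\varrho(t)1_{\{\alpha\ge 1\}},\qquad \sigma_m^2(t):=\mu^{-1}(1-e^{-2\mu t})\,U.$$
   Context: Background process: $J=(J(t))$ is an irreducible continuous-time Markov process on $\{1,\dots,d\}$ with transition rate matrix $Q=(q_{ij})$, unique stationary distribution $\boldsymbol\pi=(\pi_1,\dots,\pi_d)^{\rm T}$ (column vector), and transition probabilities $p_{ij}(t)=\mathbb P(J(t)=j\mid J(0)=i)$. The deviation matrix $D$ of $J$ is $[D]_{ij}:=\int_0^\infty (p_{ij}(t)-\pi_j)\,{\rm d}t$. Queue: while $J(t)=i$, jobs arrive according to a Poisson process with rate $\lambda_i\ge 0$. All jobs are served in parallel, starting immediately on arrival, and leave when service is completed; $J$ evolves independently of the queue. In Model I every job present at time $t$ is subject to a departure hazard rate $\mu_{J(t)}$; in Model II a job arriving while the background process is in state $i$ has an exponential service time with mean $\mu_i^{-1}$. When $\mu_i=\mu$ for all $i$ the two models coincide (service times are i.i.d. exponential with mean $\mu^{-1}$, independent of the rest). $M(t)$ is the number of jobs present at time $t$. Scaling: for $N\in\mathbb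 N$ and fixed $\alpha>0$, replace $\lambda_i$ by $N\lambda_i$ and $q_{ij}$ by $N^\alpha q_{ij}$ (service rates unchanged). The resulting number of jobs at time $t$ is $M^{(N)}(t)$, with the system empty at time $0$. Notation (in terms of the unscaled parameters): $\Lambda={\rm diag}(\lambda_1,\dots,\lambda_d)$, $\boldsymbol 1$ is the all-ones column vector, $\lambda_\infty:=\sum_{i=1}^d\pi_i\lambda_i$, $\varrho:=\lambda_\infty/\mu$, $\varrho(t):=\varrho\,(1-e^{-\mu t})$, and $U:=\boldsymbol\pi^{\rm T}\Lambda D\Lambda\boldsymbol 1$. Normal distributions may be degenerate. *)

(* Defs.v *)
From HB Require Import structures.
From mathcomp Require Import all_boot all_order all_algebra finmap.
From mathcomp Require Import all_classical all_reals all_analysis.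
From mathcomp Require Import measurable_realfun.

Set Implicit Arguments.
Unset Strict Implicit.
Unset Printing Implicit Defensive.

Import Order.TTheory GRing.Theory Num.Theory.
Import numFieldNormedType.Exports.

Local Open Scope classical_set_scope.
Local Open Scope ring_scope.

Definition is_rate_matrix (R : realType) (d : nat) (Q : 'M[R]_d) : Prop :=
  (forall i j, i != j -> 0 <= Q i j) /\ (forall i, \sum_j Q i j = 0).

Definition irreducible_rates (R : realType) (d : nat) (Q : 'M[R]_d) : Prop :=
  forall i j, connect (fun a b => (a != b) && (0 < Q a b)) i j.

Definition is_stationary (R : realType) (d : nat) (Q : 'M[R]_d)
    (pi : 'cV[R]_d) : Prop :=
  [/\ forall i, 0 <= pi i 0, \sum_i pi i 0 = 1 & pi^T *m Q = 0].

Definition expmx (R : realType) (d : nat) (A : 'M[R]_d) : 'M[R]_d :=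
  \matrix_(i, j) limn (series (fun k : nat => (k`!)%:R^-1 * (A ^+ k) i j)).

Definition transition (R : realType) (d : nat) (Q : 'M[R]_d) (t : R) :
  'M[R]_d := expmx (t *: Q).

Definition deviation_matrix (R : realType) (d : nat) (Q : 'M[R]_d)
    (pi : 'cV[R]_d) : 'M[R]_d :=
  \matrix_(i, j)
    \int[lebesgue_measure]_(t in `[0, +oo[) (transition Q t i j - pi j 0).

(* A process [J : R -> Omega -> 'I_d] is only looked at for times [0 <= t];
   its initial distribution is arbitrary. *)
Record is_markov_process (R : realType) (d : nat) (Q : 'M[R]_d)
    (disp : measure_display) (Omega : measurableType disp)
    (P : probability Omega R) (J : R -> Omega -> 'I_d) : Prop := {
  markov_measurable :
    forall (t : R) i, 0 <= t -> measurable (J t @^-1` [set i]) ;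
  markov_right_continuous :
    forall w (t : R), 0 <= t -> \forall s \near t^'+, J s w = J t w ;
  markov_left_limits :
    forall w (t : R), 0 < t -> exists i, \forall s \near t^'-, J s w = i ;
  markov_fdd :
    forall (n : nat) (t : nat -> R) (i : nat -> 'I_d),
      t 0%N = 0 -> (forall l, t l <= t l.+1) ->
      P [set w | forall l, (l <= n)%N -> J (t l) w = i l] =
      (P (J 0%R @^-1` [set i 0%N]) *
       (\prod_(l < n)
          transition Q (t l.+1 - t l) (i l) (i l.+1))%:E)%E }.

Definition background_generators (R : realType) (d : nat) (Omega : Type)
    (J : R -> Omega -> 'I_d) : set (set Omega) :=
  [set A | exists (t : R) i, 0 <= t /\ A = J t @^-1` [set i]].

Definition arrival_generators (R : realType) (Omega : Type)
    (T : nat -> Omega -> \bar R) : set (set Omega) :=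
  [set A | exists k (C : set (\bar R)), measurable C /\ A = T k @^-1` C].

Definition sigma_background (R : realType) (d : nat) (Omega : Type)
    (J : R -> Omega -> 'I_d) : set (set Omega) :=
  <<s background_generators J >>.

Definition sigma_background_arrivals (R : realType) (d : nat) (Omega : Type)
    (J : R -> Omega -> 'I_d) (T : nat -> Omega -> \bar R) : set (set Omega) :=
  <<s background_generators J `|` arrival_generators T >>.

(* [T k w] is the epoch of arrival number [k], with value [+oo] when there are
   at most [k] arrivals. *)
Definition arrivals (R : realType) (Omega : Type) (T : nat -> Omega -> \bar R)
    (a b : R) (w : Omega) : nat :=
  #|` fset_set [set k : nat | (a%:E < T k w <= b%:E)%E] |.

(* [poisson_pmf] of the library takes the value 1 at every [k] when the rate
   is 0, hence this version. *)
Definition poisson_mass (R : realType) (a : R) (k : nat) : R :=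
  a ^+ k / (k`!)%:R * expR (- a).

(* Arrivals at rate [lambda i] while the background state is [i]: given the
   whole path of [J], a Poisson process with intensity [lambda (J s)].
   Conditioning is expressed by integration over the events of sigma(J). *)
Record is_modulated_poisson (R : realType) (d : nat) (lambda : 'I_d -> R)
    (disp : measure_display) (Omega : measurableType disp)
    (P : probability Omega R) (J : R -> Omega -> 'I_d)
    (T : nat -> Omega -> \bar R) : Prop := {
  arrival_measurable : forall k, measurable_fun [set: Omega] (T k) ;
  arrival_gt0 : forall k w, (0 < T k w)%E ;
  arrival_nondecreasing : forall k w, (T k w <= T k.+1 w)%E ;
  arrival_locally_finite :
    forall w (t : R), finite_set [set k | (T k w <= t%:E)%E] ;
  arrival_poisson :
    forall (n : nat) (t : nat -> R) (k : nat -> nat) (B : set Omega),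
      0 <= t 0%N -> (forall l, t l <= t l.+1) -> sigma_background J B ->
      P (B `&` [set w | forall l, (l < n)%N ->
                                  arrivals T (t l) (t l.+1) w = k l]) =
      (\int[P]_(w in B)
         (\prod_(l < n)
            poisson_mass
              (\int[lebesgue_measure]_(s in `[t l, t l.+1]) lambda (J s w))
              (k l))%:E)%E }.

Inductive model := ModelI | ModelII.

(* Probability, given the background process and the arrival epochs, that a job
   arriving at time [tau] is still present at time [tau + x]. *)
Definition survival (R : realType) (d : nat) (md : model) (mu : 'I_d -> R)
    (path : R -> 'I_d) (tau x : R) : R :=
  match md with
  | ModelI =>
      expR (- \int[lebesgue_measure]_(s in `[tau, tau + x]) mu (path s))
  | ModelII => expR (- (mu (path tau) * x))
  end.

(* [S k w] is the time spent in the system by the job arriving at [T k w];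
   given [(J, T)] these times are independent.  The law of [S k] matters only
   on the event that arrival number [k] takes place. *)
Record is_service (R : realType) (d : nat) (md : model) (mu : 'I_d -> R)
    (disp : measure_display) (Omega : measurableType disp)
    (P : probability Omega R) (J : R -> Omega -> 'I_d)
    (T : nat -> Omega -> \bar R) (S : nat -> Omega -> R) : Prop := {
  service_measurable : forall k, measurable_fun [set: Omega] (S k) ;
  service_survival :
    forall (n : nat) (x : nat -> R) (B : set Omega),
      (forall l, 0 <= x l) -> sigma_background_arrivals J T B ->
      (forall w l, B w -> (l < n)%N -> (T l w < +oo)%E) ->
      P (B `&` [set w | forall l, (l < n)%N -> x l < S l w]) =
      (\int[P]_(w in B)
         (\prod_(l < n)
            survival md mu (J ^~ w) (fine (T l w)) (x l))%:E)%E }.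

Record is_modulated_queue (R : realType) (d : nat) (md : model)
    (Q : 'M[R]_d) (lambda mu : 'I_d -> R)
    (disp : measure_display) (Omega : measurableType disp)
    (P : probability Omega R) (J : R -> Omega -> 'I_d)
    (T : nat -> Omega -> \bar R) (S : nat -> Omega -> R) : Prop := {
  queue_background : is_markov_process Q P J ;
  queue_arrivals : is_modulated_poisson lambda P J T ;
  queue_services : is_service md mu P J T S }.

Definition jobs (R : realType) (Omega : Type) (T : nat -> Omega -> \bar R)
    (S : nat -> Omega -> R) (t : R) (w : Omega) : nat :=
  #|` fset_set [set k : nat | (T k w <= t%:E < T k w + (S k w)%:E)%E] |.

(* [normal_prob m 0] is not a Dirac mass in the library. *)
Definition normal_law (R : realType) (m v : R) :
    probability (measurableTypeR R) R :=
  if v == 0 then (@dirac _ (measurableTypeR R) m R : probability _ R)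
  else (normal_prob m (Num.sqrt v) : probability _ R).

(* The variables may live on different probability spaces. *)
Definition cvg_in_distribution (R : realType) (disp : nat -> measure_display)
    (Omega : forall n, measurableType (disp n))
    (P : forall n, probability (Omega n) R) (X : forall n, Omega n -> R)
    (nu : probability (measurableTypeR R) R) : Prop :=
  (\forall n \near \oo, measurable_fun [set: Omega n] (X n)) /\
  forall f : R -> R, continuous f -> (exists C : R, forall x, `|f x| <= C) ->
    (\int[P n]_w (f (X n w))%:E)%E @[n --> \oo] --> (\int[nu]_x (f x)%:E)%E.

Definition lambda_infty (R : realType) (d : nat) (pi : 'cV[R]_d)
    (lambda : 'I_d -> R) : R := \sum_i pi i 0 * lambda i.

Definition varrho (R : realType) (d : nat) (pi : 'cV[R]_d)
    (lambda : 'I_d -> R) (m t : R) : R :=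
  lambda_infty pi lambda / m * (1 - expR (- (m * t))).

Definition U_coef (R : realType) (d : nat) (Q : 'M[R]_d) (pi : 'cV[R]_d)
    (lambda : 'I_d -> R) : R :=
  let Lambda := diag_mx (\row_i lambda i) in
  (pi^T *m Lambda *m deviation_matrix Q pi *m Lambda *m const_mx 1
     : 'M[R]_1) 0 0.

Definition sigma2_m (R : realType) (d : nat) (Q : 'M[R]_d) (pi : 'cV[R]_d)
    (lambda : 'I_d -> R) (m t : R) : R :=
  m^-1 * (1 - expR (- (2 * m * t))) * U_coef Q pi lambda.

Definition sigma2 (R : realType) (d : nat) (Q : 'M[R]_d) (pi : 'cV[R]_d)
    (lambda : 'I_d -> R) (alpha m t : R) : R :=
  sigma2_m Q pi lambda m t * (alpha <= 1)%R%:R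
  + varrho pi lambda m t * (1 <= alpha)%R%:R.

(* Main.v *)
Require Import Defs.
From HB Require Import structures.
From mathcomp Require Import all_boot all_order all_algebra finmap.
From mathcomp Require Import all_classical all_reals all_analysis.
From mathcomp Require Import measurable_realfun.
From mathcomp Require Import ring lra.

Set Implicit Arguments.
Unset Strict Implicit.
Unset Printing Implicit Defensive.

Import Order.TTheory GRing.Theory Num.Theory.
Import numFieldNormedType.Exports.

Local Open Scope classical_set_scope.
Local Open Scope ring_scope.

(** Let [gamma] be the normalising exponent. It is enough that, for every
    [theta], the moment generating function at [theta] of the normalised
    variable converges to that of the limiting normal law
    ([mgf_cvg_in_distribution], [normal_law_mgf]).

    As all service rates equal [m], in both models a job that arrives at time
    [s] is still present at time [t] with probability [expR (- (m * (t - s)))],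
    independently of the other jobs. Given the background process, the number
    of jobs is therefore Poisson, with mean [N] times the load
    [Psi], the integral over [0, t] of [expR (- (m * (t - s))) * lambda (J s)]
    ([jobs_generating_function]). With [b = theta / N ^ gamma] and
    [a = N * (expR b - 1)], the generating function under study is
    [E (expR (a * Psi)) * expR (- (b * N * rho))], where [rho] is the
    deterministic value [varrho] around which [Psi] concentrates. It factors
    into [E (expR (a * (Psi - rho)))] and [expR (rho * (a - N * b))].

    The second factor is the Poisson noise: [a - N * b] is equivalent to
    [theta ^ 2 / 2 * N ^ (1 - 2 * gamma)], which has a nonzero limit only if
    [1 <= alpha] ([poisson_tilt_limit]). The first factor is the noise of the
    background, run at speed [nu = N ^ alpha]: it converges to the exponential
    of [beta * U * (1 - expR (- (2 * m * t))) / (2 * m)], [beta] being the limit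
    of [a ^ 2 / nu] ([tilted_limit]), and [beta] is nonzero only if
    [alpha <= 1] ([modulation_tilt_limit]).

    For the first factor, [E (expR (a * Psi))] is the limit, along finer and
    finer grids of [0, t], of the total mass of a chain of nonnegative vectors:
    each step applies the transition matrix of the background and a diagonal
    matrix of tilts ([tilted_law_limit]). Integrated against
    [1 + eps * w * h + eps ^ 2 * w ^ 2 * k], with [eps = a / nu], [w] the current
    weight and [h], [k] solutions of Poisson equations for the generator, the
    vector grows at each step by the predicted exponential factor up to a small
    relative error ([step_error_expands]); a discrete Gronwall lemma adds up the
    errors ([tilted_chain_bounds]). The deviation matrix solves the Poisson
    equations ([generator_potential]); the integrals that define it converge
    because of the Poincare inequality ([poincare], [centered_decay]).

    Finally, convergence of the moment generating functions on the whole line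
    gives that of the moments, by differentiation, then that of the
    expectations of [cos (u * x)] and [sin (u * x)], by their power series. A
    bounded continuous function is approximated by a Bernstein polynomial in a
    slow sine, and all errors are measured in a weight [expR (b * `|x|)] whose
    expectation stays bounded, which takes the place of tightness. *)

(** * Preliminaries on sums, limits and integrals *)

Section finite_sums_and_bounded_functions.
Context d (T : measurableType d) (R : realType) (mu : {measure set T -> \bar R}).
Variables (D : set T) (mD : measurable D).

Lemma integrable_lincomb (I : Type) (s : seq I) (c : I -> R) (u : I -> T -> R) :
  (forall i, mu.-integrable D (EFin \o u i)) ->
  mu.-integrable D (EFin \o (fun t => \sum_(i <- s) c i * u i t)).
Proof.
move=> iu; elim: s => [|k s IH].
  rewrite (_ : EFin \o _ = fun=> 0%E); first exact: integrable0.
  by apply/funext => t /=; rewrite big_nil.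
rewrite (_ : EFin \o _ = ((EFin \o (fun t => (c k * u k t)%R)) \+
  (EFin \o (fun t => (\sum_(i <- s) c i * u i t)%R)))%E).
  by apply: integrableD => //; exact: (integrableZl _ (c k) (iu k)).
by apply/funext => t /=; rewrite big_cons.
Qed.

Lemma Rintegral_lincomb (I : Type) (s : seq I) (c : I -> R) (u : I -> T -> R) :
  (forall i, mu.-integrable D (EFin \o u i)) ->
  \int[mu]_(t in D) (\sum_(i <- s) c i * u i t) =
  \sum_(i <- s) c i * \int[mu]_(t in D) u i t.
Proof.
move=> iu; elim: s => [|k s IH].
  by under eq_Rintegral do rewrite big_nil; rewrite big_nil Rintegral_cst// mul0r.
under eq_Rintegral do rewrite big_cons.
rewrite big_cons RintegralD//; last exact: integrable_lincomb.
  by rewrite IH RintegralZl.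
exact: (integrableZl _ (c k) (iu k)).
Qed.

Hypothesis finD : (mu D < +oo)%E.

Lemma integrable_bounded (f : T -> R) C : measurable_fun D f ->
  (forall x, D x -> `|f x| <= C) -> mu.-integrable D (EFin \o f).
Proof.
move=> mf fC; apply: measurable_bounded_integrable => //.
exists C; split; first exact: num_real.
by move=> M CM x Dx /=; apply: le_trans (fC x Dx) (ltW CM).
Qed.

Lemma bounded_convergence (f_ : nat -> T -> R) (f : T -> R) C :
  (forall n, measurable_fun D (f_ n)) ->
  (forall n x, D x -> `|f_ n x| <= C) ->
  (forall x, D x -> f_ ^~ x @ \oo --> f x) ->
  measurable_fun D f /\
  \int[mu]_(x in D) f_ n x @[n --> \oo] --> \int[mu]_(x in D) f x.
Proof.
move=> mf_ fC fcvg; have mf : measurable_fun D f by exact: measurable_fun_cvg mf_ fcvg.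
split => //.
have fC' x : D x -> `|f x| <= C.
  move=> Dx; apply: (cvgr_to_le (cvg_norm (fcvg x Dx))).
  by near=> n; exact: fC.
have iC : mu.-integrable D (EFin \o cst C).
  by apply: (@integrable_bounded _ `|C|).
have [||||i_f _ cv] := @dominated_convergence _ _ _ mu D mD
    (fun n x => (f_ n x)%:E) (fun x => (f x)%:E) (fun=> C%:E) _ _ _ iC.
- by move=> n; exact/measurable_EFinP.
- exact/measurable_EFinP.
- by apply: aeW => x Dx; apply: cvg_EFin; [near=> n|exact: fcvg].
- by apply: aeW => x n Dx; rewrite lee_fin fC.
apply: (fine_cvg _); rewrite fineK//; last exact: integrable_fin_num.
Unshelve. all: by end_near. Qed.

End finite_sums_and_bounded_functions.

Lemma Rintegral_itv_cst (R : realType) (a b c : R) : a <= b ->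
  \int[@lebesgue_measure R]_(x in `[a, b]) c = c * (b - a).
Proof.
move=> ab; rewrite Rintegral_cst//; congr (_ * _).
have h : (@lebesgue_measure R) `[a, b]%classic = (b - a)%:E.
  rewrite lebesgue_measure_itv/= lte_fin; case: ltP => [//|ba].
  by have -> : b = a; [apply/eqP; rewrite eq_le ba ab|rewrite subrr].
by transitivity (fine (b - a)%:E); first exact (congr1 (@fine R) h).
Qed.

Lemma prodr_itv01 (R : realType) (F : nat -> R) m n :
  (forall l, 0 <= F l <= 1) -> 0 <= \prod_(m <= l < n) F l <= 1.
Proof.
move=> F01; apply/andP; split.
  by apply: prodr_ge0 => l _; have /andP[] := F01 l.
elim/big_rec: _ => // l x _ x1; have /andP[F0 F1] := F01 l.
by apply: le_trans F1; rewrite ler_piMr.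
Qed.

Lemma lebesgue_itv_lty (R : realType) (x y : bool) (a b : R) :
  (@lebesgue_measure R [set` Interval (BSide x a) (BSide y b)] < +oo)%E.
Proof. by rewrite lebesgue_measure_itv; case: ifP => _; rewrite ltry. Qed.

Lemma cvg_natr_inv (R : realType) : (n%:R^-1 : R) @[n --> \oo] --> 0.
Proof. by rewrite -(cvg_shiftS (fun n : nat => (n%:R^-1 : R))); exact: cvg_harmonic. Qed.

Lemma sum_delta (R : realType) (I : finType) (i : I) (F : I -> R) :
  \sum_j (i == j)%:R * F j = F i.
Proof.
rewrite (bigD1 i)//= eqxx mul1r big1 ?addr0// => j ji.
by rewrite eq_sym (negbTE ji) mul0r.
Qed.

(** * Bounds on the exponential function *)

Section exponential.
Variable R : realType.
Implicit Types x y b : R.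

Lemma ler_expR_norm x : expR x <= expR `|x|.
Proof. by rewrite ler_expR ler_norm. Qed.

Lemma series_exp_coeff_le x n : 0 <= x -> series (exp_coeff x) n <= expR x.
Proof.
move=> x0; apply: nondecreasing_cvgn_le.
  apply/nondecreasing_seqP => k; rewrite -subr_ge0 seriesSB.
  by rewrite exp_coeff_ge0.
exact: is_cvg_series_exp_coeff.
Qed.

(** The tail of the exponential series from rank [k] is dominated by
    [|x|^k] times the series of [expR |x|], since [j! <= (k + j)!]. *)
Lemma expR_taylor k x : `|expR x - series (exp_coeff x) k| <= `|x| ^+ k * expR `|x|.
Proof.
have cv : series (exp_coeff x) (n + k)%N @[n --> \oo] --> expR x.
  by rewrite cvg_shiftn; exact: is_cvg_series_exp_coeff.
have dcv : `|series (exp_coeff x) (n + k)%N - series (exp_coeff x) k| @[n --> \oo] -->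
    `|expR x - series (exp_coeff x) k|.
  by apply: cvg_norm; apply: cvgB => //; exact: cvg_cst.
apply: (cvgr_to_le dcv); near=> n.
rewrite sub_series_geq ?leq_addl// -{1}[k]add0n big_addn addnK.
apply: le_trans (ler_norm_sum _ _ _) _.
apply: (@le_trans _ _ (`|x| ^+ k * series (exp_coeff `|x|) n)); last first.
  by rewrite ler_wpM2l ?exprn_ge0// series_exp_coeff_le.
rewrite /series/= mulr_sumr; apply: ler_sum => j _.
rewrite /exp_coeff /= normrM normrX addnC exprD -mulrA ler_wpM2l ?exprn_ge0//.
rewrite ler_wpM2l ?exprn_ge0//.
rewrite ger0_norm ?invr_ge0// lef_pV2 ?posrE ?ltr0n ?fact_gt0// ler_nat.
by rewrite leq_fact ?leq_addl.
Unshelve. all: by end_near. Qed.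

Lemma expR_taylor1 x : `|expR x - 1 - x| <= x ^+ 2 * expR `|x|.
Proof.
have := expR_taylor 2 x; rewrite /series/= !big_nat_recr//= big_geq// /exp_coeff/=.
by rewrite add0r expr0 expr1 !divr1 opprD addrA real_normK ?num_real.
Qed.

Lemma expR_taylor2 x : `|expR x - 1 - x - x ^+ 2 / 2| <= `|x| ^+ 3 * expR `|x|.
Proof.
have := expR_taylor 3 x; rewrite /series/= !big_nat_recr//= big_geq// /exp_coeff/=.
by rewrite add0r expr0 expr1 !divr1 !opprD !addrA.
Qed.

Lemma expr_le_expR x k : 0 <= x -> x ^+ k <= expR (k%:R * x).
Proof.
move=> x0; rewrite expRM_natl lerXn2r ?nnegrE ?expR_ge0//.
by rewrite (le_trans _ (expR_ge1Dx x))// lerDr.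
Qed.

End exponential.

(** * Exponential moments *)

Lemma expR_norm_le (R : realType) (b x : R) :
  expR (b * `|x|) <= expR (b * x) + expR (- b * x).
Proof.
have [x0|x0] := leP 0 x; first by rewrite ger0_norm// lerDl expR_ge0.
by rewrite ltr0_norm// mulrN mulNr lerDr expR_ge0.
Qed.

Section exponential_moments.
Context {R : realType} d (Omega : measurableType d) (P : probability Omega R).
Variable X : Omega -> R.
Hypothesis mX : measurable_fun [set: Omega] X.
Hypothesis intX : forall a, P.-integrable [set: Omega]
  (EFin \o (fun w => expR (a * X w))).

Lemma integrable_expR_norm b :
  P.-integrable [set: Omega] (EFin \o (fun w => expR (b * `|X w|))).
Proof.
apply: (le_integrable _ _ _ (integrableD _ (intX b) (intX (- b)))) => //.
  apply/measurable_EFinP; apply: measurableT_comp => //.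
  by apply: measurable_funM => //; exact: measurableT_comp.
move=> w _ /=; rewrite lee_fin ger0_norm ?expR_ge0//.
by rewrite [leRHS]ger0_norm ?addr_ge0 ?expR_ge0// expR_norm_le.
Qed.

Lemma integrable_expR_dom (g : R -> R) C b : measurable_fun [set: R] g ->
  (forall x, `|g x| <= C * expR (b * `|x|)) ->
  P.-integrable [set: Omega] (EFin \o (g \o X)).
Proof.
move=> mg gle.
apply: (le_integrable _ _ _ (integrableZl _ C (integrable_expR_norm b))) => //.
  by apply/measurable_EFinP; exact: measurableT_comp.
move=> w _ /=; rewrite lee_fin; apply: (le_trans (gle _)).
by rewrite (le_trans (ler_norm _)).
Qed.

Lemma expectation_expR_norm_le b :
  \int[P]_w expR (b * `|X w|) <=
  \int[P]_w expR (b * X w) + \int[P]_w expR (- b * X w).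
Proof.
rewrite -RintegralD//; apply: le_Rintegral => //.
- exact: integrable_expR_norm.
- exact: (integrableD _ (intX b) (intX (- b))).
- by move=> w _; exact: expR_norm_le.
Qed.

End exponential_moments.

(** * Test functions of exponential growth *)

Section mgf_convergence.
Context {R : realType} (disp : nat -> measure_display).
Context (Omega : forall n, measurableType (disp n)).
Context (P : forall n, probability (Omega n) R) (X : forall n, Omega n -> R).
Context (nu : probability (measurableTypeR R) R).
Arguments X : clear implicits.
Hypothesis mX : forall n, measurable_fun [set: Omega n] (X n).
Hypothesis intX : forall n a, (P n).-integrable [set: Omega n]
  (EFin \o (fun w => expR (a * X n w))).
Hypothesis intnu : forall a, nu.-integrable [set: measurableTypeR R]
  (EFin \o (fun x : measurableTypeR R => expR (a * x))).
Hypothesis mgf_cvg : forall a, \int[P n]_w expR (a * X n w) @[n --> \oo]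
  --> \int[nu]_x expR (a * x).

(** The exponential bound makes this class stable under approximation in the
    weight [expR (b * `|x|)], see [dominated_cvg_close]. *)
Definition dominated_cvg (g : R -> R) : Prop :=
  [/\ measurable_fun [set: R] g,
      (exists C b, forall x, `|g x| <= C * expR (b * `|x|)) &
      \int[P n]_w g (X n w) @[n --> \oo] --> \int[nu]_x g x].

(** The weight is integrated uniformly in [n], because it is at most
    [expR (b * x) + expR (- b * x)], whose expectation converges. *)
Lemma dominated_cvg_close (g : R -> R) b : measurable_fun [set: R] g ->
  (forall eta, 0 < eta -> exists2 f, dominated_cvg f &
     forall x, `|g x - f x| <= eta * expR (b * `|x|)) ->
  dominated_cvg g.
Proof.
move=> mg close.
have [C [c gC]] : exists C c, forall x, `|g x| <= C * expR (c * `|x|).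
  have [f [mf [C [c fC]] _] fg] := close 1 ltr01.
  exists (`|C| + 1), (Num.max b c) => x.
  rewrite -(subrK (f x) (g x)) addrC (le_trans (ler_normD _ _))// mulrDl lerD//.
    apply: (le_trans (fC x)); apply: (@le_trans _ _ (`|C| * expR (c * `|x|))).
      by rewrite ler_wpM2r ?expR_ge0 ?ler_norm.
    by rewrite ler_wpM2l// ler_expR ler_wpM2r// le_max lexx orbT.
  by apply: (le_trans (fg x)); rewrite ler_wpM2l// ler_expR ler_wpM2r// le_max lexx.
split => //; first by exists C, c.
pose K := \int[nu]_x expR (b * x) + \int[nu]_x expR (- b * x) + 1.
have K0 : 0 < K by rewrite ltr_wpDl// addr_ge0// Rintegral_ge0// => x _; exact: expR_ge0.
apply/cvgrPdist_le => e e0.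
have eK0 : 0 < e / (3 * K) by rewrite divr_gt0// mulr_gt0.
have [f [mf [C' [c' fC]] fcvg] fg] := close _ eK0.
pose D := Num.max C C'.
have dist d (T : measurableType d) (Q : probability T R) (Y : T -> R) :
    measurable_fun setT Y ->
    (forall a, Q.-integrable setT (EFin \o (fun w => expR (a * Y w)))) ->
    \int[Q]_w expR (b * Y w) + \int[Q]_w expR (- b * Y w) <= K ->
    `|\int[Q]_w g (Y w) - \int[Q]_w f (Y w)| <= e / 3.
  move=> mY intY leK.
  have fC1 x : `|f x| <= `|C'| * expR (Num.max b c' * `|x|).
    apply: (le_trans (fC x)); apply: (@le_trans _ _ (`|C'| * expR (c' * `|x|))).
      by rewrite ler_wpM2r ?expR_ge0 ?ler_norm.
    by rewrite ler_wpM2l// ler_expR ler_wpM2r// le_max lexx orbT.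
  have if_ := integrable_expR_dom mY intY mf fC.
  have ig := integrable_expR_dom mY intY mg gC.
  rewrite -RintegralB//; apply: (le_trans (le_normr_Rintegral _ _)) => //.
    exact: (integrableB _ ig if_).
  apply: (@le_trans _ _ (\int[Q]_w (e / (3 * K) * expR (b * `|Y w|)))).
    apply: le_Rintegral => //.
    - exact/(integrable_norm (integrableB _ ig if_)).
    - exact: (integrableZl _ _ (integrable_expR_norm mY intY b)).
  rewrite RintegralZl//; last exact: integrable_expR_norm.
  apply: (@le_trans _ _ (e / (3 * K) * K)); last first.
    by rewrite invfM mulrA mulfVK// gt_eqF.
  rewrite ler_wpM2l// ?(ltW eK0)// (le_trans _ leK)//.
  exact: expectation_expR_norm_le.
have leK : \forall n \near \oo,
    \int[P n]_w expR (b * X n w) + \int[P n]_w expR (- b * X n w) <= K.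
  apply: (@cvgr_le _ _ _ _ _ (\int[nu]_x expR (b * x) + \int[nu]_x expR (- b * x))).
    by apply: cvgD; exact: mgf_cvg.
  by rewrite ltrDl.
near=> n.
have -> : \int[nu]_x g x - \int[P n]_w g (X n w) =
   (\int[nu]_x g x - \int[nu]_x f x) + (\int[nu]_x f x - \int[P n]_w f (X n w))
   - (\int[P n]_w g (X n w) - \int[P n]_w f (X n w)) by ring.
have -> : e = e / 3 + e / 3 + e / 3 by field.
apply: (le_trans (ler_normB _ _)); apply: lerD.
  apply: (le_trans (ler_normD _ _)); apply: lerD.
    by apply: (dist _ _ nu id) => //; rewrite lerDl.
  near: n; apply: cvgr_dist_le => //; exact: divr_gt0.
by apply: dist => //; near: n.
Unshelve. all: by end_near. Qed.

Lemma dominated_cvg_lin a f g : dominated_cvg f -> dominated_cvg g ->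
  dominated_cvg (fun x => a * f x + g x).
Proof.
move=> [mf [C [c fC]] fcvg] [mg [C' [c' gC]] gcvg]; split.
- by apply: measurable_funD => //; apply: measurable_funM.
- exists (`|a| * `|C| + `|C'|), (Num.max c c') => x.
  rewrite (le_trans (ler_normD _ _))// mulrDl lerD//.
    rewrite normrM -mulrA ler_wpM2l//; apply: (le_trans (fC x)).
    apply: (@le_trans _ _ (`|C| * expR (c * `|x|))).
      by rewrite ler_wpM2r ?expR_ge0 ?ler_norm.
    by rewrite ler_wpM2l// ler_expR ler_wpM2r// le_max lexx.
  apply: (le_trans (gC x)).
  apply: (@le_trans _ _ (`|C'| * expR (c' * `|x|))).
    by rewrite ler_wpM2r ?expR_ge0 ?ler_norm.
  by rewrite ler_wpM2l// ler_expR ler_wpM2r// le_max lexx orbT.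
have lin d (T : measurableType d) (Q : probability T R) (Y : T -> R) :
    measurable_fun setT Y ->
    (forall a, Q.-integrable setT (EFin \o (fun w => expR (a * Y w)))) ->
  \int[Q]_w (a * f (Y w) + g (Y w)) =
  a * \int[Q]_w f (Y w) + \int[Q]_w g (Y w).
  move=> mY iY.
  have if_ := integrable_expR_dom mY iY mf fC.
  have ig := integrable_expR_dom mY iY mg gC.
  rewrite RintegralD//; last exact: (integrableZl _ a if_).
  by rewrite RintegralZl.
under eq_fun do rewrite lin//.
rewrite (lin _ _ nu id)//.
by apply: cvgD => //; apply: cvgMr.
Qed.

Lemma dominated_cvg_expR a : dominated_cvg (fun x => expR (a * x)).
Proof.
split; last exact: mgf_cvg.
- apply: measurableT_comp => //; exact: measurable_funM.
- by exists 1, `|a| => x; rewrite mul1r -normrM [leLHS]ger0_norm ?expR_ge0// ler_expR_norm.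
Qed.

Lemma dominated_cvg0 : dominated_cvg (fun=> 0).
Proof.
split; first exact: measurable_cst.
  by exists 0, 0 => x; rewrite mul0r normr0.
by under eq_fun do rewrite Rintegral_cst// mul0r; rewrite Rintegral_cst// mul0r; exact: cvg_cst.
Qed.

Lemma dominated_cvgZ a f : dominated_cvg f -> dominated_cvg (fun x => a * f x).
Proof.
move=> df; have := dominated_cvg_lin a df dominated_cvg0.
by under eq_fun do rewrite addr0.
Qed.

Lemma dominated_cvg_sum (F : nat -> R -> R) n :
  (forall i, dominated_cvg (F i)) ->
  dominated_cvg (fun x => \sum_(0 <= i < n) F i x).
Proof.
move=> dF; elim: n => [|n IH].
  by under eq_fun do rewrite big_geq//; exact: dominated_cvg0.
under eq_fun do rewrite big_nat_recr//= -[X in X + _]mul1r.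
exact: dominated_cvg_lin.
Qed.

(** The function [x ^+ k.+1 * expR (a * x)] is the derivative in [a] of
    [x ^+ k * expR (a * x)], hence a limit of difference quotients. *)
Lemma dominated_cvg_monomial k a : dominated_cvg (fun x => x ^+ k * expR (a * x)).
Proof.
elim: k a => [|k IH] a.
  by under eq_fun do rewrite expr0 mul1r; exact: dominated_cvg_expR.
have mexp b : measurable_fun [set: R] (fun x => expR (b * x)).
  apply: measurableT_comp => //; exact: measurable_funM.
apply: (@dominated_cvg_close _ (k%:R + 2 + `|a| + 1)).
  by apply: measurable_funM => //; exact: measurable_funX.
move=> eta eta0; pose h := Num.min 1 eta.
have h0 : 0 < h by rewrite lt_min ltr01.
have h1 : h <= 1 by rewrite ge_min lexx.
have heta : h <= eta by rewrite ge_min lexx orbT.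
exists (fun x => h^-1 * (x ^+ k * expR ((a + h) * x)) +
                 - h^-1 * (x ^+ k * expR (a * x))).
  by apply: dominated_cvg_lin; [exact: IH|exact: dominated_cvgZ].
move=> x.
have -> : x ^+ k.+1 * expR (a * x) -
  (h^-1 * (x ^+ k * expR ((a + h) * x)) + - h^-1 * (x ^+ k * expR (a * x))) =
  - (h^-1 * (x ^+ k * expR (a * x) * (expR (h * x) - 1 - h * x))).
  rewrite mulrDl expRD exprS; field.
  by rewrite gt_eqF.
rewrite normrN !normrM normfV (ger0_norm (ltW h0)).
rewrite (ger0_norm (expR_ge0 (a * x))) normrX.
have B1 : `|x| ^+ k <= expR (k%:R * `|x|) by exact: expr_le_expR.
have B2 : expR (a * x) <= expR (`|a| * `|x|) by rewrite -normrM ler_expR_norm.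
have B3 : `|expR (h * x) - 1 - h * x| <= h ^+ 2 * (expR (2 * `|x|) * expR `|x|).
  apply: (le_trans (expR_taylor1 _)).
  rewrite exprMn -mulrA ler_wpM2l ?sqr_ge0//.
  apply: ler_pM; rewrite ?sqr_ge0 ?expR_ge0//.
    by rewrite -(real_normK (num_real x)) expr_le_expR.
  by rewrite ler_expR normrM (ger0_norm (ltW h0)) ler_piMl.
apply: (@le_trans _ _ (h^-1 * (expR (k%:R * `|x|) * expR (`|a| * `|x|) *
    (h ^+ 2 * (expR (2 * `|x|) * expR `|x|))))).
  rewrite ler_wpM2l ?invr_ge0 ?(ltW h0)//.
  apply: ler_pM; rewrite ?mulr_ge0 ?exprn_ge0 ?expR_ge0//.
  by apply: ler_pM; rewrite ?exprn_ge0 ?expR_ge0.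
rewrite mulrCA [X in _ * X]mulrA expr2 mulKf ?gt_eqF// mulrCA -!expRD.
rewrite ler_pM ?expR_ge0 ?(ltW h0)// ler_expR.
by rewrite le_eqVlt; apply/orP; left; apply/eqP; ring.
Qed.

(** A bounded family of power series is controlled in the weight
    [expR (2 * `|y|)]: the tail loses a factor [2 ^- K]. *)
Lemma series_tail_le (y l : R) (u : nat -> R) K :
  (forall k, `|u k| <= exp_coeff `|y| k) -> series u @ \oo --> l ->
  `|l - series u K| <= 2 ^- K * expR (2 * `|y|).
Proof.
move=> ule ucvg.
have cv : `|series u n - series u K| @[n --> \oo] --> `|l - series u K|.
  by apply: cvg_norm; apply: cvgB => //; exact: cvg_cst.
apply: (cvgr_to_le cv).
near=> n.
have Kn : (K <= n)%N by near: n; exact: nbhs_infty_ge.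
rewrite sub_series_geq// (le_trans (ler_norm_sum _ _ _))//.
apply: (@le_trans _ _ (\sum_(K <= k < n) 2 ^- K * exp_coeff (2 * `|y|) k)).
  rewrite !big_nat; apply: ler_sum => k /andP[Kk _].
  apply: (le_trans (ule k)); rewrite /exp_coeff/= exprMn.
  rewrite [leRHS](_ : _ = 2 ^- K * 2 ^+ k * (`|y| ^+ k / k`!%:R)); last by rewrite !mulrA.
  rewrite ler_peMl ?mulr_ge0 ?exprn_ge0 ?invr_ge0//.
  by rewrite mulrC -(subnK Kk) exprD mulfK ?expf_neq0// exprn_ege1// ler1n.
rewrite -mulr_sumr ler_wpM2l ?invr_ge0 ?exprn_ge0// -sub_series_geq//.
have y0 : 0 <= 2 * `|y| by rewrite mulr_ge0.
rewrite (@le_trans _ _ (series (exp_coeff (2 * `|y|)) n))//.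
  by rewrite lerBlDr lerDl /series/= sumr_ge0// => i _; rewrite exp_coeff_ge0.
exact: series_exp_coeff_le.
Unshelve. all: by end_near. Qed.

(** The partial sums are polynomials, covered by [dominated_cvg_monomial]; the
    bound on the coefficients makes the tail small in the weight. *)
Lemma dominated_cvg_power_series (F : R -> R) (c : nat -> R) :
  measurable_fun [set: R] F -> (forall k, `|c k| <= k`!%:R^-1) ->
  (forall x, series (fun k => c k * x ^+ k) @ \oo --> F x) ->
  forall u, dominated_cvg (fun x => F (u * x)).
Proof.
move=> mF cle Fcvg u.
apply: (@dominated_cvg_close _ (2 * `|u|)).
  by apply: measurableT_comp => //; exact: measurable_funM.
move=> eta eta0.
have [K Keta] : exists K, (2 : R) ^- K <= eta.
  have [K _ /(_ K (leqnn _))/= hK] := near_infty_natSinv_lt (PosNum eta0).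
  exists K; apply: ltW; apply: le_lt_trans hK.
  by rewrite lef_pV2 ?posrE ?exprn_gt0// -natrX ler_nat ltn_expl.
exists (fun x => \sum_(0 <= k < K) (c k * u ^+ k) * (x ^+ k * expR (0 * x))).
  apply: dominated_cvg_sum => k; apply: dominated_cvgZ.
  exact: dominated_cvg_monomial.
move=> x.
have -> : \sum_(0 <= k < K) (c k * u ^+ k) * (x ^+ k * expR (0 * x)) =
    series (fun k => c k * (u * x) ^+ k) K.
  by apply: eq_bigr => k _; rewrite mul0r expR0 mulr1 exprMn mulrA.
apply: (@le_trans _ _ (2 ^- K * expR (2 * `|u * x|))).
  apply: series_tail_le => // k; rewrite normrM normrX /exp_coeff/= mulrC.
  by rewrite ler_wpM2l// exprn_ge0.
by rewrite normrM !mulrA ler_wpM2r// expR_ge0.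
Qed.

Lemma dominated_cvg_cos u : dominated_cvg (fun x => cos (u * x)).
Proof.
apply: (@dominated_cvg_power_series cos
  (fun k => (~~ odd k)%:R * (-1) ^+ k./2 * k`!%:R^-1)).
- by apply: continuous_measurable_fun; exact: continuous_cos.
- move=> k; rewrite !normrM normrX normrN1 expr1n mulr1 normfV !normr_nat.
  by rewrite ler_piMl ?invr_ge0//; case: odd.
- by move=> x; rewrite cosE; have := @is_cvg_series_cos_coeff R x; rewrite cos_coeffE.
Qed.

Lemma dominated_cvg_sin u : dominated_cvg (fun x => sin (u * x)).
Proof.
apply: (@dominated_cvg_power_series sin
  (fun k => (odd k)%:R * (-1) ^+ k.-1./2 * k`!%:R^-1)).
- by apply: continuous_measurable_fun; exact: continuous_sin.
- move=> k; rewrite !normrM normrX normrN1 expr1n mulr1 normfV !normr_nat.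
  by rewrite ler_piMl ?invr_ge0//; case: odd.
- by move=> x; rewrite sinE; have := @is_cvg_series_sin_coeff R x; rewrite sin_coeffE.
Qed.

End mgf_convergence.

(** * Bernstein polynomials in a sine *)

Section bernstein.
Variable R : realType.
Implicit Types (F G : nat -> R) (y : R).

(** The mean of [F] under the binomial law with parameters [n] and [y], by
    conditioning on the first trial. *)
Fixpoint bernstein n F y : R :=
  if n is n'.+1 then y * bernstein n' (F \o S) y + (1 - y) * bernstein n' F y
  else F 0%N.

Lemma bernstein_lin n a F G y :
  bernstein n (fun k => a * F k + G k) y = a * bernstein n F y + bernstein n G y.
Proof.
elim: n F G => [//|n IH] F G /=.
have -> : (fun k => a * F k + G k) \o S = (fun k => a * (F \o S) k + (G \o S) k) by [].
by rewrite !IH; ring.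
Qed.

Lemma bernstein_cst n a y : bernstein n (fun=> a) y = a.
Proof.
elim: n => [//|n IH] /=.
have -> : (fun=> a) \o S = (fun=> a) by [].
by rewrite IH; ring.
Qed.

Lemma le_bernstein n F G y : 0 <= y <= 1 ->
  (forall k, (k <= n)%N -> F k <= G k) -> bernstein n F y <= bernstein n G y.
Proof.
move=> /andP[y0 y1]; elim: n F G => [|n IH] F G FG /=; first exact: FG.
apply: lerD; rewrite ler_wpM2l ?subr_ge0//; apply: IH => k kn.
  exact: FG.
by apply: FG; rewrite (leq_trans kn).
Qed.

(** Second moment about [- c] of the binomial law. *)
Lemma bernstein_square n c y :
  bernstein n (fun k => (k%:R + c) ^+ 2) y =
  (n%:R * y + c) ^+ 2 + n%:R * y * (1 - y).
Proof.
elim: n c => [|n IH] c /=; first by rewrite mul0r mul0r addr0.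
have -> : (fun k => (k%:R + c) ^+ 2) \o S = (fun k => (k%:R + (1 + c)) ^+ 2).
  by apply/funext => k /=; rewrite -natr1 addrA.
by rewrite !IH -natr1; ring.
Qed.

(** Chebyshev's inequality: the values of the binomial law at distance at
    least [delta] from its mean are controlled by its variance. *)
Lemma bernstein_approx (g : R -> R) C eta delta n y : 0 <= y <= 1 ->
  (0 < n)%N -> 0 < delta -> 0 <= C ->
  (forall v, `|g v| <= C) ->
  (forall v, 0 <= v <= 1 -> `|y - v| < delta -> `|g y - g v| <= eta) ->
  `|bernstein n (fun k => g (k%:R / n%:R)) y - g y|
    <= eta + 2 * C / (delta ^+ 2 * n%:R).
Proof.
move=> y01 n0 d0 C0 gC gcont.
have n0' : 0 < n%:R :> R by rewrite ltr0n.
have eta0 : 0 <= eta by apply: le_trans (gcont y y01 _); rewrite ?subrr ?normr0.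
pose K := 2 * C / (delta ^+ 2 * n%:R ^+ 2).
have K0 : 0 <= K by apply: divr_ge0; apply: mulr_ge0 => //; exact: sqr_ge0.
pose H := fun k : nat => K * (k%:R + - (n%:R * y)) ^+ 2 + eta.
have HE : bernstein n H y <= eta + 2 * C / (delta ^+ 2 * n%:R).
  rewrite /H bernstein_lin bernstein_cst bernstein_square subrr expr0n/= add0r addrC lerD2l.
  have -> : 2 * C / (delta ^+ 2 * n%:R) = K * n%:R.
    by rewrite /K; field; rewrite !gt_eqF.
  case/andP: y01 => y0 y1.
  by rewrite ler_wpM2l// -mulrA ler_piMr// ?ltW//; nra.
have gH k : (k <= n)%N -> `|g (k%:R / n%:R) - g y| <= H k.
  move=> kn; have [ltd|led] := ltP `|y - k%:R / n%:R| delta.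
    rewrite distrC (le_trans (gcont _ _ ltd))//; last first.
      by rewrite /H lerDr mulr_ge0 ?sqr_ge0.
    by rewrite divr_ge0//= ler_pdivrMr// mul1r ler_nat.
  rewrite (@le_trans _ _ (2 * C))//.
    by rewrite (le_trans (ler_normB _ _))// (_ : 2 * C = C + C) ?lerD//; ring.
  rewrite /H ler_wpDr//.
  have -> : K * (k%:R - n%:R * y) ^+ 2 = 2 * C * ((y - k%:R / n%:R) ^+ 2 / delta ^+ 2).
    by rewrite /K; field; rewrite !gt_eqF.
  rewrite ler_peMr ?mulr_ge0// ler_pdivlMr ?exprn_gt0// mul1r.
  by rewrite -(real_normK (num_real (y - _))) lerXn2r ?nnegrE// ltW.
apply: le_trans HE; rewrite ler_norml; apply/andP; split.
  rewrite -subr_ge0 opprK.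
  have -> : bernstein n (fun k => g (k%:R / n%:R)) y - g y + bernstein n H y =
    bernstein n (fun k => 1 * (g (k%:R / n%:R)) + (1 * H k + (- g y))) y.
    by rewrite [RHS]bernstein_lin [in RHS](bernstein_lin n 1 H) bernstein_cst; ring.
  rewrite -(bernstein_cst n 0 y); apply: le_bernstein => // k kn.
  by have := gH k kn; rewrite ler_norml => /andP[]; lra.
rewrite lerBlDr; have -> : bernstein n H y + g y =
  bernstein n (fun k => 1 * H k + g y) y.
  by rewrite [RHS](bernstein_lin n 1 H) bernstein_cst mul1r.
apply: le_bernstein => // k kn.
by have := gH k kn; rewrite ler_norml => /andP[]; lra.
Qed.

End bernstein.

Section trigonometric.
Variable R : realType.

(** This span is stable under multiplication by a sine, so that polynomials
    in a sine belong to it although [dominated_cvg] has no product rule. *)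
Inductive trigonometric : (R -> R) -> Prop :=
| trigonometric_cos u : trigonometric (fun x => cos (u * x))
| trigonometric_sin u : trigonometric (fun x => sin (u * x))
| trigonometric_lin a f g : trigonometric f -> trigonometric g ->
    trigonometric (fun x => a * f x + g x).

Lemma trigonometric_sinM c f : trigonometric f ->
  trigonometric (fun x => sin (c * x) * f x).
Proof.
elim=> {f} [u|u|a f g _ IHf _ IHg].
- have -> : (fun x => sin (c * x) * cos (u * x)) =
    (fun x => 2^-1 * sin ((c + u) * x) +
              (- 2^-1 * sin ((c - u) * x) + sin ((c - u) * x))).
    by apply/funext => x; rewrite !mulrDl !mulNr !sinD sinN cosN; field.
  apply: (trigonometric_lin 2^-1 (trigonometric_sin (c + u))
    (trigonometric_lin (- 2^-1) (trigonometric_sin (c - u)) (trigonometric_sin (c - u)))).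
- have -> : (fun x => sin (c * x) * sin (u * x)) =
    (fun x => 2^-1 * cos ((c - u) * x) +
              (- (3 / 2) * cos ((c + u) * x) + cos ((c + u) * x))).
    by apply/funext => x; rewrite !mulrDl !mulNr !cosD sinN cosN; field.
  apply: (trigonometric_lin 2^-1 (trigonometric_cos (c - u))
    (trigonometric_lin (- (3 / 2)) (trigonometric_cos (c + u)) (trigonometric_cos (c + u)))).
- have -> : (fun x => sin (c * x) * (a * f x + g x)) =
    (fun x => a * (sin (c * x) * f x) + sin (c * x) * g x).
    by apply/funext => x; ring.
  exact: trigonometric_lin.
Qed.

Lemma trigonometric_bernstein c n (F : nat -> R) f : trigonometric f ->
  trigonometric (fun x => bernstein n F ((1 + sin (c * x)) / 2) * f x).
Proof.
elim: n F f => [|n IH] F f tf /=.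
  have -> : (fun x => F 0%N * f x) = (fun x => (F 0%N - 1) * f x + f x).
    by apply/funext => x; ring.
  exact: trigonometric_lin.
have tsf := trigonometric_sinM c tf.
set y := fun x => (1 + sin (c * x)) / 2.
have ty : trigonometric (fun x => y x * f x).
  have -> : (fun x => y x * f x) =
    (fun x => 2^-1 * (sin (c * x) * f x) + (- 2^-1 * f x + f x)).
    by apply/funext => x; rewrite /y; field.
  by do 2 apply: trigonometric_lin => //.
have ty' : trigonometric (fun x => (1 - y x) * f x).
  have -> : (fun x => (1 - y x) * f x) = (fun x => -1 * (y x * f x) + f x).
    by apply/funext => x; ring.
  exact: trigonometric_lin.
have -> : (fun x => (y x * bernstein n (F \o S) (y x) +
     (1 - y x) * bernstein n F (y x)) * f x) =
  (fun x => 1 * (bernstein n (F \o S) (y x) * (y x * f x)) +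
     bernstein n F (y x) * ((1 - y x) * f x)).
  by apply/funext => x; ring.
by apply: trigonometric_lin; exact: IH.
Qed.

End trigonometric.

Lemma continuous_uniform_01 (R : realType) (g : R -> R) (eta : R) :
  continuous g -> 0 < eta ->
  exists2 delta, 0 < delta & forall y v, 0 <= y <= 1 ->
    `|y - v| < delta -> `|g y - g v| <= eta.
Proof.
move=> cg eta0.
have /compact_near_coveringP cov := @segment_compact R 0 1.
have := cov R 0^'+ (fun e x => forall v, `|x - v| < e -> `|g x - g v| <= eta) _.
case.
  move=> x _; have e20 : 0 < eta / 2 by rewrite divr_gt0.
  have /cvgrPdist_lt/(_ _ e20) := cg x.
  move=> /nbhs_ballP[r /= r0 xr].
  exists (ball x (r / 2), [set e | 0 < e < r / 2]) => /=.
    split; first by apply: nbhsx_ballx; rewrite divr_gt0.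
    exists (r / 2) => /=; first by rewrite divr_gt0.
    by move=> z /=; rewrite sub0r normrN => zr z0; rewrite z0/= -(ger0_norm (ltW z0)).
  move=> [x' e] /= [xx' /andP[e0 er]] v x'v.
  have h1 : `|g x - g x'| < eta / 2.
    by apply: xr; apply: lt_trans xx' _; rewrite ltr_pdivrMr// ltr_pMr// ltr1n.
  have h2 : `|g x - g v| < eta / 2.
    apply: xr; rewrite /ball/= (splitr r) -(subrK x' x) -addrA.
    rewrite (le_lt_trans (ler_normD _ _))// ltrD//.
    exact: lt_trans er.
  rewrite -(subrK (g x) (g x')) -addrA (le_trans (ler_normD _ _))//.
  by rewrite (splitr eta) lerD// ltW// distrC.
move=> r /= r0 hr; exists (r / 2); first by rewrite divr_gt0.
move=> z v z01; apply: (hr (r / 2)) => //=.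
- by rewrite sub0r normrN ger0_norm ?divr_ge0 ?ltW// ltr_pdivrMr// ltr_pMr// ltr1n.
- by rewrite divr_gt0.
Qed.

(** * From moment generating functions to convergence in distribution *)

Section weak_limit.
Context {R : realType} (disp : nat -> measure_display).
Context (Omega : forall n, measurableType (disp n)).
Context (P : forall n, probability (Omega n) R) (X : forall n, Omega n -> R).
Context (nu : probability (measurableTypeR R) R).
Arguments X : clear implicits.
Hypothesis mX : forall n, measurable_fun [set: Omega n] (X n).
Hypothesis intX : forall n a, (P n).-integrable [set: Omega n]
  (EFin \o (fun w => expR (a * X n w))).
Hypothesis intnu : forall a, nu.-integrable [set: measurableTypeR R]
  (EFin \o (fun x : measurableTypeR R => expR (a * x))).
Hypothesis mgf_cvg : forall a, \int[P n]_w expR (a * X n w) @[n --> \oo]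
  --> \int[nu]_x expR (a * x).

Lemma trigonometric_dominated_cvg f : trigonometric f -> dominated_cvg P X nu f.
Proof.
elim=> {f} [u|u|a f g _ IHf _ IHg].
- exact: dominated_cvg_cos.
- exact: dominated_cvg_sin.
- exact: dominated_cvg_lin.
Qed.

(** On a large interval [f] is a continuous function of [sin (x / (2 * L))],
    which Bernstein polynomials approximate; outside of it both functions are
    bounded, hence small in the weight [expR `|x|]. *)
Lemma bounded_continuous_dominated_cvg (f : R -> R) C :
  continuous f -> (forall x, `|f x| <= C) -> dominated_cvg P X nu f.
Proof.
move=> cf fC; apply: (@dominated_cvg_close _ _ _ _ _ _ mX intX intnu mgf_cvg f 1) => //.
  exact: continuous_measurable_fun.
move=> eta eta0.
have C0 : 0 <= C by apply: le_trans (fC 0).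
(* Outside of [-L, L] the crude bound [2 * C] is below [eta * expR `|x|]. *)
pose L := 2 * C / eta + 1.
have L0 : 0 < L by rewrite ltr_wpDl// divr_ge0 ?mulr_ge0// ltW.
pose s : R := sin 2^-1.
have hpi : 2^-1 < pi / 2 :> R by have := @pihalf_ge1 R; lra.
have half : (2^-1 : R) \in `[(- (pi / 2)), (pi / 2)].
  by rewrite in_itv/=; apply/andP; split; lra.
have pihalf : (pi / 2 : R) \in `[(- (pi / 2)), (pi / 2)].
  by rewrite in_itv/=; apply/andP; split; lra.
have zer : (0 : R) \in `[(- (pi / 2)), (pi / 2)].
  by rewrite in_itv/=; apply/andP; split; lra.
have s1 : s < 1 by rewrite -sin_pihalf ltr_sin.
have s0 : 0 < s by rewrite -sin0 ltr_sin//; lra.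
(* [asin] is continuous only inside of ]-1, 1[; the clamping is the identity
   on the values that [sin] takes over the rescaled interval. *)
pose clamp (v : R) : R := Num.max (- s) (Num.min s v).
have clampE v : - s <= v <= s -> clamp v = v.
  by move=> /andP[sv vs]; rewrite /clamp min_r// max_r.
have clampB v : -1 < clamp v < 1.
  rewrite /clamp lt_max gt_max gt_min ltrNl opprK s1/= ltrNl.
  by rewrite (lt_trans _ s0)//= ?ltrN10// s1.
pose g (v : R) : R := f (2 * L * asin (clamp (2 * v - 1))).
have cg : continuous g.
  have c1 : continuous (fun v : R => clamp (2 * v - 1)).
    move=> v; have h1 : {for v, continuous (fun v : R => 2 * v - 1 : R^o)}.
      by apply: cvgB; [apply: cvgMr; exact: cvg_id|exact: cvg_cst].
    have h2 := continuous_min (@cst_continuous _ R^o s _) h1.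
    exact: (continuous_max (@cst_continuous _ R^o (- s) _) h2).
  have c2 : continuous (fun v : R => 2 * L * asin (clamp (2 * v - 1))).
    move=> v; apply: cvgMr.
    have ca : {for clamp (2 * v - 1), continuous (@asin R)}.
      exact/continuous_asin/clampB.
    exact: (continuous_comp (c1 v) ca).
  by move=> v; exact: (continuous_comp (c2 v) (cf _)).
have e20 : 0 < eta / 2 by rewrite divr_gt0.
have [delta d0 unif] := continuous_uniform_01 cg e20.
have [n n0 nlarge] : exists2 n, (0 < n)%N &
    2 * C / (delta ^+ 2 * n%:R) <= eta / 2.
  pose k := Num.truncn (2 * C / (delta ^+ 2 * (eta / 2))).
  exists k.+1 => //; rewrite ler_pdivrMr ?mulr_gt0 ?exprn_gt0//.
  have := truncnS_gt (2 * C / (delta ^+ 2 * (eta / 2))).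
  rewrite -/k ltr_pdivrMr ?mulr_gt0 ?exprn_gt0// => /ltW h.
  by rewrite (le_trans h)// le_eqVlt; apply/orP; left; apply/eqP; ring.
exists (fun x => bernstein n (fun k => g (k%:R / n%:R))
                  ((1 + sin ((2 * L)^-1 * x)) / 2)).
  have -> : (fun x => bernstein n (fun k => g (k%:R / n%:R))
               ((1 + sin ((2 * L)^-1 * x)) / 2)) =
      (fun x => bernstein n (fun k => g (k%:R / n%:R))
               ((1 + sin ((2 * L)^-1 * x)) / 2) * cos (0 * x)).
    by apply/funext => x; rewrite mul0r cos0 mulr1.
  apply: trigonometric_dominated_cvg; apply: trigonometric_bernstein.
  exact: trigonometric_cos.
move=> x; rewrite mul1r.
set y := (1 + _) / 2.
have y01 : 0 <= y <= 1.
  have := sin_le1 ((2 * L)^-1 * x); have := sin_geN1 ((2 * L)^-1 * x).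
  by rewrite /y; move=> ? ?; apply/andP; split; lra.
have gC v : `|g v| <= C by exact: fC.
have [xL|Lx] := leP `|x| L; last first.
  apply: (@le_trans _ _ (2 * C)).
    rewrite (le_trans (ler_normB _ _))// (_ : 2 * C = C + C); last by ring.
    rewrite lerD// ler_norml; apply/andP; split.
      rewrite -(bernstein_cst n (- C) y); apply: le_bernstein => // k _.
      by have := gC (k%:R / n%:R); rewrite ler_norml => /andP[].
    rewrite -[leRHS](bernstein_cst n C y); apply: le_bernstein => // k _.
    by have := gC (k%:R / n%:R); rewrite ler_norml => /andP[].
  rewrite [leRHS]mulrC -ler_pdivrMr//; apply: (le_trans _ (expR_ge1Dx _)).
  by rewrite addrC (le_trans _ (lerD (ltW Lx) (lexx 1)))// /L -addrA lerDl.
have xs : - 2^-1 <= (2 * L)^-1 * x <= 2^-1.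
  move: xL; rewrite ler_norml => /andP[x1 x2].
  have -> : (2 * L)^-1 * x = 2^-1 * (x / L) by rewrite invfM; ring.
  have h1 : x / L <= 1 by rewrite ler_pdivrMr// mul1r.
  have h2 : -1 <= x / L by rewrite ler_pdivlMr// mulN1r.
  by apply/andP; split; lra.
have ax : (2 * L)^-1 * x \in `[(- (pi / 2)), (pi / 2)].
  by rewrite in_itv/=; case/andP: xs => ? ?; apply/andP; split; lra.
have fg : f x = g y.
  have Ey : 2 * y - 1 = sin ((2 * L)^-1 * x) by rewrite /y; field.
  rewrite /g Ey clampE; last first.
    rewrite -sinN !leNgt !ltr_sin//; last by rewrite in_itv/=; apply/andP; split; lra.
    by case/andP: xs => ? ?; rewrite -!leNgt; apply/andP.
  rewrite sinK//; congr f; field.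
  by rewrite gt_eqF.
rewrite fg distrC; apply: (@le_trans _ _ eta); last first.
  by rewrite ler_peMr ?(ltW eta0)// -expR0 ler_expR.
have -> : eta = eta / 2 + eta / 2 by field.
apply: le_trans (lerD (lexx _) nlarge).
by apply: bernstein_approx => // v v01; exact: unif.
Qed.

End weak_limit.

(** The hypotheses bear on positive indices only, which shifting the sequence
    reduces to [bounded_continuous_dominated_cvg]. *)
Theorem mgf_cvg_in_distribution (R : realType) (disp : nat -> measure_display)
    (Omega : forall n, measurableType (disp n))
    (P : forall n, probability (Omega n) R) (X : forall n, Omega n -> R)
    (nu : probability (measurableTypeR R) R) :
  (forall n, (0 < n)%N -> measurable_fun [set: Omega n] (@X n)) ->
  (forall n a, (0 < n)%N -> (P n).-integrable [set: Omega n]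
     (EFin \o (fun w => expR (a * X n w)))) ->
  (forall a, nu.-integrable [set: measurableTypeR R]
     (EFin \o (fun x : measurableTypeR R => expR (a * x)))) ->
  (forall a, \int[P n]_w expR (a * X n w) @[n --> \oo]
     --> \int[nu]_x expR (a * x)) ->
  cvg_in_distribution P X nu.
Proof.
move=> mX intX intnu mgf; split; first by near=> n; apply: mX; near: n; exact: nbhs_infty_gt.
move=> f cf [C fC].
have mS n : measurable_fun [set: Omega n.+1] (@X n.+1) by exact: mX.
have iS n a : (P n.+1).-integrable [set: Omega n.+1]
     (EFin \o (fun w => expR (a * X n.+1 w))) by exact: intX.
have cS a : \int[P n.+1]_w expR (a * X n.+1 w) @[n --> \oo]
     --> \int[nu]_x expR (a * x).
  have := mgf a.
  by rewrite -(cvg_shiftS (fun n => \int[P n]_w expR (a * X n w))).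
have [mf [C' [b fb]] fcvg] :=
  bounded_continuous_dominated_cvg mS iS intnu cS cf fC.
rewrite -(cvg_shiftS (fun n => (\int[P n]_w (f (X n w))%:E)%E)) /=.
have toR d (T : measurableType d) (Q : probability T R) (Y : T -> R) :
    measurable_fun setT Y ->
    (forall a, Q.-integrable setT (EFin \o (fun w => expR (a * Y w)))) ->
    (\int[Q]_w (f (Y w))%:E)%E = (\int[Q]_w f (Y w))%:E.
  move=> mY iY; rewrite /Rintegral fineK//.
  by apply: integrable_fin_num => //; exact: (integrable_expR_dom mY iY mf fb).
under eq_fun do rewrite toR//.
rewrite (toR _ _ nu id)//.
by apply: cvg_EFin => //; near=> n.
Unshelve. all: by end_near. Qed.

(** * Exponential moments of the normal law *)

Section normal_mgf.
Variable R : realType.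
Notation leb := (@lebesgue_measure R).

Lemma ge0_integral_normal_prob (s : R) (f : R -> \bar R) :
  measurable_fun [set: R] f -> (forall x, 0 <= f x)%E ->
  (\int[normal_prob 0 s]_x f x =
   \int[leb]_x (f x * (normal_pdf 0 s x)%:E))%E.
Proof.
move=> mf f0.
have dom : normal_prob 0 s `<< leb := @normal_prob_dominates R 0 s.
rewrite -(Radon_Nikodym_SigmaFinite.change_of_variables dom f0)//.
apply: ae_eq_integral => //.
- apply: emeasurable_funM => //.
  exact: (measurable_int leb (Radon_Nikodym_SigmaFinite.f_integrable dom)).
- apply: emeasurable_funM => //.
  by apply/measurable_EFinP; exact: measurable_normal_pdf.
apply: ae_eqe_mul2l; apply: integral_ae_eq => //.
- exact: Radon_Nikodym_SigmaFinite.f_integrable.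
- by apply/measurable_EFinP; exact: measurable_normal_pdf.
- by move=> A _ mA; rewrite -Radon_Nikodym_SigmaFinite.f_integral.
Qed.

(** Completing the square, the factor [expR (a * x)] turns the density of mean
    [0] into a multiple of the density of mean [s ^+ 2 * a]. *)
Lemma normal_prob_mgf (s a : R) : s != 0 ->
  (\int[normal_prob 0 s]_x (expR (a * x))%:E = (expR (s ^+ 2 * a ^+ 2 / 2))%:E)%E.
Proof.
move=> s0; rewrite ge0_integral_normal_prob//; last first.
  apply/measurable_EFinP; apply: measurableT_comp => //; exact: measurable_funM.
under eq_integral => x _.
  have -> : ((expR (a * x))%:E * (normal_pdf 0 s x)%:E =
    (expR (s ^+ 2 * a ^+ 2 / 2))%:E * (normal_pdf (s ^+ 2 * a) s x)%:E)%E.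
    rewrite -!EFinM; congr EFin; rewrite !normal_pdfE//.
    rewrite mulrCA [RHS]mulrCA; congr (_ * _).
    rewrite /normal_fun -!expRD; congr expR; field.
    by rewrite s0.
  over.
rewrite integralZl//; last exact: integrable_normal_pdf.
by rewrite integral_normal_pdf mule1.
Qed.

Lemma normal_law_mgf (v a : R) : 0 <= v ->
  (\int[normal_law 0 v]_x (expR (a * x))%:E = (expR (v * a ^+ 2 / 2))%:E)%E.
Proof.
move=> v0; rewrite /normal_law; case: eqVneq => [->|vn0].
  rewrite integral_dirac//; last first.
    apply/measurable_EFinP; apply: measurableT_comp => //; exact: measurable_funM.
  by rewrite diracT mul1e mulr0 !mul0r.
rewrite normal_prob_mgf ?sqr_sqrtr//.
by rewrite sqrtr_eq0 -ltNge lt_def vn0.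
Qed.

Lemma normal_law_integrable_expR (v a : R) : 0 <= v ->
  (normal_law 0 v).-integrable [set: measurableTypeR R]
    (EFin \o (fun x : measurableTypeR R => expR (a * x))).
Proof.
move=> v0; apply/integrableP; split.
  apply/measurable_EFinP; apply: measurableT_comp => //; exact: measurable_funM.
under eq_integral do rewrite /= ger0_norm ?expR_ge0//.
by rewrite normal_law_mgf// ltry.
Qed.

End normal_mgf.

(** * Transition matrices *)

Section transition_matrix.
Variables (R : realType) (d : nat) (A : 'M[R]_d).

Definition mxabs_sum : R := \sum_i \sum_j `|A i j|.

Lemma mxabs_sum_ge0 : 0 <= mxabs_sum.
Proof. by do 2 apply: sumr_ge0 => ? _. Qed.

Lemma row_abs_le_mxabs_sum i : \sum_j `|A i j| <= mxabs_sum.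
Proof.
by rewrite /mxabs_sum [leRHS](bigD1 i)//= lerDl; do 2 apply: sumr_ge0 => ? _.
Qed.

Lemma exp_mx_le k i j : `|(A ^+ k) i j| <= mxabs_sum ^+ k.
Proof.
elim: k i j => [|k IH] i j.
  by rewrite !expr0 mxE; case: (i == j); rewrite ?normr0 ?normr1.
rewrite !exprS mxE (le_trans (ler_norm_sum _ _ _))//.
apply: le_trans (ler_wpM2r _ (row_abs_le_mxabs_sum i)); last first.
  by rewrite exprn_ge0// mxabs_sum_ge0.
rewrite mulr_suml; apply: ler_sum => l _.
by rewrite normrM ler_wpM2l.
Qed.

Lemma scale_exp_mx (t : R) k : (t *: A) ^+ k = t ^+ k *: A ^+ k.
Proof.
elim: k => [|k IH]; first by rewrite !expr0 scale1r.
rewrite !exprS IH -[LHS]/(_ *m _) -[in RHS]/(_ *m _).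
by rewrite -scalemxAl -scalemxAr scalerA.
Qed.

Definition transition_coeff i j (k : nat) : R := (A ^+ k) i j / k`!%:R.

Lemma transitionE i j :
  (fun t => transition A t i j) = (fun t => limn (pseries (transition_coeff i j) t)).
Proof.
apply/funext => t; rewrite /transition /expmx mxE; congr (limn (series _)).
by apply/funext => k; rewrite scale_exp_mx mxE /transition_coeff mulrC -mulrA mulrC.
Qed.

Lemma transition_term_le i j t k :
  `|transition_coeff i j k * t ^+ k| <= exp_coeff (mxabs_sum * `|t|) k.
Proof.
rewrite /exp_coeff/= !normrM normfV normr_nat exprMn normrX mulrAC.
by rewrite ler_wpM2r ?invr_ge0// ler_wpM2r ?exprn_ge0// exp_mx_le.
Qed.

Lemma is_cvg_transition i j t : cvgn (pseries (transition_coeff i j) t).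
Proof.
apply: normed_cvg; apply: (series_le_cvg _ _ (transition_term_le i j t)) => //.
- by move=> k; rewrite exp_coeff_ge0// mulr_ge0// mxabs_sum_ge0.
- exact: is_cvg_series_exp_coeff.
Qed.

Lemma transition_cvg i j t :
  pseries (transition_coeff i j) t @ \oo --> transition A t i j.
Proof.
by have /(congr1 (@^~ t)) /= -> := transitionE i j; exact: is_cvg_transition.
Qed.

Lemma transition0 : transition A 0 = 1%:M.
Proof.
apply/matrixP => i j; have := @transition_cvg i j 0.
move=> /cvg_lim => <-//; apply: lim_near_cst => //; near=> n.
rewrite /pseries /series /= -(prednK (_ : 0 < n)%N); last by near: n; exact: nbhs_infty_gt.
rewrite big_nat_recl// big1 ?addr0.
  by rewrite /transition_coeff !expr0 divr1 mulr1.
by move=> k _; rewrite exprS mul0r mulr0.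
Unshelve. all: by end_near. Qed.

Lemma transition_coeff_diffs i j :
  pseries_diffs (transition_coeff i j) =
  (fun k => \sum_l A i l * transition_coeff l j k).
Proof.
apply/funext => k; rewrite /pseries_diffs /transition_coeff exprS mxE.
rewrite mulr_suml mulr_sumr; apply: eq_bigr => l _.
rewrite factS natrM invfM -!mulrA; field.
by rewrite pnatr_eq0 -lt0n fact_gt0/= addrC natr1 pnatr_eq0.
Qed.

Lemma is_cvg_lincomb (c : 'I_d -> R) (u : 'I_d -> nat -> R) (l : 'I_d -> R) x :
  (forall i, pseries (u i) x @ \oo --> l i) ->
  pseries (fun k => \sum_i c i * u i k) x @ \oo --> \sum_i c i * l i.
Proof.
move=> ul; have -> : pseries (fun k => \sum_i c i * u i k) x =
    (fun n => \sum_i c i * pseries (u i) x n).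
  apply/funext => n; rewrite /pseries /series/=.
  under [RHS]eq_bigr do rewrite mulr_sumr.
  rewrite exchange_big/=; apply: eq_bigr => k _; rewrite mulr_suml.
  by apply: eq_bigr => i _; rewrite mulrA.
apply: cvg_big => [|i _]; first exact: add_continuous.
by apply: cvgMr; exact: ul.
Qed.

(** Termwise differentiation of the power series: the backward equation. *)
Lemma is_derive_transition (i j : 'I_d) (t : R) :
  is_derive t (1 : R) (fun s : R => transition A s i j) (\sum_l A i l * transition A t l j).
Proof.
rewrite transitionE.
have c1 i' s : pseries (pseries_diffs (transition_coeff i' j)) s @ \oo -->
    \sum_l A i' l * transition A s l j.
  by rewrite transition_coeff_diffs; apply: is_cvg_lincomb => l; exact: transition_cvg.
have <- := cvg_lim (@Rhausdorff R) (c1 i t).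
apply: (@pseries_snd_diffs _ _ (`|t| + 1)).
- exact: is_cvg_transition.
- by apply/cvg_ex; eexists; exact: c1.
- rewrite transition_coeff_diffs.
  have -> : pseries_diffs (fun k => \sum_l A i l * transition_coeff l j k) =
    (fun k => \sum_l A i l * pseries_diffs (transition_coeff l j) k).
    apply/funext => k; rewrite /pseries_diffs mulr_sumr.
    by apply: eq_bigr => l _; rewrite mulrCA.
  apply/cvg_ex; eexists; apply: is_cvg_lincomb => l; exact: c1.
- by rewrite [ltRHS]ger0_norm// ltrDl.
Qed.

(** The terms of rank at least 2 are dominated by those of the exponential
    series at [mxabs_sum * `|t|]. *)
Lemma transition_taylor i j t :
  `|transition A t i j - (i == j)%:R - t * A i j|
    <= (mxabs_sum * `|t|) ^+ 2 * expR (mxabs_sum * `|t|).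
Proof.
set x := mxabs_sum * `|t|.
have x0 : 0 <= x by rewrite mulr_ge0// mxabs_sum_ge0.
apply: (@le_trans _ _ (expR x - 1 - x)); last first.
  apply: le_trans (ler_norm _) _.
  by have := expR_taylor1 x; rewrite (ger0_norm x0).
have c1 : `|pseries (transition_coeff i j) t n - (i == j)%:R - t * A i j| @[n --> \oo] -->
    `|transition A t i j - (i == j)%:R - t * A i j|.
  apply: cvg_norm; apply: cvgB; last exact: cvg_cst.
  by apply: cvgB; [exact: transition_cvg|exact: cvg_cst].
have c2 : series (exp_coeff x) n - 1 - x @[n --> \oo] --> expR x - 1 - x.
  apply: cvgB; last exact: cvg_cst.
  by apply: cvgB; [exact: is_cvg_series_exp_coeff|exact: cvg_cst].
apply: (ler_cvg_to c1 c2); near=> n.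
have n2 : (2 <= n)%N by near: n; exact: nbhs_infty_ge.
rewrite /pseries /series/=.
rewrite !(@big_ltn _ _ _ 0%N n) ?(leq_trans _ n2)// !(@big_ltn _ _ _ 1%N n)//.
rewrite {1 2}/transition_coeff {1 2}/exp_coeff/= !expr0 !expr1 !divr1 !mulr1 mxE.
rewrite [X in `|X|](_ : _ = \sum_(2 <= k < n) transition_coeff i j k * t ^+ k); last by ring.
rewrite [leRHS](_ : _ = \sum_(2 <= k < n) exp_coeff x k); last by ring.
apply: le_trans (ler_norm_sum _ _ _) _; apply: ler_sum => k _.
exact: transition_term_le.
Unshelve. all: by end_near. Qed.

End transition_matrix.

(** * Generator, Dirichlet form and the Poincare inequality *)

Section generator.
Variables (R : realType) (d : nat) (Q : 'M[R]_d) (pi : 'cV[R]_d).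
Hypothesis Q_rates : is_rate_matrix Q.
Hypothesis Q_irreducible : irreducible_rates Q.
Hypothesis pi_stationary : is_stationary Q pi.
Implicit Types f g : 'I_d -> R.

Definition pi_mean (w : 'cV[R]_d) f : R := \sum_i w i 0 * f i.
Definition generator (A : 'M[R]_d) f (i : 'I_d) : R := \sum_j A i j * f j.
Notation mean := (pi_mean pi).
Notation gen := (generator Q).

Lemma pi_meanD (w : 'cV[R]_d) a f g :
  pi_mean w (fun i => a * f i + g i) = a * pi_mean w f + pi_mean w g.
Proof.
rewrite /pi_mean mulr_sumr -big_split/=.
by apply: eq_bigr => i _; rewrite mulrDr mulrCA.
Qed.

Lemma pi_mean_cst a : mean (fun=> a) = a.
Proof. by case: pi_stationary => _ pi1 _; rewrite /pi_mean -mulr_suml pi1 mul1r. Qed.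

Lemma generatorD a f g i :
  gen (fun i => a * f i + g i) i = a * gen f i + gen g i.
Proof.
rewrite /generator mulr_sumr -big_split/=.
by apply: eq_bigr => j _; rewrite mulrDr mulrCA.
Qed.

Lemma generator_cst a i : gen (fun=> a) i = 0.
Proof. by case: Q_rates => _ rs; rewrite /generator -mulr_suml rs mul0r. Qed.

Lemma stationary_col j : \sum_i pi i 0 * Q i j = 0.
Proof.
case: pi_stationary => _ _ /matrixP/(_ 0 j); rewrite !mxE => h; rewrite -[RHS]h.
by apply: eq_bigr => i _; rewrite mxE.
Qed.

Lemma pi_mean_generator f : mean (gen f) = 0.
Proof.
rewrite /pi_mean /generator.
under eq_bigr do rewrite mulr_sumr.
rewrite exchange_big/= big1// => j _.
under eq_bigr do rewrite mulrA.
by rewrite -mulr_suml stationary_col mul0r.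
Qed.

Definition dirichlet f : R := \sum_i \sum_j pi i 0 * Q i j * (f i - f j) ^+ 2.

Lemma dirichlet_term_ge0 f i j : 0 <= pi i 0 * Q i j * (f i - f j) ^+ 2.
Proof.
have [<-|ij] := eqVneq i j; first by rewrite subrr expr0n mulr0.
case: Q_rates => /(_ i j ij) q0 _; case: pi_stationary => p0 _ _.
by rewrite mulr_ge0 ?sqr_ge0// mulr_ge0.
Qed.

Lemma dirichlet_ge0 f : 0 <= dirichlet f.
Proof. by do 2 apply: sumr_ge0 => ? _; exact: dirichlet_term_ge0. Qed.

(** Expand the square: stationarity kills the term in [f j ^+ 2], and the
    vanishing of the row sums kills the term in [f i ^+ 2]. *)
Lemma dirichletE f : mean (fun i => f i * gen f i) = - (dirichlet f / 2).
Proof.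
have -> : dirichlet f = mean (fun i => f i ^+ 2 * gen (fun=> 1) i) +
   ((- 2) * mean (fun i => f i * gen f i) + mean (gen (fun j => f j ^+ 2))).
  rewrite /dirichlet /pi_mean mulr_sumr -!big_split/=.
  apply: eq_bigr => i _.
  rewrite /generator !mulr_sumr -!big_split/=; apply: eq_bigr => j _; ring.
rewrite pi_mean_generator addr0.
rewrite [X in X + _](_ : _ = 0); first by field.
by rewrite /pi_mean big1// => i _; rewrite generator_cst !mulr0.
Qed.

(** A state with positive mass passes some of it on along every edge. *)
Lemma stationary_gt0 i : 0 < pi i 0.
Proof.
case: pi_stationary => p0 p1 _; case: Q_rates => q0 _.
have step a b : (a != b) && (0 < Q a b) -> 0 < pi a 0 -> 0 < pi b 0.
  move=> /andP[ab qab] pa; rewrite lt_neqAle p0 andbT eq_sym.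
  apply/eqP => pb0; have := stationary_col b; rewrite (bigD1 b)//= pb0 mul0r add0r.
  apply/eqP; rewrite gt_eqF// (bigD1 a)//= ltr_pwDl ?mulr_gt0//.
  by apply: sumr_ge0 => c /andP[cb _]; rewrite mulr_ge0// q0.
have [k pk] : exists k, 0 < pi k 0.
  apply/existsP; apply: contraT; rewrite negb_exists => /forallP n.
  have : \sum_i pi i 0 = 0.
    by apply: big1 => k _; apply/eqP; rewrite eq_le p0 andbT leNgt n.
  by rewrite p1 => /eqP; rewrite oner_eq0.
have /connectP[s sp ->] := Q_irreducible k i.
elim: s k pk sp => [//|a s IH] k pk /= /andP[ka sp].
by apply: IH => //; exact: step ka pk.
Qed.

(** The increment of [f] along an edge is controlled by the corresponding term
    of the Dirichlet form, and irreducibility joins any two states. *)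
Lemma dirichlet_controls i j :
  exists2 K, 0 <= K & forall f, (f i - f j) ^+ 2 <= K * dirichlet f.
Proof.
have /connectP[s sp ->] := Q_irreducible i j.
elim: s i sp => [|a s IH] i /=.
  by move=> _; exists 0 => // f; rewrite subrr expr0n mul0r.
move=> /andP[/andP[ia qia] sp].
have [K K0 hK] := IH a sp.
have c0 : 0 < pi i 0 * Q i a by rewrite mulr_gt0// stationary_gt0.
exists (2 * (pi i 0 * Q i a)^-1 + 2 * K).
  by rewrite addr_ge0// mulr_ge0// invr_ge0 ltW.
move=> f; set b := f (last a s).
have h1 : (f i - f a) ^+ 2 <= (pi i 0 * Q i a)^-1 * dirichlet f.
  rewrite ler_pdivlMl// /dirichlet (bigD1 i)//= (bigD1 a)//= -addrA lerDl.
  rewrite addr_ge0//; first by apply: sumr_ge0 => ? _; exact: dirichlet_term_ge0.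
  by do 2 apply: sumr_ge0 => ? _; exact: dirichlet_term_ge0.
have h2 := hK f; rewrite -/b in h2.
have h3 : (f i - b) ^+ 2 <= 2 * (f i - f a) ^+ 2 + 2 * (f a - b) ^+ 2.
  rewrite -subr_ge0 (_ : _ - _ = ((f i - f a) - (f a - b)) ^+ 2) ?sqr_ge0//; ring.
by rewrite mulrDl -!mulrA (le_trans h3)// lerD// ler_wpM2l.
Qed.

(** The variance is half the mean of [(f i - f j) ^+ 2] over independent
    pairs, and the Dirichlet form controls each pair. *)
Lemma poincare : exists2 K, 0 < K &
  forall f, mean f = 0 -> mean (fun i => f i ^+ 2) <= K * dirichlet f.
Proof.
case: pi_stationary => p0 p1 _.
have /choice[K hK] : forall ij : 'I_d * 'I_d, exists K, 0 <= K /\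
    forall f, (f ij.1 - f ij.2) ^+ 2 <= K * dirichlet f.
  by move=> [i j]; have [K ? ?] := dirichlet_controls i j; exists K.
have KS : 0 <= \sum_i \sum_j pi i 0 * pi j 0 * K (i, j).
  apply: sumr_ge0 => i _; apply: sumr_ge0 => j _.
  by have [K0 _] := hK (i, j); rewrite mulr_ge0// mulr_ge0.
exists (\sum_i \sum_j pi i 0 * pi j 0 * K (i, j) + 1).
  by rewrite ltr_wpDl.
move=> f mf.
have D0 := dirichlet_ge0 f.
have E : \sum_i \sum_j pi i 0 * pi j 0 * (f i - f j) ^+ 2 =
    2 * mean (fun i => f i ^+ 2).
  have -> : \sum_i \sum_j pi i 0 * pi j 0 * (f i - f j) ^+ 2 =
    mean (fun i => f i ^+ 2 * mean (fun=> 1)) +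
    ((-2) * mean (fun i => f i * mean f) + mean (fun i => mean (fun j => f j ^+ 2))).
    rewrite [X in _ = X + _]/pi_mean [X in _ + (_ * X + _)]/pi_mean.
    rewrite [X in _ + (_ + X)]/pi_mean mulr_sumr -!big_split/=.
    apply: eq_bigr => i _.
    rewrite /pi_mean !mulr_sumr -!big_split/=; apply: eq_bigr => j _; ring.
  rewrite !pi_mean_cst mf.
  have -> : (fun i => f i ^+ 2 * 1) = (fun i => f i ^+ 2).
    by apply/funext => i; rewrite mulr1.
  have -> : (fun i => f i * 0) = (fun=> 0) by apply/funext => i; rewrite mulr0.
  by rewrite pi_mean_cst; ring.
have : \sum_i \sum_j pi i 0 * pi j 0 * (f i - f j) ^+ 2 <=
    (\sum_i \sum_j pi i 0 * pi j 0 * K (i, j)) * dirichlet f.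
  rewrite mulr_suml; apply: ler_sum => i _.
  rewrite mulr_suml; apply: ler_sum => j _.
  by have [_ hKf] := hK (i, j); rewrite -[leRHS]mulrA ler_wpM2l ?mulr_ge0//; exact: hKf.
rewrite E; have : 0 <= mean (fun i => f i ^+ 2).
  by apply: sumr_ge0 => i _; rewrite mulr_ge0 ?sqr_ge0.
move: KS; set S := \sum_i _; nra.
Qed.

End generator.

(** * Integrals of exponentially decaying functions *)

Section exponential_decay.
Variable R : realType.
Notation leb := (@lebesgue_measure R).

Lemma cvg_expR_decay (c K : R) : 0 < c -> K * expR (- (c * x)) @[x --> +oo] --> 0.
Proof.
move=> c0; rewrite -(mulr0 K); apply: cvgMr.
have : c * x @[x --> +oo] --> +oo by exact: gt0_cvgMry.
by move=> h; exact: (@cvg_comp _ _ _ (fun x => c * x) (fun x => expR (- x)) _ _ _ h (@cvgr_expR R)).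
Qed.

Lemma is_derive_expR_decay (c K x : R) :
  is_derive x (1 : R) (fun x => K * expR (- (c * x))) (- (c * K) * expR (- (c * x))).
Proof.
apply: is_derive_eq.
by rewrite /GRing.scale/=; ring.
Qed.

Lemma is_derive_continuous (F f : R -> R) :
  (forall x : R, is_derive x (1 : R) F (f x)) -> continuous F.
Proof.
by move=> dF x; have [/derivable1_diffP/differentiable_continuous] := dF x.
Qed.

Lemma decay_FTC_ge0 (F f : R -> R) : (forall x : R, is_derive x (1 : R) F (f x)) ->
  continuous f -> (forall x, 0 <= x -> 0 <= f x) -> F x @[x --> +oo] --> 0 ->
  leb.-integrable `[0%R, +oo[%classic (EFin \o f) /\
  \int[leb]_(x in `[0, +oo[) f x = - F 0.
Proof.
move=> dF cf f0 Foo.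
have E : (\int[leb]_(x in `[0%R, +oo[) (f x)%:E = 0%:E - (F 0)%:E)%E.
  apply: ge0_continuous_FTC2y => //.
  - exact: continuous_subspaceT.
  - by apply: cvg_at_right_filter; exact: is_derive_continuous.
  - by move=> x _; rewrite derive1E; exact: derive_val.
split; last by rewrite /Rintegral E/= sub0r.
apply/integrableP; split.
  by apply/measurable_EFinP; apply: measurable_funTS; exact: continuous_measurable_fun.
under eq_integral.
  move=> x; rewrite inE/= in_itv/= andbT => x0; rewrite ger0_norm ?f0//; over.
by rewrite E ltry.
Qed.

Lemma integrable_expR_decay (c K : R) : 0 < c -> 0 <= K ->
  leb.-integrable `[0%R, +oo[%classic (EFin \o (fun x => K * expR (- (c * x)))).
Proof.
move=> c0 K0.
apply: (proj1 (@decay_FTC_ge0 (fun x => - (K / c) * expR (- (c * x)))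
  (fun x => K * expR (- (c * x))) _ _ _ _)).
- move=> x; have := is_derive_expR_decay c (- (K / c)) x.
  by rewrite mulrN opprK mulrCA mulfV ?gt_eqF// mulr1.
- by apply: is_derive_continuous => x; exact: is_derive_expR_decay.
- by move=> x _; rewrite mulr_ge0 ?expR_ge0.
- exact: cvg_expR_decay.
Qed.

Lemma integrable_decay (f : R -> R) (c K : R) : continuous f -> 0 < c ->
  (forall x, 0 <= x -> `|f x| <= K * expR (- (c * x))) ->
  leb.-integrable `[0%R, +oo[%classic (EFin \o f).
Proof.
move=> cf c0 fK.
have K0 : 0 <= K by have := fK 0 (lexx 0); rewrite mulr0 oppr0 expR0 mulr1; apply: le_trans.
apply: (le_integrable _ _ _ (integrable_expR_decay c0 K0)) => //.
  by apply/measurable_EFinP; apply: measurable_funTS; exact: continuous_measurable_fun.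
move=> x /=; rewrite in_itv/= andbT => x0; rewrite lee_fin (le_trans (fK _ x0))//.
exact: ler_norm.
Qed.

(** Adding [K * expR (- (c * x))] to the integrand makes it nonnegative, which
    is the case settled by [decay_FTC_ge0]. *)
Lemma decay_FTC (F f : R -> R) (c K : R) :
  (forall x : R, is_derive x (1 : R) F (f x)) -> continuous f -> 0 < c ->
  (forall x, 0 <= x -> `|F x| <= K * expR (- (c * x))) ->
  (forall x, 0 <= x -> `|f x| <= K * expR (- (c * x))) ->
  \int[leb]_(x in `[0, +oo[) f x = - F 0.
Proof.
move=> dF cf c0 FK fK.
have K0 : 0 <= K by have := fK 0 (lexx 0); rewrite mulr0 oppr0 expR0 mulr1; apply: le_trans.
pose e x := K * expR (- (c * x)).
pose G x := F x + - (K / c) * expR (- (c * x)).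
have de (x : R) : is_derive x (1 : R) (fun x => - (K / c) * expR (- (c * x))) (e x).
  have := is_derive_expR_decay c (- (K / c)) x.
  by rewrite mulrN opprK mulrCA mulfV ?gt_eqF// mulr1.
have ce : continuous e.
  by apply: is_derive_continuous => x; exact: is_derive_expR_decay.
have [ie Ee] : leb.-integrable `[0%R, +oo[%classic (EFin \o e) /\
    \int[leb]_(x in `[0, +oo[) e x = - (- (K / c) * expR (- (c * 0))).
  apply: (@decay_FTC_ge0 (fun x => - (K / c) * expR (- (c * x)))) => //.
    by move=> x _; rewrite mulr_ge0 ?expR_ge0.
  exact: cvg_expR_decay.
have [iG EG] : leb.-integrable `[0%R, +oo[%classic (EFin \o (fun x => f x + e x)) /\
    \int[leb]_(x in `[0, +oo[) (f x + e x) = - G 0.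
  apply: (@decay_FTC_ge0 G (fun x => f x + e x)).
  - by move=> x; apply: cvgD; [exact: cf|exact: ce].
  - move=> x x0; have := fK x x0; rewrite ler_norml => /andP[+ _].
    by rewrite -subr_ge0 opprK.
  - suff F0 : F x @[x --> +oo] --> 0.
      have h : F x + - (K / c) * expR (- (c * x)) @[x --> +oo] --> 0 + 0.
        by apply: cvgD => //; exact: cvg_expR_decay.
      by rewrite addr0 in h.
    apply: norm_cvg0.
    have z : (fun _ : R => 0 : R) @ +oo --> (0 : R) by exact: cvg_cst.
    apply: (@squeeze_cvgr _ _ _ _ (fun=> 0) (fun x => K * expR (- (c * x))) _ _ 0 z (@cvg_expR_decay c K c0)).
    by near=> x; rewrite normr_ge0/= FK//; near: x; exact: nbhs_pinfty_ge.
have i_f := integrable_decay cf c0 fK.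
move: EG; rewrite RintegralD// Ee /G; lra.
Unshelve. all: by end_near. Qed.

End exponential_decay.

(** * Deviation matrix and the Poisson equation *)

Section ergodicity.
Variables (R : realType) (d : nat) (Q : 'M[R]_d) (pi : 'cV[R]_d).
Hypothesis Q_rates : is_rate_matrix Q.
Hypothesis Q_irreducible : irreducible_rates Q.
Hypothesis pi_stationary : is_stationary Q pi.
Notation mean := (pi_mean pi).
Notation gen := (generator Q).
Notation leb := (@lebesgue_measure R).

Lemma is_derive_lincomb (c : 'I_d -> R) (u : 'I_d -> R -> R) (du : 'I_d -> R) (t : R) :
  (forall i, is_derive t (1 : R) (u i) (du i)) ->
  is_derive t (1 : R) (fun s : R => \sum_i c i * u i s) (\sum_i c i * du i).
Proof.
move=> dudu.
have -> : (fun s : R => \sum_i c i * u i s) = \sum_i (c i \*: u i).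
  by apply/funext => s; rewrite fct_sumE.
have -> : \sum_i c i * du i = \sum_i c i *: du i by [].
by apply: is_derive_sum => i; exact: is_deriveZ.
Qed.

Definition centered (i j : 'I_d) (t : R) : R := transition Q t i j - pi j 0.

Lemma is_derive_centered (i j : 'I_d) (t : R) :
  is_derive t (1 : R) (centered i j) (gen (fun l => centered l j t) i).
Proof.
have -> : gen (fun l => centered l j t) i = \sum_l Q i l * transition Q t l j - 0.
  case: Q_rates => _ rs.
  rewrite -[X in _ - X](mulr0 (pi j 0)) -[X in pi j 0 * X](rs i).
  rewrite /generator mulr_sumr -sumrB; apply: eq_bigr => l _.
  by rewrite /centered mulrBr [X in _ - X]mulrC.
by apply: is_deriveB; exact: is_derive_transition.
Qed.

Lemma pi_mean_centered j t : mean (fun i => centered i j t) = 0.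
Proof.
have d0 (s : R) : is_derive s (1 : R) (fun s : R => mean (fun i => centered i j s)) 0.
  have <- : mean (gen (fun l => centered l j s)) = 0 by exact: pi_mean_generator.
  by apply: is_derive_lincomb => i; exact: is_derive_centered.
rewrite (is_derive_0_is_cst t 0 d0) /centered transition0 /pi_mean.
under eq_bigr do rewrite mulrBr.
rewrite sumrB -mulr_suml; case: pi_stationary => _ -> _; rewrite mul1r.
rewrite (bigD1 j)//= mxE eqxx mulr1 big1 ?addr0 ?subrr// => i ij.
by rewrite mxE (negbTE ij) mulr0.
Qed.

(** The variance of the transition probabilities under [pi] has derivative
    minus the Dirichlet form, so the Poincare inequality makes it decay. *)
Lemma centered_decay : exists c K, [/\ 0 < c, 0 <= K &
  forall i j t, 0 <= t -> `|centered i j t| <= K * expR (- (c * t))].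
Proof.
have [K0 K0gt poin] := poincare Q_rates Q_irreducible pi_stationary.
pose V j (t : R) := mean (fun i => centered i j t ^+ 2).
have dV j (t : R) : is_derive t (1 : R) (V j)
    (mean (fun i => 2 * (centered i j t * gen (fun l => centered l j t) i))).
  apply: is_derive_lincomb => i; have := is_derive_centered i j t => dc.
  have h := is_deriveX 2 dc.
  by apply: (is_derive_eq h); rewrite expr1 /GRing.scale/= mulrA.
have dVle j t : mean (fun i => 2 * (centered i j t * gen (fun l => centered l j t) i))
    <= - K0^-1 * V j t.
  have -> : mean (fun i => 2 * (centered i j t * gen (fun l => centered l j t) i)) =
     2 * mean (fun i => centered i j t * gen (fun l => centered l j t) i).
    by rewrite /pi_mean mulr_sumr; apply: eq_bigr => i _; rewrite mulrCA.
  rewrite (dirichletE Q_rates pi_stationary) mulrN mulrCA mulfV// mulr1 mulNr lerN2.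
  rewrite mulrC ler_pdivrMr// mulrC; apply: poin; exact: pi_mean_centered.
have Vdecay j t : 0 <= t -> V j t <= V j 0 * expR (- (K0^-1 * t)).
  move=> t0.
  pose W (t : R) : R := expR (K0^-1 * t) * V j t.
  have dW (s : R) : is_derive s (1 : R) W (expR (K0^-1 * s) *
     (mean (fun i => 2 * (centered i j s * gen (fun l => centered l j s) i)) + K0^-1 * V j s)).
    have de : is_derive s (1 : R) (fun t : R => expR (K0^-1 * t)) (K0^-1 * expR (K0^-1 * s)).
      by apply: is_derive_eq; rewrite /GRing.scale/=; ring.
    apply: (is_derive_eq (is_deriveM de (dV j s))).
    by rewrite /GRing.scale/=; ring.
  have : W t <= W 0.
    apply: (@ler0_derive1_nincry _ W 0) => //.
    - move=> s _; rewrite derive1E; have [_ hd] := dW s; rewrite hd.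
      rewrite pmulr_rle0 ?expR_gt0//; have := dVle j s.
      by rewrite mulNr; lra.
    - apply: continuous_subspaceT; exact: is_derive_continuous dW.
  rewrite /W mulr0 expR0 mul1r => h.
  by rewrite expRN ler_pdivlMr ?expR_gt0// mulrC.
have V0 j : 0 <= V j 0.
  by apply: sumr_ge0 => i _; rewrite mulr_ge0 ?sqr_ge0//; case: pi_stationary.
pose C := \sum_i \sum_j V j 0 / pi i 0.
have pi0 i := stationary_gt0 Q_rates Q_irreducible pi_stationary i.
have C0 : 0 <= C.
  by do 2 apply: sumr_ge0 => ? _; rewrite divr_ge0// ltW.
exists (K0^-1 / 2), (C + 1); split.
- by rewrite divr_gt0// invr_gt0.
- by rewrite addr_ge0.
move=> i j t t0.
have h1 : centered i j t ^+ 2 <= C * expR (- (K0^-1 * t)).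
  have h : pi i 0 * centered i j t ^+ 2 <= V j t.
    rewrite /V /pi_mean (bigD1 i)//= lerDl; apply: sumr_ge0 => k _.
    by rewrite mulr_ge0 ?sqr_ge0// ltW.
  have := le_trans h (Vdecay j t t0); rewrite mulrC -ler_pdivlMr// mulrAC.
  move=> /le_trans; apply; rewrite ler_wpM2r ?expR_ge0// /C (bigD1 i)//= (bigD1 j)//=.
  rewrite -addrA lerDl addr_ge0//; last first.
    by do 2 apply: sumr_ge0 => ? _; rewrite divr_ge0// ltW.
  by apply: sumr_ge0 => ? _; rewrite divr_ge0// ltW.
rewrite -(@ler_pXn2r _ 2)// ?nnegrE ?mulr_ge0 ?addr_ge0 ?expR_ge0//.
rewrite (real_normK (num_real _)) (le_trans h1)// exprMn -expRM_natl.
have -> : 2%:R * - (K0^-1 / 2 * t) = - (K0^-1 * t) by field; rewrite gt_eqF.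
by rewrite ler_wpM2r ?expR_ge0//; nra.
Qed.

Lemma continuous_centered i j : continuous (centered i j).
Proof. by apply: is_derive_continuous => t; exact: is_derive_centered. Qed.

Lemma integrable_centered i j :
  leb.-integrable `[0%R, +oo[%classic (EFin \o centered i j).
Proof.
have [c [K [c0 K0 cK]]] := centered_decay.
apply: (integrable_decay _ c0 (cK i j)); exact: continuous_centered.
Qed.

Definition potential (f : 'I_d -> R) (i : 'I_d) : R :=
  \sum_j deviation_matrix Q pi i j * f j.

(** Under the integral sign the generator gives the time derivative of
    [centered], which integrates to minus the initial value. *)
Lemma generator_deviation i j :
  \sum_l Q i l * deviation_matrix Q pi l j = pi j 0 - (i == j)%:R.
Proof.
under eq_bigr do rewrite mxE.
rewrite -(Rintegral_lincomb _ _ (Q i) (fun l => integrable_centered l j))//.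
have [c [K [c0 K0 cK]]] := centered_decay.
pose B := \sum_l `|Q i l| * K + K.
rewrite (@decay_FTC _ (centered i j) _ c B (is_derive_centered i j))//.
- by rewrite /centered transition0 mxE opprB.
- move=> t; apply: cvg_big => [|l _]; first exact: add_continuous.
  by apply: cvgMr; exact: continuous_centered.
- move=> t t0; apply: (le_trans (cK i j t t0)).
  rewrite ler_wpM2r ?expR_ge0// /B lerDr.
  by apply: sumr_ge0 => l _; rewrite mulr_ge0.
- move=> t t0; apply: (@le_trans _ _ ((\sum_l `|Q i l| * K) * expR (- (c * t)))).
    rewrite (le_trans (ler_norm_sum _ _ _))// mulr_suml; apply: ler_sum => l _.
    by rewrite normrM -mulrA ler_wpM2l// cK.
  by rewrite ler_wpM2r ?expR_ge0// /B lerDl.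
Qed.

Lemma pi_mean_deviation j : mean (fun i => deviation_matrix Q pi i j) = 0.
Proof.
rewrite /pi_mean; under eq_bigr do rewrite mxE.
rewrite -(Rintegral_lincomb _ _ (pi ^~ 0) (fun l => integrable_centered l j))//.
under eq_Rintegral do rewrite -/(pi_mean pi (fun l => centered l j _)) pi_mean_centered.
by rewrite Rintegral_cst// mul0r.
Qed.

(** The potential solves the Poisson equation of the background process. *)
Lemma generator_potential f i : gen (potential f) i = mean f - f i.
Proof.
rewrite /generator /potential.
under eq_bigr do rewrite mulr_sumr.
rewrite exchange_big/=.
rewrite -(sum_delta i f) -sumrB; apply: eq_bigr => j _.
rewrite -mulrBl -generator_deviation mulr_suml.
by apply: eq_bigr => l _; rewrite mulrA.
Qed.

Lemma pi_mean_potential f : mean (potential f) = 0.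
Proof.
rewrite /pi_mean /potential.
under eq_bigr do rewrite mulr_sumr.
rewrite exchange_big/= big1// => j _.
under eq_bigr do rewrite mulrA.
by rewrite -mulr_suml -/(pi_mean pi (fun i => deviation_matrix Q pi i j))
  pi_mean_deviation mul0r.
Qed.

Lemma U_coefE (lambda : 'I_d -> R) :
  U_coef Q pi lambda = mean (fun i => lambda i * potential lambda i).
Proof.
rewrite /U_coef !mul_mx_diag mxE /pi_mean /potential.
under eq_bigr do rewrite !mxE mulr1 mulr_suml.
rewrite exchange_big/=; apply: eq_bigr => i _.
rewrite !mulr_sumr; apply: eq_bigr => j _.
by rewrite !mxE !mulrA.
Qed.

(** Since [potential lambda] is centered, [lambda] can be replaced by its
    centering, which is minus the generator of the potential. *)
Lemma U_coef_ge0 (lambda : 'I_d -> R) : 0 <= U_coef Q pi lambda.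
Proof.
rewrite U_coefE; set h := potential lambda.
have -> : mean (fun i => lambda i * h i) =
    - 1 * mean (fun i => h i * gen h i) + mean lambda * mean h.
  rewrite /pi_mean !mulr_sumr -big_split/=; apply: eq_bigr => i _.
  by rewrite generator_potential; rewrite /pi_mean; ring.
rewrite pi_mean_potential mulr0 addr0 mulN1r dirichletE// opprK.
by rewrite divr_ge0//; exact: dirichlet_ge0.
Qed.

End ergodicity.

(** * First order expansions in the time step *)

Section first_order_expansion.
Variable R : realType.

(** First order expansion in the step [delta], uniformly in the weight [w]. *)
Definition expands (f : R -> R -> R) (f0 f1 : R -> R) : Prop := exists2 C, 0 <= C &
  forall w delta, 0 <= w <= 1 -> 0 <= delta <= 1 ->
  [/\ `|f0 w| <= C, `|f1 w| <= C &
      `|f w delta - (f0 w + delta * f1 w)| <= C * delta ^+ 2].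

Lemma expands_eq f f' f0 f0' f1 f1' : f =2 f' -> f0 =1 f0' -> f1 =1 f1' ->
  expands f f0 f1 -> expands f' f0' f1'.
Proof.
move=> ff f00 f11 [C C0 fC]; exists C => // w delta w01 d01.
by rewrite -ff -f00 -f11; exact: fC.
Qed.

Lemma expands_cst (c : R -> R) C : (forall w, 0 <= w <= 1 -> `|c w| <= C) ->
  expands (fun w _ => c w) c (fun=> 0).
Proof.
move=> cC; have C0 : 0 <= C by apply: le_trans (cC 0 _); rewrite ?lexx ?ler01.
exists C => // w delta w01 _; rewrite normr0 mulr0 addr0 subrr normr0.
by rewrite mulr_ge0 ?sqr_ge0//; split => //; exact: cC.
Qed.

Lemma expands_step : expands (fun _ delta => delta) (fun=> 0) (fun=> 1).
Proof.
exists 1 => // w delta _ _; rewrite normr0 normr1 mulr1 add0r subrr normr0 mul1r sqr_ge0.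
by split.
Qed.

Lemma expandsD f f0 f1 g g0 g1 : expands f f0 f1 -> expands g g0 g1 ->
  expands (fun w delta => f w delta + g w delta) (fun w => f0 w + g0 w)
    (fun w => f1 w + g1 w).
Proof.
move=> [C C0 fC] [D D0 gD]; exists (C + D); first exact: addr_ge0.
move=> w delta w01 d01; have [a1 a2 a3] := fC w delta w01 d01.
have [b1 b2 b3] := gD w delta w01 d01; split.
- exact: (le_trans (ler_normD _ _) (lerD a1 b1)).
- exact: (le_trans (ler_normD _ _) (lerD a2 b2)).
rewrite mulrDl (_ : _ - _ = (f w delta - (f0 w + delta * f1 w)) +
  (g w delta - (g0 w + delta * g1 w))); last by ring.
exact: (le_trans (ler_normD _ _) (lerD a3 b3)).
Qed.

Lemma expandsM f f0 f1 g g0 g1 : expands f f0 f1 -> expands g g0 g1 ->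
  expands (fun w delta => f w delta * g w delta) (fun w => f0 w * g0 w)
    (fun w => f0 w * g1 w + f1 w * g0 w).
Proof.
move=> [C C0 fC] [D D0 gD]; exists (6 * (C * D)).
  by rewrite mulr_ge0 ?mulr_ge0.
move=> w delta w01 /[dup] /andP[d0 d1] d01; have [a1 a2 a3] := fC w delta w01 d01.
have [b1 b2 b3] := gD w delta w01 d01.
have CD0 : 0 <= C * D by rewrite mulr_ge0.
have q1 : `|f0 w * g0 w| <= C * D by rewrite normrM ler_pM.
have q2 : `|f0 w * g1 w| <= C * D by rewrite normrM ler_pM.
have q3 : `|f1 w * g0 w| <= C * D by rewrite normrM ler_pM.
have q4 : `|f1 w * g1 w| <= C * D by rewrite normrM ler_pM.
have d2 : delta ^+ 2 <= 1 by rewrite expr_le1.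
split; first by rewrite (le_trans q1)//; lra.
  by apply: (le_trans (ler_normD _ _)); lra.
have gle : `|g w delta| <= 3 * D.
  rewrite -(subrK (g0 w + delta * g1 w) (g w delta)).
  apply: (le_trans (ler_normD _ _)).
  have : `|g0 w + delta * g1 w| <= 2 * D.
    apply: (le_trans (ler_normD _ _)); rewrite normrM (ger0_norm d0).
    have : delta * `|g1 w| <= 1 * D by rewrite ler_pM.
    by lra.
  have : D * delta ^+ 2 <= D * 1 by rewrite ler_wpM2l.
  by lra.
have ple : `|f0 w + delta * f1 w| <= 2 * C.
  apply: (le_trans (ler_normD _ _)); rewrite normrM (ger0_norm d0).
  have : delta * `|f1 w| <= 1 * C by rewrite ler_pM.
  by lra.
rewrite (_ : _ - _ = (f w delta - (f0 w + delta * f1 w)) * g w delta +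
  (f0 w + delta * f1 w) * (g w delta - (g0 w + delta * g1 w)) +
  delta ^+ 2 * (f1 w * g1 w)); last by ring.
have e1 : `|(f w delta - (f0 w + delta * f1 w)) * g w delta| <= (C * delta ^+ 2) * (3 * D).
  by rewrite normrM ler_pM.
have e2 : `|(f0 w + delta * f1 w) * (g w delta - (g0 w + delta * g1 w))| <=
    2 * C * (D * delta ^+ 2) by rewrite normrM ler_pM.
have e3 : `|delta ^+ 2 * (f1 w * g1 w)| <= delta ^+ 2 * (C * D).
  by rewrite normrM (ger0_norm (sqr_ge0 _)) ler_wpM2l ?sqr_ge0.
apply: (le_trans (ler_normD _ _)).
apply: (le_trans (lerD (ler_normD _ _) (lexx _))).
apply: (le_trans (lerD (lerD e1 e2) e3)).
by rewrite le_eqVlt; apply/orP; left; apply/eqP; ring.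
Qed.

Lemma expands_sum (I : finType) (f : I -> R -> R -> R) (f0 f1 : I -> R -> R) :
  (forall i, expands (f i) (f0 i) (f1 i)) ->
  expands (fun w delta => \sum_i f i w delta) (fun w => \sum_i f0 i w)
    (fun w => \sum_i f1 i w).
Proof.
move=> ef.
have H (s : seq I) : expands (fun w delta => \sum_(i <- s) f i w delta)
    (fun w => \sum_(i <- s) f0 i w) (fun w => \sum_(i <- s) f1 i w).
  elim: s => [|i s IH].
    apply: (expands_eq _ _ _ (@expands_cst (fun=> 0) 0 _)) => [w d|w|w|w _];
      by rewrite ?big_nil ?normr0.
  apply: (expands_eq _ _ _ (expandsD (ef i) IH)) => [w d|w|w];
    by rewrite big_cons.
exact: H.
Qed.

Lemma expands_expR f f1 : expands f (fun=> 0) f1 ->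
  expands (fun w delta => expR (f w delta)) (fun=> 1) f1.
Proof.
move=> [C C0 fC]; exists (1 + C + 4 * C ^+ 2 * expR (2 * C)).
  by rewrite !addr_ge0// !mulr_ge0 ?expR_ge0 ?sqr_ge0.
have K0 : 0 <= 4 * C ^+ 2 * expR (2 * C) by rewrite !mulr_ge0 ?expR_ge0 ?sqr_ge0.
move=> w delta w01 /[dup] /andP[d0 d1] d01; have [_ a2 a3] := fC w delta w01 d01.
split; first by rewrite normr1; lra.
  by lra.
set x := f w delta; rewrite -/x add0r in a3.
have d2 : delta ^+ 2 <= delta by rewrite expr2 ler_piMl.
have xle : `|x| <= 2 * C * delta.
  rewrite -(subrK (delta * f1 w) x); apply: (le_trans (ler_normD _ _)).
  have h1 : `|delta * f1 w| <= delta * C by rewrite normrM (ger0_norm d0) ler_wpM2l.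
  have h2 : C * delta ^+ 2 <= C * delta by rewrite ler_wpM2l.
  by lra.
have e1 : `|expR x - 1 - x| <= 4 * C ^+ 2 * expR (2 * C) * delta ^+ 2.
  apply: (le_trans (expR_taylor1 x)).
  have s1 : x ^+ 2 <= (2 * C * delta) ^+ 2.
    by rewrite -(real_normK (num_real x)) lerXn2r ?nnegrE ?mulr_ge0.
  have s2 : expR `|x| <= expR (2 * C).
    rewrite ler_expR (le_trans xle)//; have : 2 * C * delta <= 2 * C * 1.
      by rewrite ler_wpM2l ?mulr_ge0.
    by rewrite mulr1.
  have := ler_pM (sqr_ge0 x) (expR_ge0 `|x|) s1 s2.
  by move=> /le_trans; apply; rewrite le_eqVlt; apply/orP; left; apply/eqP; ring.
rewrite (_ : _ - _ = (expR x - 1 - x) + (x - delta * f1 w)); last by ring.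
apply: (le_trans (ler_normD _ _)); apply: (le_trans (lerD e1 a3)).
have d20 := sqr_ge0 delta; nra.
Qed.

End first_order_expansion.

(** * One step of the tilted chain *)

Lemma expands_transition (R : realType) (d : nat) (A : 'M[R]_d) i j :
  expands (fun _ delta => transition A delta i j) (fun=> (i == j)%:R) (fun=> A i j).
Proof.
pose S := mxabs_sum A; have S0 : 0 <= S by exact: mxabs_sum_ge0.
have k0 : 0 <= S ^+ 2 * expR S by rewrite mulr_ge0 ?sqr_ge0 ?expR_ge0.
exists (1 + `|A i j| + S ^+ 2 * expR S); first by rewrite !addr_ge0.
move=> w delta _ /andP[d0 d1]; have A0 := normr_ge0 (A i j).
split; last 1 first.
- rewrite opprD addrA; apply: (le_trans (transition_taylor A i j delta)).
  rewrite (ger0_norm d0) exprMn.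
  have : S ^+ 2 * delta ^+ 2 * expR (S * delta) <= S ^+ 2 * delta ^+ 2 * expR S.
    rewrite ler_wpM2l ?mulr_ge0 ?sqr_ge0// ler_expR.
    by rewrite -[leRHS]mulr1 ler_wpM2l.
  move=> /le_trans; apply; rewrite mulrAC ler_wpM2r ?sqr_ge0//.
  by rewrite lerDr addr_ge0.
- case: (i == j); rewrite ?normr0 ?normr1; lra.
- lra.
Qed.

Lemma expands_expR_scale (R : realType) (c : R -> R) C :
  (forall w, 0 <= w <= 1 -> `|c w| <= C) ->
  expands (fun w delta => expR (c w * delta)) (fun=> 1) c.
Proof.
move=> cC; apply: expands_expR.
apply: (expands_eq _ _ _ (expandsM (expands_cst cC) (@expands_step R))) => [//|w|w].
  by rewrite mulr0.
by rewrite mulr1 mul0r addr0.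
Qed.

Section tilted_step.
Variables (R : realType) (d : nat) (Q : 'M[R]_d) (pi : 'cV[R]_d).
Hypothesis Q_rates : is_rate_matrix Q.
Hypothesis Q_irreducible : irreducible_rates Q.
Hypothesis pi_stationary : is_stationary Q pi.
Variables (lambda : 'I_d -> R) (m nu a : R).
Hypothesis m_gt0 : 0 < m.
Hypothesis nu_gt0 : 0 < nu.
Notation gen := (generator Q).

Let linf : R := lambda_infty pi lambda.
Let U : R := U_coef Q pi lambda.

(** Corrector of first order: the solution of the Poisson equation for the
    centered arrival rates. *)
Definition corrector1 : 'I_d -> R := potential Q pi lambda.
(** Corrector of second order: it averages out the fluctuations of the
    variance created by the first one. *)
Definition corrector2 : 'I_d -> R :=
  potential Q pi (fun i => (lambda i - linf) * corrector1 i).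
Let eps : R := a / nu.

Definition corrected (w : R) (i : 'I_d) : R :=
  1 + eps * w * corrector1 i + eps ^+ 2 * w ^+ 2 * corrector2 i.

(** The integral over [s] in [0, delta] of
    [a ^+ 2 * U / nu * v ^+ 2 + a * linf * v] for [v = w * expR (- m * s)]:
    the growth, during a step that ends with weight [w], predicted by the
    variance and the mean of the arrival rates. *)
Definition step_exponent (w delta : R) : R :=
  a ^+ 2 * U / nu * w ^+ 2 * ((1 - expR (- m * delta) ^+ 2) / (2 * m)) +
  a * linf * w * ((1 - expR (- m * delta)) / m).

(** The defect of [corrected] as an eigenfunction of the tilted step. *)
Definition step_error (i : 'I_d) (w delta : R) : R :=
  expR (- step_exponent w delta) *
    (\sum_j transition (nu *: Q) delta i j *
       (expR (a * w * lambda j * delta) * corrected w j)) -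
  corrected (w * expR (- m * delta)) i.

(** What the two correctors leave of the derivative of [step_error] at
    [delta = 0]. All its terms carry a factor [a / nu]. *)
Definition step_residual (i : 'I_d) (w : R) : R :=
  a * eps ^+ 2 * w ^+ 3 * ((lambda i - linf) * corrector2 i)
  - a ^+ 2 * U / nu * w ^+ 2 *
     (eps * w * corrector1 i + eps ^+ 2 * w ^+ 2 * corrector2 i)
  + m * (eps * w * corrector1 i + 2 * eps ^+ 2 * w ^+ 2 * corrector2 i).

Lemma generator_corrector1 i : gen corrector1 i = linf - lambda i.
Proof. by rewrite /corrector1 (generator_potential Q_rates Q_irreducible pi_stationary). Qed.

Lemma generator_corrector2 i :
  gen corrector2 i = U - (lambda i - linf) * corrector1 i.
Proof.
rewrite /corrector2 (generator_potential Q_rates Q_irreducible pi_stationary).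
congr (_ - _); rewrite /U U_coefE.
have -> : (fun i => (lambda i - linf) * corrector1 i) =
    (fun i => - linf * corrector1 i + lambda i * corrector1 i).
  by apply/funext => j; ring.
rewrite pi_meanD (pi_mean_potential Q_rates Q_irreducible pi_stationary).
by rewrite mulr0 add0r.
Qed.

Let norm_weight_le (c w : R) : 0 <= w <= 1 -> `|c * w| <= `|c|.
Proof. by move=> /andP[w0 w1]; rewrite normrM (ger0_norm w0) ler_piMr. Qed.

Let norm_weight2_le (c w : R) : 0 <= w <= 1 -> `|c * w ^+ 2| <= `|c|.
Proof.
move=> /andP[w0 w1]; rewrite normrM (ger0_norm (sqr_ge0 _)) ler_piMr//.
by rewrite expr_le1.
Qed.

Lemma expands_decay : expands (fun _ delta => expR (- m * delta)) (fun=> 1) (fun=> - m).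
Proof. by apply: (@expands_expR_scale _ (fun=> - m) `|m|) => w _; rewrite normrN. Qed.

Let D1 := expands_decay.

Let D2 : expands (fun _ delta => expR (- m * delta) * expR (- m * delta))
  (fun=> 1) (fun=> - (2 * m)).
Proof. by apply: (expands_eq _ _ _ (expandsM D1 D1)) => [//|w|w]; ring. Qed.

Let c0 (c : R) : expands (fun _ _ => c) (fun=> c) (fun=> 0).
Proof. by apply: (@expands_cst _ (fun=> c) `|c|). Qed.

Let c1 (c : R) : expands (fun w _ => c * w) (fun w => c * w) (fun=> 0).
Proof.
by apply: (@expands_cst _ (fun w => c * w) `|c|) => w; exact: norm_weight_le.
Qed.

Let c2 (c : R) : expands (fun w _ => c * w ^+ 2) (fun w => c * w ^+ 2) (fun=> 0).
Proof.
by apply: (@expands_cst _ (fun w => c * w ^+ 2) `|c|) => w; exact: norm_weight2_le.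
Qed.

Let expands_step_exponent :
  expands (fun w delta => expR (- step_exponent w delta)) (fun=> 1)
    (fun w => - (a ^+ 2 * U / nu * w ^+ 2 + a * linf * w)).
Proof.
apply: expands_expR.
have := expandsD
  (expandsM (c2 (- (a ^+ 2 * U / nu / (2 * m)))) (expandsD (c0 1) (expandsM (c0 (-1)) D2)))
  (expandsM (c1 (- (a * linf / m))) (expandsD (c0 1) (expandsM (c0 (-1)) D1))).
apply: expands_eq => [w delta|w|w].
- by rewrite /step_exponent; field; rewrite !gt_eqF.
- by rewrite /=; ring.
- by rewrite /=; field; rewrite !gt_eqF.
Qed.

(** The terms of order [a] and [a ^+ 2 / nu] cancel by the Poisson equations
    [generator_corrector1] and [generator_corrector2]. *)
Lemma step_error_expands i :
  expands (step_error i) (fun=> 0) (step_residual i).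
Proof.
have psiC j : expands (fun w _ => corrected w j) (corrected ^~ j) (fun=> 0).
  apply: (@expands_cst _ _ (1 + `|eps * corrector1 j| + `|eps ^+ 2 * corrector2 j|)) => w w01.
  rewrite /corrected (le_trans (ler_normD _ _))// lerD//.
    rewrite (le_trans (ler_normD _ _))// normr1 lerD2l mulrAC.
    exact: norm_weight_le.
  by rewrite mulrAC norm_weight2_le.
have eC j : expands (fun w delta => expR (a * w * lambda j * delta)) (fun=> 1)
    (fun w => a * w * lambda j).
  apply: (@expands_expR_scale _ _ `|a * lambda j|) => w w01.
  by rewrite mulrAC norm_weight_le.
have main := expandsM expands_step_exponent
  (expands_sum (fun j => expandsM (expands_transition (nu *: Q) i j)
                                  (expandsM (eC j) (psiC j)))).
have dec := expandsD (c0 (-1)) (expandsD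
  (expandsM (c1 (- (eps * corrector1 i))) D1)
  (expandsM (c2 (- (eps ^+ 2 * corrector2 i))) D2)).
apply: expands_eq (expandsD main dec) => [w delta|w|w].
- rewrite /step_error; congr (_ + _).
  by rewrite /corrected; ring.
- under eq_bigr do rewrite mul1r.
  by rewrite sum_delta /corrected; ring.
- under eq_bigr do rewrite mulr0 add0r mul1r mxE.
  under [X in _ + _ * X + _ = _]eq_bigr do rewrite mul1r.
  rewrite big_split/= !sum_delta.
  have -> : \sum_j nu * Q i j * corrected w j =
      nu * gen (fun j => eps * w * corrector1 j +
        (eps ^+ 2 * w ^+ 2 * corrector2 j + 1)) i.
    rewrite /generator mulr_sumr; apply: eq_bigr => j _.
    by rewrite /corrected; ring.
  rewrite !generatorD generator_cst// generator_corrector1 generator_corrector2.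
  by rewrite /corrected /step_residual /eps; field; rewrite gt_eqF.
Qed.

End tilted_step.

(** * The tilted chain over a fixed horizon *)

Lemma multiplicative_gronwall (R : realType) (Y : nat -> R) (x : R) (r : nat) :
  0 <= x <= 1 -> (forall l, 0 <= Y l) ->
  (forall l, (l < r)%N -> `|Y l.+1 - Y l| <= x * Y l) ->
  Y 0%N * (1 - r%:R * x) <= Y r <= Y 0%N * expR (r%:R * x).
Proof.
move=> /andP[x0 x1] Y0; elim: r => [|r IH] Yx.
  by rewrite mul0r subr0 expR0 mulr1 lexx.
have /andP[l1 l2] := IH (fun l lr => Yx l (leq_trans lr (leqnSn r))).
have := Yx r (leqnn _); rewrite ler_norml => /andP[h1 h2].
have Yr := Y0 r; have r0 : 0 <= r%:R :> R by [].
apply/andP; split.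
  have : Y 0%N * (1 - r%:R * x) * (1 - x) <= Y r * (1 - x).
    by rewrite ler_wpM2r ?subr_ge0.
  have : 0 <= Y 0%N * (r%:R * x ^+ 2) by rewrite mulr_ge0 ?mulr_ge0 ?sqr_ge0.
  by rewrite -natr1; nra.
rewrite -natr1 mulrDl mul1r expRD mulrA.
apply: (@le_trans _ _ (Y r * (1 + x))); first by lra.
apply: ler_pM => //; first by rewrite addr_ge0.
exact: expR_ge1Dx.
Qed.

Section tilted_chain.
Variables (R : realType) (d : nat) (Q : 'M[R]_d) (pi : 'cV[R]_d).
Hypothesis Q_rates : is_rate_matrix Q.
Hypothesis Q_irreducible : irreducible_rates Q.
Hypothesis pi_stationary : is_stationary Q pi.
Variables (lambda : 'I_d -> R) (m nu a t : R).
Hypothesis m_gt0 : 0 < m.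
Hypothesis nu_gt0 : 0 < nu.
Hypothesis t_ge0 : 0 <= t.

Definition weight (s : R) : R := expR (- (m * (t - s))).

Definition grid (r l : nat) : R := t * l%:R / r%:R.

(** Forward equation of the chain observed on the grid, tilted by the
    exponential of [a] times the weighted Riemann sum of the rates. *)
Definition tilted_recursion (p0 : 'I_d -> R) (y : nat -> nat -> 'I_d -> R) :=
  forall r : nat, (0 < r)%N -> [/\ y r 0%N = p0, (forall l i, 0 <= y r l i) &
    forall l j, (l < r)%N -> y r l.+1 j =
      \sum_i y r l i * transition (nu *: Q) (t / r%:R) i j *
        expR (a * weight (grid r l.+1) * lambda j * (t / r%:R))].

Let c := corrected Q pi lambda nu a.
Let X := step_exponent Q pi lambda m nu a.

Lemma weight_step r l : (0 < r)%N ->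
  weight (grid r l) = weight (grid r l.+1) * expR (- m * (t / r%:R)).
Proof.
move=> r0; rewrite /weight -expRD; congr expR; rewrite /grid -natr1; field.
by rewrite pnatr_eq0 -lt0n.
Qed.

Lemma weight_itv s : s <= t -> 0 <= weight s <= 1.
Proof.
move=> st; rewrite expR_ge0/= -expR0 ler_expR oppr_le0 mulr_ge0 ?(ltW m_gt0)//.
by rewrite subr_ge0.
Qed.

Lemma grid_le r l : (l <= r)%N -> grid r l <= t.
Proof.
move=> lr; case: r lr => [|r] lr; first by rewrite /grid invr0 mulr0.
by rewrite /grid ler_pdivrMr// ler_wpM2l// ler_nat.
Qed.

Lemma grid_end r : (0 < r)%N -> grid r r = t.
Proof. by move=> r0; rewrite /grid mulfK// pnatr_eq0 -lt0n. Qed.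

(** The exponents are the increments of a function of the weight, hence their
    sum telescopes and does not depend on the grid. *)
Lemma sum_step_exponent r : (0 < r)%N ->
  \sum_(0 <= l < r) X (weight (grid r l.+1)) (t / r%:R) =
  a ^+ 2 * U_coef Q pi lambda / nu * ((1 - expR (- (2 * m * t))) / (2 * m)) +
  a * varrho pi lambda m t.
Proof.
move=> r0.
pose f l := a ^+ 2 * U_coef Q pi lambda / nu / (2 * m) * weight (grid r l) ^+ 2 +
  a * lambda_infty pi lambda / m * weight (grid r l).
transitivity (\sum_(0 <= l < r) (f l.+1 - f l)).
  apply: eq_bigr => l _; rewrite /f (weight_step l r0) /X /step_exponent.
  by field; rewrite !gt_eqF.
rewrite telescope_sumr// /f grid_end//.
have -> : weight t = 1 by rewrite /weight subrr mulr0 oppr0 expR0.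
have -> : weight (grid r 0) = expR (- (m * t)).
  by rewrite /weight /grid mulr0 mul0r subr0.
rewrite /varrho expr1n mulr1 -expRM_natl.
have -> : 2%:R * - (m * t) = - (2 * m * t) by ring.
by field; rewrite !gt_eqF.
Qed.

Variables (eta rho : R).
Hypothesis eta_itv : 0 <= eta <= 1 / 2.
Hypothesis rho_ge0 : 0 <= rho.
Hypothesis corrected_eta : forall w i, 0 <= w <= 1 -> `|c w i - 1| <= eta.
Hypothesis residual_rho : forall w i, 0 <= w <= 1 ->
  `|step_residual Q pi lambda m nu a i w| <= rho.

(** The mass of the tilted chain, integrated against [corrected] and divided
    by its predicted growth, changes at each step by a relative amount
    [2 * t * rho / r] up to [O(r ^- 2)]. As [corrected] stays within [eta] of
    1, this encloses the total mass. *)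
Lemma tilted_chain_bounds (p0 : 'I_d -> R) (y : nat -> nat -> 'I_d -> R) (G : R) :
  (forall i, 0 <= p0 i) -> \sum_i p0 i = 1 -> tilted_recursion p0 y ->
  (fun r => \sum_i y r r i) @ \oo --> G ->
  forall K, K = expR (a ^+ 2 * U_coef Q pi lambda / nu *
    ((1 - expR (- (2 * m * t))) / (2 * m)) + a * varrho pi lambda m t) ->
  (1 - eta) * (1 - 2 * t * rho) * K <= (1 + eta) * G /\
  (1 - eta) * G <= (1 + eta) * expR (2 * t * rho) * K.
Proof.
move=> p00 p01 yrec yG K KE; case/andP: eta_itv => eta0 eta1.
have /choice[Ci hCi] : forall i, exists C, 0 <= C /\ forall w delta,
    0 <= w <= 1 -> 0 <= delta <= 1 ->
    `|step_error Q pi lambda m nu a i w delta| <= delta * rho + C * delta ^+ 2.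
  move=> i; have [C C0 hC] := step_error_expands Q_rates Q_irreducible
    pi_stationary lambda a m_gt0 nu_gt0 i.
  exists C; split=> // w delta w01 d01; have [_ _] := hC w delta w01 d01.
  rewrite add0r => h; have [d0 d1] := andP d01.
  rewrite -(subrK (delta * step_residual Q pi lambda m nu a i w) (step_error _ _ _ _ _ _ _ _ _)).
  rewrite addrC (le_trans (ler_normD _ _))// lerD// normrM (ger0_norm d0).
  by rewrite ler_wpM2l// residual_rho.
pose C := \sum_i Ci i.
have C0 : 0 <= C by apply: sumr_ge0 => i _; have [] := hCi i.
have errC i w delta : 0 <= w <= 1 -> 0 <= delta <= 1 ->
    `|step_error Q pi lambda m nu a i w delta| <= delta * rho + C * delta ^+ 2.
  move=> w01 d01; have [_ h] := hCi i; apply: (le_trans (h _ _ w01 d01)).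
  rewrite lerD2l ler_wpM2r ?sqr_ge0// /C (bigD1 i)//= lerDl.
  by apply: sumr_ge0 => j _; have [] := hCi j.
have cpos w i : 0 <= w <= 1 -> 1 - eta <= c w i <= 1 + eta.
  by move=> /(corrected_eta i); rewrite ler_norml => /andP[? ?]; apply/andP; split; lra.
pose x r : R := 2 * ((t / r%:R) * rho + C * (t / r%:R) ^+ 2).
have K0 : 0 < K by rewrite KE expR_gt0.
have finite r : (0 < r)%N -> t / r%:R <= 1 -> x r <= 1 ->
    (1 - eta) * (1 - r%:R * x r) * K <= (1 + eta) * (\sum_i y r r i) /\
    (1 - eta) * (\sum_i y r r i) <= (1 + eta) * expR (r%:R * x r) * K.
  move=> r0 d1 x1; have [y0 ypos ystep] := yrec r r0.
  have d0 : 0 <= t / r%:R by rewrite divr_ge0.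
  pose E l := expR (- \sum_(0 <= k < l) X (weight (grid r k.+1)) (t / r%:R)).
  (* The compensated mass after [l] steps. *)
  pose Y l := E l * \sum_i y r l i * c (weight (grid r l)) i.
  have Er : E r = K^-1 by rewrite /E sum_step_exponent// expRN KE.
  have S0 l : 0 <= \sum_i y r l i by apply: sumr_ge0.
  have Ylow l : (l <= r)%N -> (1 - eta) * E l * (\sum_i y r l i) <= Y l.
    move=> lr; rewrite [leLHS](_ : _ = E l * ((\sum_i y r l i) * (1 - eta))); last by ring.
    rewrite ler_wpM2l ?expR_ge0// mulr_suml; apply: ler_sum => i _; rewrite ler_wpM2l//.
    by have /andP[] := cpos _ i (weight_itv (grid_le lr)).
  have Yup l : (l <= r)%N -> Y l <= (1 + eta) * E l * (\sum_i y r l i).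
    move=> lr; rewrite [leRHS](_ : _ = E l * ((\sum_i y r l i) * (1 + eta))); last by ring.
    rewrite ler_wpM2l ?expR_ge0// mulr_suml; apply: ler_sum => i _.
    by rewrite ler_wpM2l//; have /andP[] := cpos _ i (weight_itv (grid_le lr)).
  have Y0 l : (l <= r)%N -> 0 <= Y l.
    move=> lr; apply: le_trans (Ylow l lr); rewrite !mulr_ge0 ?expR_ge0//; lra.
  have Ystep l : (l < r)%N -> `|Y l.+1 - Y l| <= x r * Y l.
    move=> lr.
    have -> : Y l.+1 - Y l = E l * \sum_i y r l i *
        step_error Q pi lambda m nu a i (weight (grid r l.+1)) (t / r%:R).
      rewrite /Y /E big_nat_recr//= opprD expRD.
      set e1 := expR (- \sum_(0 <= _ < _) _).
      rewrite -mulrA -mulrBr; congr (_ * _).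
      have -> : \sum_j y r l.+1 j * c (weight (grid r l.+1)) j =
          \sum_i y r l i * \sum_j transition (nu *: Q) (t / r%:R) i j *
            (expR (a * weight (grid r l.+1) * lambda j * (t / r%:R)) *
             c (weight (grid r l.+1)) j).
        under eq_bigr => j _ do rewrite ystep// mulr_suml.
        rewrite exchange_big/=; apply: eq_bigr => i _; rewrite mulr_sumr.
        by apply: eq_bigr => j _; rewrite !mulrA.
      rewrite mulr_sumr -sumrB; apply: eq_bigr => i _.
      by rewrite /step_error -(weight_step l r0) mulrBr mulrCA.
    rewrite normrM (ger0_norm (expR_ge0 _)).
    apply: (@le_trans _ _ (E l * ((\sum_i y r l i) * (x r / 2)))).
      rewrite ler_wpM2l ?expR_ge0// (le_trans (ler_norm_sum _ _ _))//.
      rewrite mulr_suml; apply: ler_sum => i _.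
      rewrite normrM (ger0_norm (ypos l i)) ler_wpM2l//.
      rewrite /x mulrAC divff// mul1r; apply: errC; last by rewrite d0.
      exact/weight_itv/grid_le.
    have xr0 : 0 <= x r by rewrite mulr_ge0// addr_ge0 ?mulr_ge0 ?sqr_ge0.
    rewrite [leLHS](_ : _ = x r * (1 / 2 * E l * (\sum_i y r l i))); last by field.
    rewrite ler_wpM2l//; apply: le_trans (Ylow l (ltnW lr)).
    by rewrite ler_wpM2r// ler_wpM2r ?expR_ge0//; lra.
  have xr0 : 0 <= x r by rewrite mulr_ge0// addr_ge0 ?mulr_ge0 ?sqr_ge0.
  (* Freezing [Y] after [r] steps keeps it nonnegative everywhere. *)
  pose Z l := Y (minn l r).
  have /andP[b1 b2] : Z 0%N * (1 - r%:R * x r) <= Z r <= Z 0%N * expR (r%:R * x r).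
    apply: multiplicative_gronwall; first by rewrite xr0.
      by move=> l; apply: Y0; exact: geq_minr.
    move=> l lr; rewrite /Z (minn_idPl lr) (minn_idPl (ltnW lr)); exact: Ystep.
  rewrite /Z min0n minnn in b1 b2.
  have E0 : E 0%N = 1 by rewrite /E big_geq// oppr0 expR0.
  have s1 := Ylow 0%N (leq0n r); have s2 := Yup 0%N (leq0n r).
  have s3 := Ylow r (leqnn r); have s4 := Yup r (leqnn r).
  rewrite E0 y0 p01 !mulr1 in s1 s2; rewrite Er in s3 s4.
  have e0 := expR_ge0 (r%:R * x r).
  split.
    rewrite -ler_pdivlMr//; apply: (@le_trans _ _ (Y r)); last first.
      by rewrite (le_trans s4)// mulrAC.
    have [neg|pos] := leP (1 - r%:R * x r) 0.
      apply: (@le_trans _ _ 0); last exact: Y0.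
      by rewrite mulr_ge0_le0//; lra.
    by apply: le_trans b1; rewrite ler_wpM2r// ltW.
  rewrite -ler_pdivrMr//; apply: (@le_trans _ _ (Y r)).
    by rewrite (le_trans _ s3)// mulrAC.
  by rewrite (le_trans b2)// ler_wpM2r.
have xlim : r%:R * x r @[r --> \oo] --> 2 * t * rho.
  have h : 2 * t * rho + 2 * C * t ^+ 2 * r%:R^-1 @[r --> \oo] -->
      2 * t * rho + 2 * C * t ^+ 2 * 0.
    by apply: cvgD; [exact: cvg_cst|apply: cvgMr; exact: cvg_natr_inv].
  rewrite mulr0 addr0 in h; apply: cvg_trans h; apply: near_eq_cvg; near=> r.
  have r0 : (r%:R : R) != 0.
    by rewrite pnatr_eq0 -lt0n; near: r; exact: nbhs_infty_gt.
  by rewrite /x; field.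
have tinv (b : R) : b * r%:R^-1 @[r --> \oo] --> 0.
  by rewrite -(mulr0 b); apply: cvgMr; exact: cvg_natr_inv.
have d1 : \forall r \near \oo, t / r%:R <= 1.
  by apply: (cvgr_le _ (tinv t)); exact: ltr01.
have x1 : \forall r \near \oo, x r <= 1.
  have xl : x r @[r --> \oo] --> 0.
    have h : 2 * rho * (t * r%:R^-1) + 2 * C * ((t * r%:R^-1) * (t * r%:R^-1)) @[r --> \oo] -->
        2 * rho * 0 + 2 * C * (0 * 0).
      by apply: cvgD; apply: cvgMr => //; exact: cvgM.
    rewrite !mulr0 addr0 in h; apply: cvg_trans h; apply: near_eq_cvg; near=> r.
    by rewrite /x; ring.
  by apply: (cvgr_le _ xl); exact: ltr01.
have L1 : (1 - eta) * (1 - r%:R * x r) * K @[r --> \oo] --> (1 - eta) * (1 - 2 * t * rho) * K.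
  apply: cvgMl; apply: cvgMr; apply: cvgB => //; exact: cvg_cst.
have L2 : (1 + eta) * expR (r%:R * x r) * K @[r --> \oo] --> (1 + eta) * expR (2 * t * rho) * K.
  apply: cvgMl; apply: cvgMr; exact: (continuous_cvg _ (@continuous_expR R _)).
have L3 : (1 + eta) * (\sum_i y r r i) @[r --> \oo] --> (1 + eta) * G by exact: cvgMr.
have L4 : (1 - eta) * (\sum_i y r r i) @[r --> \oo] --> (1 - eta) * G by exact: cvgMr.
split.
  apply: (ler_cvg_to L1 L3); near=> r.
  have [|||h _] := finite r; last exact: h.
  - by near: r; exact: nbhs_infty_gt.
  - by near: r.
  - by near: r.
apply: (ler_cvg_to L4 L2); near=> r.
have [|||_ h] := finite r; last exact: h.
- by near: r; exact: nbhs_infty_gt.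
- by near: r.
- by near: r.
Unshelve. all: by end_near. Qed.

End tilted_chain.

(** * The tilted chain as the background accelerates *)

Section tilted_limit.
Variables (R : realType) (d : nat) (Q : 'M[R]_d) (pi : 'cV[R]_d).
Hypothesis Q_rates : is_rate_matrix Q.
Hypothesis Q_irreducible : irreducible_rates Q.
Hypothesis pi_stationary : is_stationary Q pi.
Variables (lambda : 'I_d -> R) (m t : R).
Hypothesis m_gt0 : 0 < m.
Hypothesis t_ge0 : 0 <= t.
Let U : R := U_coef Q pi lambda.
Let h := corrector1 Q pi lambda.
Let k := corrector2 Q pi lambda.
Let g i : R := lambda i - lambda_infty pi lambda.

Let L : R := \sum_i (`|h i| + `|k i| + `|g i * k i|).

Let L_ge i : [/\ `|h i| <= L, `|k i| <= L & `|g i * k i| <= L].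
Proof.
have Li : `|h i| + `|k i| + `|g i * k i| <= L.
  rewrite /L (bigD1 i)//= lerDl; apply: sumr_ge0 => j _.
  by rewrite !addr_ge0.
have := normr_ge0 (h i); have := normr_ge0 (k i); have := normr_ge0 (g i * k i).
by split; lra.
Qed.

Let L0 : 0 <= L.
Proof. by apply: sumr_ge0 => i _; rewrite !addr_ge0. Qed.

Definition corrector_size (nu a : R) : R := (`|a / nu| + (a / nu) ^+ 2) * L.

Definition residual_size (nu a : R) : R :=
  `|a| * (a / nu) ^+ 2 * L + `|a ^+ 2 * U / nu| * corrector_size nu a
  + m * ((`|a / nu| + 2 * (a / nu) ^+ 2) * L).

Let corr_le (x w : R) i : 0 <= w <= 1 ->
  `|x * w * h i + x ^+ 2 * w ^+ 2 * k i| <= (`|x| + x ^+ 2) * L.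
Proof.
move=> /andP[w0 w1]; have [hL kL _] := L_ge i.
have w2 : w ^+ 2 <= 1 by rewrite expr_le1.
have s0 : 0 <= x ^+ 2 by exact: sqr_ge0.
apply: (le_trans (ler_normD _ _)); rewrite mulrDl lerD//.
  rewrite !normrM (ger0_norm w0) ler_pM ?mulr_ge0//.
  by rewrite ler_piMr.
have s1 := mulr_ge0 s0 (sqr_ge0 w).
by rewrite normrM (ger0_norm s1); apply: ler_pM => //; rewrite ler_piMr.
Qed.

Lemma corrected_near1 nu a w i : 0 <= w <= 1 ->
  `|corrected Q pi lambda nu a w i - 1| <= corrector_size nu a.
Proof.
move=> w01; rewrite /corrected -/h -/k (_ : _ - 1 =
  a / nu * w * h i + (a / nu) ^+ 2 * w ^+ 2 * k i); last by ring.
exact: corr_le.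
Qed.

Lemma step_residual_le nu a w i : 0 <= w <= 1 ->
  `|step_residual Q pi lambda m nu a i w| <= residual_size nu a.
Proof.
move=> /[dup] w01 /andP[w0 w1]; rewrite /step_residual /residual_size -/h -/k -/U -/(g i).
have [hL kL gkL] := L_ge i.
have w2 : w ^+ 2 <= 1 by rewrite expr_le1.
have w3 : w ^+ 3 <= 1 by rewrite expr_le1.
have s0 := sqr_ge0 (a / nu).
apply: (le_trans (ler_normD _ _)); apply: lerD.
  apply: (le_trans (ler_normB _ _)); apply: lerD.
    rewrite normrM ler_pM// -mulrA normrM ler_wpM2l//.
    have s3 := mulr_ge0 s0 (exprn_ge0 3 w0).
    by rewrite (ger0_norm s3) ler_piMr.
  rewrite normrM ler_pM//; last exact: corr_le.
  by rewrite normrM (ger0_norm (sqr_ge0 w)) ler_piMr.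
rewrite normrM (gtr0_norm m_gt0) ler_wpM2l ?(ltW m_gt0)//.
apply: (le_trans (ler_normD _ _)); rewrite [leRHS]mulrDl; apply: lerD.
  by rewrite normrM ler_pM// normrM (ger0_norm w0) ler_piMr.
have s2 : 0 <= 2 * (a / nu) ^+ 2 by rewrite mulr_ge0.
have s4 := mulr_ge0 s2 (sqr_ge0 w).
by rewrite normrM (ger0_norm s4); apply: ler_pM => //; rewrite ler_piMr.
Qed.

(** As [a ^+ 2 / nu] converges while [nu] tends to infinity, [a / nu] tends to
    zero, and the errors of [tilted_chain_bounds] vanish with it. *)
Lemma tilted_limit (nu a G : nat -> R) (beta : R)
    (p0 : nat -> 'I_d -> R) (y : nat -> nat -> nat -> 'I_d -> R) :
  (forall n, (0 < n)%N -> 0 < nu n) -> (nu n)^-1 @[n --> \oo] --> 0 ->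
  a n ^+ 2 / nu n @[n --> \oo] --> beta ->
  (forall n, (0 < n)%N -> [/\ (forall i, 0 <= p0 n i), \sum_i p0 n i = 1,
    tilted_recursion Q lambda m (nu n) (a n) t (p0 n) (y n) &
    (fun r => \sum_i y n r r i) @ \oo --> G n]) ->
  G n * expR (- (a n * varrho pi lambda m t)) @[n --> \oo] -->
  expR (beta * U * ((1 - expR (- (2 * m * t))) / (2 * m))).
Proof.
move=> nu0 nuoo abeta hyp.
have e2 : (a n / nu n) ^+ 2 @[n --> \oo] --> 0.
  have : a n ^+ 2 / nu n * (nu n)^-1 @[n --> \oo] --> beta * 0 by exact: cvgM.
  rewrite mulr0; apply: cvg_trans; apply: near_eq_cvg; near=> n.
  by rewrite exprMn expr2 mulrA.
have e1 : `|a n / nu n| @[n --> \oo] --> 0.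
  have : Num.sqrt ((a n / nu n) ^+ 2) @[n --> \oo] --> Num.sqrt 0.
    exact: (continuous_cvg _ (@sqrt_continuous R _)).
  by rewrite sqrtr0; under eq_fun do rewrite sqrtr_sqr.
have Ubeta : `|a n ^+ 2 * U / nu n| @[n --> \oo] --> `|beta * U|.
  apply: cvg_norm; have : a n ^+ 2 / nu n * U @[n --> \oo] --> beta * U by exact: cvgMl.
  by apply: cvg_trans; apply: near_eq_cvg; near=> n; rewrite mulrAC.
have etalim : corrector_size (nu n) (a n) @[n --> \oo] --> 0.
  have : (`|a n / nu n| + (a n / nu n) ^+ 2) * L @[n --> \oo] --> (0 + 0) * L.
    by apply: cvgMl; exact: cvgD.
  by rewrite addr0 mul0r.
have rholim : residual_size (nu n) (a n) @[n --> \oo] --> 0.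
  have h1 : `|a n| * (a n / nu n) ^+ 2 * L @[n --> \oo] --> `|beta| * 0 * L.
    have : `|a n ^+ 2 / nu n| * `|a n / nu n| * L @[n --> \oo] --> `|beta| * 0 * L.
      by apply: cvgMl; apply: cvgM => //; exact: cvg_norm.
    apply: cvg_trans; apply: near_eq_cvg; near=> n.
    congr (_ * L); rewrite -normrM -(ger0_norm (sqr_ge0 (a n / nu n))) -normrM.
    by congr (`|_|); ring.
  have h2 : `|a n ^+ 2 * U / nu n| * corrector_size (nu n) (a n) @[n --> \oo] -->
      `|beta * U| * 0 by exact: cvgM.
  have h3 : m * ((`|a n / nu n| + 2 * (a n / nu n) ^+ 2) * L) @[n --> \oo] -->
      m * ((0 + 2 * 0) * L).
    by apply: cvgMr; apply: cvgMl; apply: cvgD => //; exact: cvgMr.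
  have := cvgD (cvgD h1 h2) h3.
  by rewrite !mulr0 !addr0 !mul0r mulr0 addr0; apply.
set W := (1 - expR (- (2 * m * t))) / (2 * m).
pose E n := expR (a n ^+ 2 * U / nu n * W).
have Elim : E n @[n --> \oo] --> expR (beta * U * W).
  apply: (continuous_cvg _ (@continuous_expR R _)); apply: cvgMl.
  have : a n ^+ 2 / nu n * U @[n --> \oo] --> beta * U by exact: cvgMl.
  by apply: cvg_trans; apply: near_eq_cvg; near=> n; rewrite mulrAC.
pose eta n := corrector_size (nu n) (a n).
pose rho n := residual_size (nu n) (a n).
have eta0 n : 0 <= eta n by rewrite mulr_ge0// addr_ge0// sqr_ge0.
have rho0 n : 0 <= rho n.
  apply: addr_ge0; first apply: addr_ge0.
  - by apply: mulr_ge0 => //; apply: mulr_ge0 => //; exact: sqr_ge0.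
  - by apply: mulr_ge0 => //; exact: eta0.
  - apply: mulr_ge0; first exact: ltW.
    by apply: mulr_ge0 => //; apply: addr_ge0 => //; apply: mulr_ge0 => //; exact: sqr_ge0.
have m1 : 1 - eta n @[n --> \oo] --> (1 : R).
  by rewrite -[X in _ --> X](subr0 1); apply: cvgB => //; exact: cvg_cst.
have p1 : 1 + eta n @[n --> \oo] --> (1 : R).
  by rewrite -[X in _ --> X](addr0 1); apply: cvgD => //; exact: cvg_cst.
have lo : (1 - eta n) * (1 - 2 * t * rho n) / (1 + eta n) * E n @[n --> \oo] -->
    (1 : R) * (1 - 2 * t * 0) / 1 * expR (beta * U * W).
  apply: cvgM => //; apply: cvgM; last by apply: cvgV => //; exact: oner_neq0.
  by apply: cvgM => //; apply: cvgB; [exact: cvg_cst|exact: cvgMr].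
have up : (1 + eta n) * expR (2 * t * rho n) / (1 - eta n) * E n @[n --> \oo] -->
    (1 : R) * expR (2 * t * 0) / 1 * expR (beta * U * W).
  apply: cvgM => //; apply: cvgM; last by apply: cvgV => //; exact: oner_neq0.
  apply: cvgM => //; apply: (continuous_cvg _ (@continuous_expR R _)); exact: cvgMr.
rewrite mulr0 subr0 mulr1 divr1 mul1r in lo.
rewrite mulr0 expR0 mulr1 divr1 mul1r in up.
apply: (squeeze_cvgr _ lo up); near=> n.
have n0 : (0 < n)%N by near: n; exact: nbhs_infty_gt.
have eta2 : eta n <= 1 / 2.
  by near: n; apply: (cvgr_le _ etalim); rewrite divr_gt0.
have [q0 q1 rec yG] := hyp n n0.
have etaI : 0 <= eta n <= 1 / 2 by rewrite eta0.
have [b1 b2] := @tilted_chain_bounds _ _ _ _ Q_rates Q_irreducible pi_stationary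
  lambda m (nu n) (a n) t m_gt0 (nu0 n n0) t_ge0 (eta n) (rho n) etaI (rho0 n)
  (@corrected_near1 (nu n) (a n)) (fun w i => @step_residual_le (nu n) (a n) w i)
  _ _ (G n) q0 q1 rec yG _ erefl.
have en : 0 < 1 - eta n by have := eta0 n; lra.
have ep : 0 < 1 + eta n by have := eta0 n; lra.
move: b1 b2; rewrite expRD -/(E n) => b1 b2.
set x := expR (a n * _) in b1 b2; have x0 : 0 < x by exact: expR_gt0.
rewrite expRN -/x; apply/andP; split.
  rewrite ler_pdivlMr// -(ler_pM2l ep) (le_trans _ b1)// le_eqVlt; apply/orP; left.
  by apply/eqP; field; rewrite gt_eqF.
rewrite ler_pdivrMr// -(ler_pM2l en) (le_trans b2)// le_eqVlt; apply/orP; left.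
by apply/eqP; field; rewrite gt_eqF.
Unshelve. all: by end_near. Qed.

End tilted_limit.

(** * Riemann sums of right-continuous functions *)

Section right_riemann_sums.
Variables (R : realType) (f : R -> R) (a b C : R).
Hypothesis ab : a <= b.
Hypothesis f_right : forall s, a <= s < b -> f u @[u --> s^'+] --> f s.
Hypothesis f_bounded : forall s, a <= s <= b -> `|f s| <= C.
Notation leb := (@lebesgue_measure R).

Definition subdivision (r l : nat) : R := a + (b - a) * l%:R / r%:R.

Let cell (r l : nat) : set R := `]subdivision r l, subdivision r l.+1].

Let step (r : nat) (s : R) : R :=
  \sum_(0 <= l < r) f (subdivision r l.+1) * \1_(cell r l) s.

Lemma subdivision_le r l l' : (l <= l')%N -> subdivision r l <= subdivision r l'.
Proof.
move=> ll'; rewrite /subdivision lerD2l -!mulrA ler_wpM2l ?subr_ge0//.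
by rewrite ler_wpM2r ?invr_ge0// ler_nat.
Qed.

Lemma subdivision0 r : subdivision r 0 = a.
Proof. by rewrite /subdivision mulr0 mul0r addr0. Qed.

Lemma subdivision_end r : (0 < r)%N -> subdivision r r = b.
Proof.
by move=> r0; rewrite /subdivision mulfK ?pnatr_eq0 -?lt0n// addrC subrK.
Qed.

Lemma subdivision_itv r l : (l <= r)%N -> a <= subdivision r l <= b.
Proof.
move=> lr; apply/andP; split; first by rewrite -(subdivision0 r) subdivision_le.
case: r lr => [|r] lr; first by rewrite /subdivision invr0 mulr0 addr0.
by rewrite -(@subdivision_end r.+1)// subdivision_le.
Qed.

Lemma subdivisionS r l : subdivision r l.+1 = subdivision r l + (b - a) / r%:R.
Proof. by rewrite /subdivision -natr1; ring. Qed.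

Let stepE r s : (0 < r)%N -> a < s <= b ->
  exists u, [/\ step r s = f u, s <= u <= b & u <= s + (b - a) / r%:R].
Proof.
move=> r0 /andP[as_ sb].
have ex : exists l, s <= subdivision r l.+1.
  by exists r.-1; rewrite prednK// subdivision_end.
case: (ex_minnP ex) => l sl lmin.
have lr : (l < r)%N.
  by rewrite -(prednK r0) ltnS; apply: lmin; rewrite prednK// subdivision_end.
have ls : subdivision r l < s.
  case: l sl lmin lr => [|l] sl lmin lr; first by rewrite subdivision0.
  by rewrite ltNge; apply/negP => /lmin; rewrite ltnn.
exists (subdivision r l.+1); split.
- rewrite /step big_mkord (bigD1 (Ordinal lr))//= big1 ?addr0.
    by rewrite indicE mem_set ?mulr1// /cell/= in_itv/= ls sl.
  move=> k kl; rewrite indicE memNset ?mulr0// /cell/= in_itv/= => /andP[ks sk].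
  have lk : (l <= k)%N by exact: lmin.
  have : (l < k)%N by rewrite ltn_neqAle lk andbT eq_sym; exact: kl.
  move=> /(@subdivision_le r); rewrite leNgt => /negP; apply.
  exact: lt_le_trans ks sl.
- by rewrite sl; have /andP[] := subdivision_itv lr.
- by rewrite subdivisionS lerD2r ltW.
Qed.

Let step_cvg s : a < s <= b -> step ^~ s @ \oo --> f s.
Proof.
move=> sab; apply/cvgrPdist_le => e e0; case/andP: (sab) => as_ sb.
have [delta d0 hd] : exists2 delta, 0 < delta &
    forall u, s <= u <= b -> u < s + delta -> `|f s - f u| <= e.
  have [sb'|bs] := ltP s b; last first.
    exists 1 => // u /andP[su ub] _.
    have -> : u = s by apply/eqP; rewrite eq_le su (le_trans ub).
    by rewrite subrr normr0 ltW.
  have sab' : a <= s < b by rewrite (ltW as_).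
  have /cvgrPdist_le/(_ _ e0)[delta /= d0 hd] := f_right sab'.
  exists delta => // u /andP[su ub] usd.
  move: su; rewrite le_eqVlt => /predU1P[->|su]; first by rewrite subrr normr0 ltW.
  apply: hd => //=; rewrite distrC gtr0_norm ?subr_gt0//.
  by rewrite ltrBlDl.
near=> r; have r0 : (0 < r)%N by near: r; exact: nbhs_infty_gt.
have [u [-> /= su us]] := stepE r0 sab; apply: hd => //.
rewrite (le_lt_trans us)// ltrD2l.
near: r; have : (b - a) * r%:R^-1 @[r --> \oo] --> 0.
  by rewrite -(mulr0 (b - a)); apply: cvgMr; exact: cvg_natr_inv.
by move=> h; exact: (cvgr_lt _ h).
Unshelve. all: by end_near. Qed.

Let step_measurable r : measurable_fun `]a, b] (step r).
Proof.
apply: measurable_sum => l; apply: measurable_funM => //.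
by apply: measurable_indic; exact: measurable_itv.
Qed.

Let step_integral r : (0 < r)%N ->
  \int[leb]_(s in `]a, b]) step r s =
  \sum_(0 <= l < r) (b - a) / r%:R * f (subdivision r l.+1).
Proof.
move=> r0; have D0 : (b - a) / r%:R >= 0 by rewrite divr_ge0// subr_ge0.
have cellD l : (l < r)%N -> cell r l `<=` `]a, b].
  move=> lr s; rewrite /cell/= !in_itv/= => /andP[h1 h2]; apply/andP; split.
    by apply: le_lt_trans h1; have /andP[] := subdivision_itv (ltnW lr).
  by apply: (le_trans h2); have /andP[] := subdivision_itv lr.
have fin : (leb `]a, b]%classic < +oo)%E := lebesgue_itv_lty false false a b.
rewrite Rintegral_lincomb//; last first.
  move=> l; apply: (@integrable_bounded _ _ _ _ _ _ _ _ 1) => //.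
    by apply: measurable_indic; exact: measurable_itv.
  by move=> x _; rewrite indicE; case: (_ \in _); rewrite ?normr1 ?normr0.
rewrite !big_nat; apply: eq_bigr => l /andP[_ lr]; rewrite mulrC; congr (_ * _).
rewrite /Rintegral integral_indic//; last exact: measurable_itv.
rewrite setIidl; last exact: cellD.
have mc : leb (cell r l) = ((b - a) / r%:R)%:E.
  rewrite lebesgue_measure_itv/= subdivisionS; case: ifPn.
    by move=> _; rewrite -EFinB addrAC subrr add0r.
  rewrite lte_fin -leNgt gerDl => h; congr EFin.
  by apply/eqP; rewrite eq_le D0 h.
by transitivity (fine ((b - a) / r%:R)%:E); first exact (congr1 (@fine R) mc).
Qed.

(** Right endpoints are the natural choice for a right-continuous function:
    the step functions then converge pointwise. *)
Lemma right_riemann_sum :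
  (fun r => \sum_(0 <= l < r) (b - a) / r%:R * f (subdivision r l.+1)) @ \oo
    --> \int[leb]_(s in `[a, b]) f s.
Proof.
have fin : (leb `]a, b]%classic < +oo)%E := lebesgue_itv_lty false false a b.
have stepC n x : `]a, b]%classic x -> `|step n x| <= `|C|.
  rewrite /= in_itv/= => xab; case: n => [|n].
    by rewrite /step big_geq// normr0.
  have [u [-> /andP[xu ub] _]] := stepE (ltn0Sn n) xab.
  apply: le_trans (ler_norm C); apply: f_bounded; rewrite ub andbT.
  by case/andP: xab => ax _; rewrite (le_trans (ltW ax)).
have stepf x : `]a, b]%classic x -> step ^~ x @ \oo --> f x.
  by rewrite /= in_itv/=; exact: step_cvg.
have [mf cv] := @bounded_convergence _ _ _ leb _ (measurable_itv _) fin step f `|C|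
  step_measurable stepC stepf.
have i_f : leb.-integrable `]a, b] (EFin \o f).
  apply: (@integrable_bounded _ _ _ _ _ _ _ _ C) => // x /=.
  by rewrite in_itv/= => /andP[ax xb]; apply: f_bounded; rewrite ltW.
rewrite -Rintegral_itv_obnd_cbnd//; apply: cvg_trans cv; apply: near_eq_cvg.
by near=> r; rewrite step_integral//; near: r; exact: nbhs_infty_gt.
Unshelve. all: by end_near. Qed.

Lemma right_continuous_integrable : leb.-integrable `[a, b] (EFin \o f).
Proof.
have fin' : (leb `[a, b]%classic < +oo)%E := lebesgue_itv_lty true false a b.
have mf : measurable_fun `]a, b] f.
  by apply: (measurable_fun_cvg step_measurable) => s; exact: step_cvg.
apply: (@integrable_bounded _ _ _ _ _ _ _ _ C) => //.
by apply/measurable_fun_itv_obnd_cbndP.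
Qed.

End right_riemann_sums.

(** * Functions of the background at successive times *)

Section markov_expectations.
Variables (R : realType) (d : nat) (A : 'M[R]_d) (disp : measure_display)
  (Omega : measurableType disp) (P : probability Omega R)
  (J : R -> Omega -> 'I_d).
Hypothesis J_markov : is_markov_process A P J.

Definition state_indicator (s : R) (i : 'I_d) (w : Omega) : R := (J s w == i)%:R.

Lemma state_indicatorE s i : state_indicator s i = \1_(J s @^-1` [set i]).
Proof.
apply/funext => w; rewrite /state_indicator indicE.
by case: eqP => h; [rewrite mem_set|rewrite memNset].
Qed.

Lemma measurable_state_indicator s i : 0 <= s ->
  measurable_fun [set: Omega] (state_indicator s i).
Proof.
move=> s0; rewrite state_indicatorE; apply: measurable_indic.
exact: (markov_measurable J_markov).
Qed.

Lemma state_functionE (f : 'I_d -> R) s w :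
  f (J s w) = \sum_i f i * state_indicator s i w.
Proof.
rewrite (bigD1 (J s w))//= /state_indicator eqxx mulr1 big1 ?addr0// => i.
by rewrite eq_sym => /negbTE ->; rewrite mulr0.
Qed.

Lemma measurable_state_function (f : 'I_d -> R) s : 0 <= s ->
  measurable_fun [set: Omega] (fun w => f (J s w)).
Proof.
move=> s0; under eq_fun do rewrite state_functionE.
apply: measurable_sum => i; apply: measurable_funM => //.
exact: measurable_state_indicator.
Qed.

Variable s : nat -> R.
Hypothesis s_start : s 0%N = 0.
Hypothesis s_nondecreasing : forall l, s l <= s l.+1.

Lemma times_ge0 l : 0 <= s l.
Proof.
elim: l => [|l IH]; first by rewrite s_start.
exact: le_trans IH (s_nondecreasing l).
Qed.

Variable f : nat -> 'I_d -> R.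

(** The expectation of the product of the [f] at the times before [s l], on the
    event that the state is [k] at time [s l]. *)
Fixpoint forward (l : nat) (k : 'I_d) : R :=
  if l is l'.+1 then
    \sum_i forward l' i * f l' i * transition A (s l - s l') i k
  else fine (P (J 0 @^-1` [set k])).

Let integrand (n j : nat) (i : nat -> 'I_d) (w : Omega) : R :=
  (\prod_(0 <= l < j) f l (J (s l) w)) *
  \prod_(j <= l < n.+1) state_indicator (s l) (i l) w.

Let integrand_integrable n j i : P.-integrable [set: Omega] (EFin \o integrand n j i).
Proof.
have mi : measurable_fun [set: Omega] (integrand n j i).
  apply: measurable_funM; apply: measurable_prod => l _.
    by apply: measurable_state_function; exact: times_ge0.
  by apply: measurable_state_indicator; exact: times_ge0.
have finP : (P [set: Omega] < +oo)%E by rewrite probability_setT ltry.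
apply: (@integrable_bounded _ _ _ P _ measurableT finP _
  (\prod_(0 <= l < j) (\sum_k `|f l k|))) => //.
move=> w _; rewrite /integrand normrM.
have /andP[q0 q1] : 0 <= \prod_(j <= l < n.+1) state_indicator (s l) (i l) w <= 1.
  by apply: prodr_itv01 => l; rewrite /state_indicator; case: eqP; rewrite lexx ler01.
rewrite (ger0_norm q0); apply: (@le_trans _ _ (`|\prod_(0 <= l < j) f l (J (s l) w)| * 1)).
  by rewrite ler_wpM2l.
rewrite mulr1 normr_prod; apply: ler_prod => l _; rewrite normr_ge0/=.
by rewrite (bigD1 (J (s l) w))//= lerDl sumr_ge0.
Qed.

(** Induction on the number [j] of times that carry a function. Expanding the
    last one over the states leaves a path that is prescribed from time
    [s j] on; with no function left, this is the finite-dimensional law. *)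
Lemma forward_expectation n j (i : nat -> 'I_d) : (j <= n)%N ->
  \int[P]_w integrand n j i w =
  forward j (i j) * \prod_(j <= l < n) transition A (s l.+1 - s l) (i l) (i l.+1).
Proof.
elim: j i => [|j IH] i jn.
  have := markov_fdd J_markov n i s_start s_nondecreasing.
  rewrite big_mkord /= => h; rewrite /Rintegral.
  have -> : (\int[P]_w (integrand n 0 i w)%:E)%E =
      P [set w | forall l, (l <= n)%N -> J (s l) w = i l].
    have mB : measurable [set w | forall l, (l <= n)%N -> J (s l) w = i l].
      rewrite (_ : [set w | _] =
        \bigcap_(l in [set l | (l <= n)%N]) (J (s l) @^-1` [set i l])).
        apply: bigcap_measurable => [|l _].
          by exists 0%N.
        by apply: (markov_measurable J_markov); exact: times_ge0.
      by apply/seteqP; split => w h' l ln; exact: h'.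
    rewrite -[X in P X]setIT -integral_indic//; apply: eq_integral => w _.
    congr EFin; rewrite /integrand big_geq// mul1r indicE.
    have [wB|wB] := boolP (w \in _).
      rewrite big_nat big1// => l /andP[_ ln]; rewrite /state_indicator.
      by move: wB; rewrite inE => /(_ l ln) ->; rewrite eqxx.
    apply/eqP; move: wB; rewrite notin_setE => /existsNP[l /not_implyP[ln Jl]].
    rewrite (big_cat_nat _ (n := l))//=; last exact: leqW.
    rewrite [X in _ * X]big_ltn ?ltnS//; have -> : state_indicator (s l) (i l) w = 0.
      by rewrite /state_indicator; case: eqP.
    by rewrite mul0r mulr0.
  rewrite h fineM//.
  by rewrite fin_num_measure//; apply: (markov_measurable J_markov).
pose path k l := if l == j then k else i l.
have -> : integrand n j.+1 i = (fun w => \sum_k f j k * integrand n j (path k) w).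
  apply/funext => w; rewrite /integrand big_nat_recr//= state_functionE.
  rewrite mulr_sumr mulr_suml; apply: eq_bigr => k _.
  rewrite -!mulrA mulrCA; congr (_ * (_ * _)).
  rewrite [RHS]big_ltn; last by rewrite ltnS ltnW.
  congr (_ * _); first by rewrite /path eqxx.
  rewrite !big_nat; apply: eq_bigr => l /andP[jl _].
  by rewrite /path gtn_eqF.
rewrite Rintegral_lincomb//.
rewrite mulr_suml; apply: eq_bigr => k _; rewrite IH; last exact: ltnW.
rewrite {1}/path eqxx big_ltn// {1}/path eqxx /path gtn_eqF//.
rewrite mulrA [f j k * _]mulrC mulrA; congr (_ * _).
rewrite !big_nat; apply: eq_bigr => l /andP[jl _].
by rewrite !gtn_eqF// ltnW.
Qed.

Lemma forward_ge0 l k : (forall l k, 0 <= f l k) -> 0 <= forward l k.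
Proof.
move=> f0; have := @forward_expectation l l (fun=> k) (leqnn l).
rewrite [X in _ * X]big_geq// mulr1 => <-; apply: Rintegral_ge0 => w _.
rewrite mulr_ge0//; apply: prodr_ge0 => // j _; exact: ler0n.
Qed.

Lemma forward_sum n :
  \int[P]_w (\prod_(0 <= l < n.+1) f l (J (s l) w)) = \sum_k f n k * forward n k.
Proof.
have -> : (fun w => \prod_(0 <= l < n.+1) f l (J (s l) w)) =
    (fun w => \sum_k f n k * integrand n n (fun=> k) w).
  apply/funext => w; rewrite big_nat_recr//= state_functionE mulr_sumr.
  apply: eq_bigr => k _; rewrite /integrand big_nat1; ring.
rewrite Rintegral_lincomb//; apply: eq_bigr => k _.
by rewrite forward_expectation// [X in _ * (_ * X)]big_geq// mulr1.
Qed.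

End markov_expectations.

(** * Service times given the background and the arrivals *)

Section services.
Variables (R : realType) (d : nat) (md : model) (mu : 'I_d -> R) (m : R)
  (disp : measure_display) (Omega : measurableType disp)
  (P : probability Omega R) (J : R -> Omega -> 'I_d)
  (T : nat -> Omega -> \bar R) (S : nat -> Omega -> R).
Hypothesis S_service : is_service md mu P J T S.
Hypothesis mu_eq : forall i, mu i = m.

Lemma survival_cst path tau x : 0 <= x -> survival md mu path tau x = expR (- (m * x)).
Proof.
move=> x0; case: md; rewrite /survival; last by rewrite mu_eq.
under eq_Rintegral do rewrite mu_eq.
by rewrite Rintegral_itv_cst ?lerDl// addrAC subrr add0r.
Qed.

Definition outlives (x : R) (l : nat) (w : Omega) : bool := x < S l w.

Lemma measurable_outlives x l :
  measurable_fun [set: Omega] (fun w => (outlives x l w)%:R : R).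
Proof.
have -> : (fun w => (outlives x l w)%:R : R) = \1_(S l @^-1` `]x, +oo[).
  apply/funext => w; rewrite indicE /outlives; have [h|h] := boolP (x < S l w).
    by rewrite mem_set//= in_itv/= andbT.
  by rewrite memNset//= in_itv/= andbT; exact/negP.
apply: measurable_indic; rewrite -[X in measurable X]setTI.
by apply: (service_measurable S_service).
Qed.

Variables (n : nat) (B : set Omega).
Hypothesis mB : measurable B.
Hypothesis B_sigma : sigma_background_arrivals J T B.
Hypothesis B_fin : forall w l, B w -> (l < n)%N -> (T l w < +oo)%E.

Lemma outlive_probability (x : nat -> R) : (forall l, 0 <= x l) ->
  \int[P]_(w in B) (\prod_(0 <= l < n) (outlives (x l) l w)%:R) =
  fine (P B) * \prod_(0 <= l < n) expR (- (m * x l)).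
Proof.
move=> x0; have := service_survival S_service x0 B_sigma B_fin.
have mO : measurable [set w | forall l, (l < n)%N -> x l < S l w].
  rewrite (_ : [set w | _] =
    \bigcap_(l in [set l | (l < n)%N]) (S l @^-1` `]x l, +oo[)); last first.
    apply/seteqP; split => w h l /= ln; first by rewrite in_itv/= andbT; exact: h.
    by have := h l ln; rewrite /= in_itv/= andbT.
  have [->|n0] := posnP n.
    by rewrite (_ : [set l | _] = set0) ?bigcap_set0//; apply/seteqP; split.
  apply: bigcap_measurable => [|l _]; first by exists 0%N.
  rewrite -[X in measurable X]setTI; exact: (service_measurable S_service).
under eq_integral do under eq_bigr do rewrite survival_cst//.
rewrite integral_cst// => h; rewrite /Rintegral.
have -> : (\int[P]_(w in B) (\prod_(0 <= l < n) (outlives (x l) l w)%:R)%:E)%E =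
    P (B `&` [set w | forall l, (l < n)%N -> x l < S l w]).
  rewrite setIC -integral_indic//; apply: eq_integral => w _; congr EFin.
  rewrite indicE; have [wO|wO] := boolP (w \in _).
    rewrite big_nat big1// => l /andP[_ ln]; rewrite /outlives.
    by move: wO; rewrite inE => /(_ l ln) ->.
  move: wO; rewrite notin_setE => /existsNP[l /not_implyP[ln /negP xS]].
  rewrite big_mkord (bigD1 (Ordinal ln))//= /outlives (negbTE xS).
  by rewrite mul0r.
rewrite h fineM//; last by rewrite fin_num_measure.
by rewrite mulrC big_mkord.
Qed.

Variables (z : R) (X : nat -> R).
Hypothesis X_ge0 : forall l, 0 <= X l.

(** Equal to [z ^+ outlives (X l) l w] when the service time is positive, but
    linear in indicators of survival events. *)
Let factor (l : nat) (w : Omega) : R :=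
  (outlives 0 l w)%:R + (z - 1) * (outlives (X l) l w)%:R.

Let integrand (j : nat) (y : nat -> R) (w : Omega) : R :=
  (\prod_(0 <= l < j) factor l w) * \prod_(j <= l < n) (outlives (y l) l w)%:R.

Let integrand_measurable j y : measurable_fun [set: Omega] (integrand j y).
Proof.
apply: measurable_funM; apply: measurable_prod => l _; last exact: measurable_outlives.
apply: measurable_funD; first exact: measurable_outlives.
by apply: measurable_funM => //; exact: measurable_outlives.
Qed.

Let P_fin D : measurable D -> (P D < +oo)%E.
Proof. by move=> mD; rewrite -ge0_fin_numE// fin_num_measure. Qed.

Let integrand_integrable j y : P.-integrable B (EFin \o integrand j y).
Proof.
apply: (@integrable_bounded _ _ _ P _ mB (P_fin mB) _ (\prod_(0 <= l < j) (1 + `|z - 1|))).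
  exact: measurable_funTS.
move=> w _; rewrite /integrand normrM -[leRHS]mulr1; apply: ler_pM => //.
  rewrite normr_prod; apply: ler_prod => l _; rewrite normr_ge0/=.
  rewrite (le_trans (ler_normD _ _))// lerD//.
    by case: outlives; rewrite ?normr1 ?normr0.
  by rewrite normrM; case: outlives; rewrite ?normr1 ?normr0 ?mulr1 ?mulr0.
have /andP[q0 q1] : 0 <= \prod_(j <= l < n) ((outlives (y l) l w)%:R : R) <= 1.
  by apply: prodr_itv01 => l; case: outlives; rewrite lexx ler01.
by rewrite ger0_norm.
Qed.

Lemma factor_expectation j (y : nat -> R) : (j <= n)%N -> (forall l, 0 <= y l) ->
  \int[P]_(w in B) integrand j y w =
  fine (P B) * ((\prod_(0 <= l < j) (1 + (z - 1) * expR (- (m * X l)))) *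
    \prod_(j <= l < n) expR (- (m * y l))).
Proof.
elim: j y => [|j IH] y jn y0.
  rewrite big_geq// mul1r -outlive_probability//.
  by apply: eq_Rintegral => w _; rewrite /integrand big_geq// mul1r.
pose set_y v l := if l == j then v else y l.
have set_y0 v : 0 <= v -> forall l, 0 <= set_y v l.
  by move=> v0 l; rewrite /set_y; case: eqP.
have tailE (F : nat -> R -> R) v : \prod_(j <= l < n) F l (set_y v l) =
    F j v * \prod_(j.+1 <= l < n) F l (y l).
  rewrite big_ltn// /set_y eqxx; congr (_ * _).
  by rewrite !big_nat; apply: eq_bigr => l /andP[jl _]; rewrite gtn_eqF.
have -> : integrand j.+1 y = (fun w => \sum_(v <- [:: (1, 0); (z - 1, X j)])
    v.1 * integrand j (set_y v.2) w).
  apply/funext => w; rewrite !big_cons big_nil addr0 /= /integrand.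
  rewrite (tailE (fun l v => (outlives v l w)%:R)).
  rewrite (tailE (fun l v => (outlives v l w)%:R)).
  by rewrite big_nat_recr//= /factor; ring.
rewrite [in RHS]big_nat_recr//.
rewrite Rintegral_lincomb// !big_cons big_nil addr0 /= !IH ?(ltnW jn)//;
  [|exact: set_y0..].
rewrite !(tailE (fun l v => expR (- (m * v)))) mulr0 oppr0 expR0.
ring.
Qed.

(** Given the background and the arrivals, the survival indicators are
    independent Bernoulli variables. *)
Lemma outlive_generating_function : 0 <= z ->
  (\int[P]_(w in B) (\prod_(0 <= l < n) z ^+ (outlives (X l) l w))%:E)%E =
  (P B * (\prod_(0 <= l < n) (1 + (z - 1) * expR (- (m * X l))))%:E)%E.
Proof.
move=> z0.
have fac := factor_expectation (leqnn n) (fun=> lexx 0).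
rewrite [X in _ * (_ * X)]big_geq// mulr1 in fac.
have -> : (P B * (\prod_(0 <= l < n) (1 + (z - 1) * expR (- (m * X l))))%:E)%E =
    (\int[P]_(w in B) (integrand n (fun=> 0) w)%:E)%E.
  rewrite -[P B](@fineK _ (P B)) ?fin_num_measure// -EFinM -fac /Rintegral fineK//.
  by apply: integrable_fin_num => //; exact: integrand_integrable.
(* The given law makes the service times positive almost surely. *)
pose O := [set w | forall l, (l < n)%N -> 0 < S l w].
have mO : measurable O.
  rewrite (_ : O = \bigcap_(l in [set l | (l < n)%N]) (S l @^-1` `]0%R, +oo[%classic)); last first.
    apply/seteqP; split => w h l /= ln; first by rewrite in_itv/= andbT; exact: h.
    by have := h l ln; rewrite /= in_itv/= andbT.
  have [->|n0] := posnP n.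
    by rewrite (_ : [set l | _] = set0) ?bigcap_set0//; apply/seteqP; split.
  apply: bigcap_measurable => [|l _]; first by exists 0%N.
  rewrite -[X in measurable X]setTI; exact: (service_measurable S_service).
have PO : P (B `\` O) = 0%E.
  have := service_survival S_service (x := fun=> 0) (fun=> lexx 0) B_sigma B_fin.
  under eq_integral do under eq_bigr do rewrite survival_cst// mulr0 oppr0 expR0.
  under eq_integral do rewrite big1//.
  rewrite integral_cst// mul1e => h.
  have hO : P (B `&` O) = P B by exact: h.
  rewrite measureD//; last exact: P_fin.
  transitivity (P B - P B)%E; first by congr (_ - _)%E; exact: hO.
  by rewrite subee// fin_num_measure.
apply: ae_eq_integral => //.
- apply/measurable_EFinP; apply: measurable_funTS; apply: measurable_prod => l _.
  rewrite (_ : (fun w => _) = (fun w => 1 + (z - 1) * (outlives (X l) l w)%:R)).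
    by apply: measurable_funD => //; apply: measurable_funM => //; exact: measurable_outlives.
  by apply/funext => w; case: outlives => /=; rewrite ?expr1 ?expr0; ring.
- by apply/measurable_EFinP; apply: measurable_funTS; exact: integrand_measurable.
exists (B `\` O); split => //; first exact: measurableD.
move=> w /= /not_implyP[Bw ne]; split => // Ow; apply: ne; congr EFin.
rewrite /integrand [X in _ * X]big_geq// mulr1 !big_nat.
apply: eq_bigr => l /andP[_ ln]; rewrite /factor {2}/outlives (Ow l ln).
by case: outlives => /=; rewrite ?expr1 ?expr0; ring.
Qed.

End services.

(** * Counting the arrivals *)

Section counting.

Lemma card_fset_set_sum (X : set nat) (K : nat) : (forall k, X k -> (k < K)%N) ->
  #|` fset_set X| = (\sum_(0 <= k < K) (k \in X))%N.
Proof.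
elim: K X => [|K IH] X XK.
  have -> : X = set0 by rewrite -subset0 => k /XK.
  by rewrite fset_set0 cardfs0 big_geq.
have finX : finite_set X by apply: (@sub_finite_set _ _ `I_K.+1) => // k; exact: XK.
rewrite big_nat_recr//= (cardfsD1 K) in_fset_set// addnC; congr (_ + _)%N.
rewrite -fset_setD1// IH => [|k [Xk kK]].
  rewrite !big_nat; apply: eq_bigr => k /andP[_ kK].
  have [Xk|Xk] := pselect (X k); last by rewrite !memNset// => -[].
  by rewrite !mem_set//; split => //= kK'; rewrite kK' ltnn in kK.
by have := XK k Xk; rewrite ltnS leq_eqVlt => /predU1P[].
Qed.

Lemma sum_nat_cells (I : Type) (idx : I) (op : Monoid.law idx) (s : nat -> nat)
    (F : nat -> I) n : (forall l, (s l <= s l.+1)%N) ->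
  \big[op/idx]_(s 0%N <= k < s n) F k =
  \big[op/idx]_(0 <= l < n) \big[op/idx]_(s l <= k < s l.+1) F k.
Proof.
move=> s_le; elim: n => [|n IH]; first by rewrite !big_geq.
rewrite big_nat_recr//= -IH -big_cat_nat//.
by elim: n {IH} => // n; move=> /leq_trans; apply.
Qed.

End counting.

Section arrivals.
Variables (R : realType) (Omega : Type) (T : nat -> Omega -> \bar R).
Hypothesis T_gt0 : forall k w, (0 < T k w)%E.
Hypothesis T_nondecreasing : forall k w, (T k w <= T k.+1 w)%E.
Hypothesis T_finite : forall w (t : R), finite_set [set k | (T k w <= t%:E)%E].

Definition arrived (u : R) (w : Omega) : nat := arrivals T 0 u w.

Lemma arrival_mono k k' w : (k <= k')%N -> (T k w <= T k' w)%E.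
Proof.
move=> /subnK <-; elim: (k' - k)%N => [|n IH]; first by rewrite add0n.
by rewrite addSn; exact: le_trans IH (T_nondecreasing _ _).
Qed.

(** By monotonicity and local finiteness, the arrivals up to time [u] form an
    initial segment of the indices. *)
Lemma arrivedP u w k : (T k w <= u%:E)%E = (k < arrived u w)%N.
Proof.
have [K TK] : exists K, ~~ (T K w <= u%:E)%E.
  apply/not_existsP => h; apply: infinite_nat.
  apply: sub_finite_set (T_finite w u) => k' _ /=.
  by have /negP := h k'; rewrite negbK.
have : exists K, ~~ (T K w <= u%:E)%E by exists K.
move=> /ex_minnP[c Tc cmin].
have TE k' : (T k' w <= u%:E)%E = (k' < c)%N.
  apply/idP/idP => [Tk|k'c].
    rewrite ltnNge; apply/negP => ck'; move/negP: Tc; apply.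
    exact: le_trans (arrival_mono w ck') Tk.
  by apply/negPn/negP => /cmin; rewrite leqNgt k'c.
rewrite TE /arrived /arrivals (@card_fset_set_sum _ c).
  rewrite big_nat (eq_bigr (fun=> 1%N)) -?big_nat ?sum_nat_const_nat ?subn0 ?muln1//.
  move=> k' /andP[_ k'c]; rewrite mem_set//=.
  by rewrite T_gt0 TE.
by move=> k' /= /andP[_]; rewrite TE.
Qed.

Lemma arrived_le u v w : u <= v -> (arrived u w <= arrived v w)%N.
Proof.
move=> uv; rewrite leqNgt; apply/negP; rewrite -arrivedP => h.
have : (T (arrived v w) w <= v%:E)%E by apply: (le_trans h); rewrite lee_fin.
by rewrite arrivedP ltnn.
Qed.

Lemma arrived0 w : arrived 0 w = 0%N.
Proof.
apply/eqP; rewrite -leqn0 leqNgt; apply/negP; rewrite -arrivedP.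
by rewrite leNgt T_gt0.
Qed.

Lemma arrivalsE u v w : u <= v -> arrivals T u v w = (arrived v w - arrived u w)%N.
Proof.
move=> uv; rewrite /arrivals (@card_fset_set_sum _ (arrived v w)).
  rewrite (big_cat_nat _ (n := arrived u w))//=; last exact: arrived_le.
  rewrite big_nat big1 ?add0n; last first.
    move=> k /andP[_]; rewrite -arrivedP => Tk.
    by rewrite memNset//= => /andP[]; rewrite ltNge Tk.
  rewrite big_nat (eq_bigr (fun=> 1%N)) -?big_nat ?sum_nat_const_nat ?muln1//.
  move=> k /andP[uk kv]; rewrite mem_set//= arrivedP kv andbT.
  by rewrite ltNge arrivedP -leqNgt.
by move=> k /= /andP[_]; rewrite arrivedP.
Qed.

Lemma jobsE (S : nat -> Omega -> R) t w :
  jobs T S t w = (\sum_(0 <= k < arrived t w) (t%:E < T k w + (S k w)%:E)%E)%N.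
Proof.
rewrite /jobs (@card_fset_set_sum _ (arrived t w)).
  rewrite !big_nat; apply: eq_bigr => k /andP[_ kt].
  have [h|h] := boolP (t%:E < T k w + (S k w)%:E)%E.
    by rewrite mem_set//= arrivedP kt.
  by rewrite memNset//= => /andP[_]; exact/negP.
by move=> k /= /andP[]; rewrite arrivedP.
Qed.

Definition cell_event (g : nat -> R) (n : nat) (a : nat -> nat) : set Omega :=
  [set w | forall l, (l < n)%N -> arrivals T (g l) (g l.+1) w = a l].

Variables (g : nat -> R) (n : nat).
Hypothesis g_start : g 0%N = 0.
Hypothesis g_nondecreasing : forall l, g l <= g l.+1.

Definition partial_count (a : nat -> nat) (l : nat) : nat := (\sum_(0 <= i < l) a i)%N.

Lemma cell_eventP a w : cell_event g n a w <->
  forall l, (l <= n)%N -> arrived (g l) w = partial_count a l.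
Proof.
split=> [h|h l ln].
  elim=> [|l IH] ln; first by rewrite g_start arrived0 /partial_count big_geq.
  have := h l ln; rewrite arrivalsE// => al.
  rewrite /partial_count big_nat_recr//= -/(partial_count a l) -IH; last exact: ltnW.
  by rewrite -al subnKC//; exact: arrived_le.
rewrite arrivalsE// !h//; last exact: ltnW.
by rewrite /partial_count big_nat_recr//= addKn.
Qed.

(** The event is decided by comparing each epoch with the grid points. *)
Lemma cell_event_sigma (G : set (set Omega)) a : sigma_algebra [set: Omega] G ->
  (forall k (C : set (\bar R)), measurable C -> G (T k @^-1` C)) ->
  G (cell_event g n a).
Proof.
move=> [G0 GC GU] GT.
have GI (F : nat -> set Omega) : (forall k, G (F k)) -> G (\bigcap_k F k).
  move=> GF; rewrite -[X in G X]setCK setC_bigcap -setTD; apply: (GC).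
  by apply: GU => k; rewrite -setTD; exact: GC.
have GT' : G setT by rewrite -setC0 -setTD; exact: GC.
pose F l k := [set w | (l <= n)%N ->
  (T k w <= (g l)%:E)%E = (k < partial_count a l)%N].
have -> : cell_event g n a = \bigcap_l \bigcap_k F l k.
  apply/seteqP; split => w.
    by move=> /cell_eventP h l _ k _ ln; rewrite arrivedP h.
  move=> h; apply/cell_eventP => l ln.
  have E k : (k < arrived (g l) w)%N = (k < partial_count a l)%N.
    by rewrite -arrivedP; exact: (h l I k I ln).
  apply/eqP; rewrite eqn_leq; apply/andP; split.
    by rewrite leqNgt E ltnn.
  by rewrite leqNgt -E ltnn.
apply: (GI) => l; apply: (GI) => k; rewrite /F; case: (leqP l n) => ln; last first.
  by rewrite (_ : [set w | _] = setT)//; apply/seteqP; split.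
case: (k < partial_count a l)%N.
  rewrite (_ : [set w | _] = T k @^-1` `]-oo, (g l)%:E]%classic).
    by apply: GT; exact: emeasurable_itv.
  apply/seteqP; split => w /=; rewrite in_itv/=; first exact.
  by move=> ->.
rewrite (_ : [set w | _] = T k @^-1` `](g l)%:E, +oo[%classic).
  by apply: GT; exact: emeasurable_itv.
apply/seteqP; split => w /=; rewrite in_itv/= andbT ltNge.
  by move=> /(_ isT) ->.
by move=> /negbTE ->.
Qed.

End arrivals.

(** * Thinning of the arrivals on a grid *)

Section thinning.
Variables (R : realType) (d : nat) (md : model) (la mu : 'I_d -> R) (m : R)
  (disp : measure_display) (Omega : measurableType disp)
  (P : probability Omega R) (J : R -> Omega -> 'I_d)
  (T : nat -> Omega -> \bar R) (S : nat -> Omega -> R).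
Hypothesis T_poisson : is_modulated_poisson la P J T.
Hypothesis S_service : is_service md mu P J T S.
Hypothesis mu_eq : forall i, mu i = m.

Variables (g : nat -> R) (n : nat).
Hypothesis g_start : g 0%N = 0.
Hypothesis g_nondecreasing : forall l, g l <= g l.+1.

Definition intensity (l : nat) (w : Omega) : R :=
  \int[lebesgue_measure]_(s in `[g l, g l.+1]) la (J s w).

Variable C : R.
Hypothesis intensity_measurable : forall l, measurable_fun [set: Omega] (intensity l).
Hypothesis intensity_itv : forall l w, 0 <= intensity l w <= C.

Variables (z : R) (x : nat -> R).
Hypothesis z_ge0 : 0 <= z.
Hypothesis m_ge0 : 0 <= m.
Hypothesis x_ge0 : forall l, 0 <= x l.

Notation arr := (arrived T).

Definition survivors (w : Omega) : nat :=
  (\sum_(0 <= l < n) \sum_(arr (g l) w <= k < arr (g l.+1) w) outlives S (x l) k w)%N.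

(** On the event where the cells have counts [a], job [k] arrives in the cell
    of this index. *)
Let job_cell (a : nat -> nat) (k : nat) : nat :=
  (\sum_(0 <= i < n) (partial_count a i.+1 <= k))%N.

Let partial_count_mono a l l' : (l <= l')%N -> (partial_count a l <= partial_count a l')%N.
Proof.
by move=> ll'; rewrite /partial_count [leqRHS](big_cat_nat _ (n := l))//= leq_addr.
Qed.

Let partial_count0 a : partial_count a 0 = 0%N.
Proof. by rewrite /partial_count big_geq. Qed.

Let job_cellE a l k : (l < n)%N ->
  (partial_count a l <= k < partial_count a l.+1)%N -> job_cell a k = l.
Proof.
move=> ln /andP[lk kl]; rewrite /job_cell (big_cat_nat _ (n := l))//=; last exact: ltnW.
rewrite big_nat (eq_bigr (fun=> 1%N)) -?big_nat; last first.
  move=> i /andP[_ il]; have -> // : (partial_count a i.+1 <= k)%N.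
  by apply: leq_trans lk; exact: partial_count_mono.
rewrite sum_nat_const_nat subn0 muln1 big_nat big1 ?addn0// => i /andP[li _].
apply/eqP; rewrite eqb0 -ltnNge; apply: (leq_trans kl).
exact: partial_count_mono.
Qed.

Let threshold (a : nat -> nat) (k : nat) : R := x (job_cell a k).

Let survival_weight (a : nat -> nat) (w : Omega) : R :=
  \prod_(0 <= k < partial_count a n) z ^+ (outlives S (threshold a k) k w).

Let survivorsE a w : cell_event T g n a w -> z ^+ survivors w = survival_weight a w.
Proof.
move=> /(cell_eventP (arrival_gt0 T_poisson) (arrival_nondecreasing T_poisson)
  (arrival_locally_finite T_poisson) n g_start g_nondecreasing) aw.
rewrite /survival_weight prodrXr; congr (_ ^+ _).
have -> : (\sum_(0 <= k < partial_count a n) outlives S (threshold a k) k w =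
  \sum_(partial_count a 0 <= k < partial_count a n) outlives S (threshold a k) k w)%N.
  by rewrite partial_count0.
rewrite sum_nat_cells; last by move=> l; exact: partial_count_mono.
rewrite /survivors !big_nat; apply: eq_bigr => l /andP[_ ln].
rewrite !aw//; last exact: ltnW.
rewrite !big_nat; apply: eq_bigr => k lk.
by rewrite /threshold (job_cellE ln lk).
Qed.

(** Generating function of the survival of a single job. *)
Let cell_gf (l : nat) : R := 1 + (z - 1) * expR (- (m * x l)).

Let cell_gf_ge0 l : 0 <= cell_gf l.
Proof.
have e1 : expR (- (m * x l)) <= 1 by rewrite -expR0 ler_expR oppr_le0 mulr_ge0.
rewrite /cell_gf (_ : _ + _ = (1 - expR (- (m * x l))) + z * expR (- (m * x l))); last by ring.
by rewrite addr_ge0 ?subr_ge0 ?mulr_ge0 ?expR_ge0.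
Qed.

Let measurable_T k (D : set (\bar R)) : measurable D -> measurable (T k @^-1` D).
Proof.
move=> mD; rewrite -[X in measurable X]setTI.
exact: (arrival_measurable T_poisson).
Qed.

Let measurable_cell_event a : measurable (cell_event T g n a).
Proof.
apply: (cell_event_sigma (arrival_gt0 T_poisson) (arrival_nondecreasing T_poisson)
  (arrival_locally_finite T_poisson)) => //.
exact: sigma_algebra_measurable.
Qed.

Let cell_event_gf a :
  (\int[P]_(w in cell_event T g n a) (survival_weight a w)%:E)%E =
  (P (cell_event T g n a) * (\prod_(0 <= l < n) cell_gf l ^+ a l)%:E)%E.
Proof.
rewrite (outlive_generating_function S_service mu_eq) //.
- congr (_ * _%:E)%E.
  have -> : \prod_(0 <= k < partial_count a n) (1 + (z - 1) * expR (- (m * threshold a k))) =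
    \prod_(partial_count a 0 <= k < partial_count a n) (1 + (z - 1) * expR (- (m * threshold a k))).
    by rewrite partial_count0.
  rewrite sum_nat_cells; last by move=> l; exact: partial_count_mono.
  rewrite !big_nat; apply: eq_bigr => l /andP[_ ln].
  transitivity (\prod_(partial_count a l <= k < partial_count a l.+1) cell_gf l).
    rewrite !big_nat; apply: eq_bigr => k lk.
    by rewrite /threshold (job_cellE ln lk).
  by rewrite prodr_const_nat /partial_count big_nat_recr//= addKn.
- apply: (cell_event_sigma (arrival_gt0 T_poisson) (arrival_nondecreasing T_poisson)
    (arrival_locally_finite T_poisson)) => //; first exact: smallest_sigma_algebra.
  by move=> k D mD; apply: sub_sigma_algebra; right; exists k, D.
- move=> w k /(cell_eventP (arrival_gt0 T_poisson) (arrival_nondecreasing T_poisson)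
    (arrival_locally_finite T_poisson) n g_start g_nondecreasing) aw.
  rewrite -(aw n (leqnn n)) -(arrivedP (arrival_gt0 T_poisson)
    (arrival_nondecreasing T_poisson) (arrival_locally_finite T_poisson)) => h.
  by apply: le_lt_trans h _; rewrite ltry.
- by move=> k; exact: x_ge0.
Qed.

Let mass (a : nat -> nat) (w : Omega) : R :=
  \prod_(l < n) poisson_mass (intensity l w) (a l).

Let poisson_mass_itv (l : nat) (k : nat) w : 0 <= poisson_mass (intensity l w) k <= 1.
Proof.
have /andP[i0 iC] := intensity_itv l w; rewrite /poisson_mass.
rewrite mulr_ge0 ?expR_ge0 ?divr_ge0 ?exprn_ge0//= expRN ler_pdivrMr ?expR_gt0// mul1r.
have := series_exp_coeff_le k.+1 i0; apply: le_trans.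
rewrite /series/= big_nat_recr//= lerDr sumr_ge0// => j _.
by rewrite exp_coeff_ge0.
Qed.

Let measurable_poisson_mass l k :
  measurable_fun [set: Omega] (fun w => poisson_mass (intensity l w) k).
Proof.
apply: measurable_funM.
  by apply: measurable_funM => //; exact: measurable_funX.
by apply: measurableT_comp => //; exact: measurableT_comp.
Qed.

Let measurable_mass a : measurable_fun [set: Omega] (mass a).
Proof.
rewrite /mass; under eq_fun do rewrite -(big_mkord xpredT (fun l =>
  poisson_mass (intensity l _) (a l))).
by apply: measurable_prod => l _; exact: measurable_poisson_mass.
Qed.

Let finP : (P [set: Omega] < +oo)%E.
Proof. by rewrite probability_setT ltry. Qed.

Let integrable_mass a : P.-integrable [set: Omega] (EFin \o mass a).
Proof.
apply: (@integrable_bounded _ _ _ P _ measurableT finP _ 1) => // w _.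
rewrite /mass -(big_mkord xpredT (fun l => poisson_mass (intensity l w) (a l))).
have /andP[q0 q1] := @prodr_itv01 R (fun l => poisson_mass (intensity l w) (a l)) 0 n
  (fun l => poisson_mass_itv l (a l) w).
by rewrite ger0_norm.
Qed.

Let cell_event_probability a : P (cell_event T g n a) = (\int[P]_w mass a w)%:E.
Proof.
have := arrival_poisson T_poisson (B := setT) n a.
have h0 : 0 <= g 0%N by rewrite g_start.
have hT : sigma_background J setT.
  have [G0 GC _] := @smallest_sigma_algebra _ [set: Omega] (background_generators J).
  by rewrite -setC0 -setTD; exact: GC.
move=> /(_ g h0 g_nondecreasing hT); rewrite setTI => ->.
rewrite /Rintegral fineK//.
exact: (integrable_fin_num measurableT (integrable_mass a)).
Qed.

Let counts (K : nat) (f : {ffun 'I_n -> 'I_K.+1}) (l : nat) : nat :=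
  oapp (fun i : 'I_n => f i : nat) 0%N (insub l).

Let countsE K (f : {ffun 'I_n -> 'I_K.+1}) (i : 'I_n) : counts f i = f i.
Proof. by rewrite /counts valK. Qed.

Let number (l : nat) (w : Omega) : nat := arrivals T (g l) (g l.+1) w.

Let sum_cell_events K w :
  \sum_(f : {ffun 'I_n -> 'I_K.+1}) (\1_(cell_event T g n (counts f)) w : R) =
  [forall i : 'I_n, (number i w <= K)%N]%:R.
Proof.
have [/forallP h|/forallPn[i ni]] := boolP [forall i : 'I_n, (number i w <= K)%N].
  pose f0 : {ffun 'I_n -> 'I_K.+1} := [ffun i : 'I_n => inord (number i w)].
  rewrite (bigD1 f0)//= big1 ?addr0.
    rewrite indicE mem_set// => l ln; have := countsE f0 (Ordinal ln).
    by rewrite /= ffunE inordK => [->//|]; rewrite ltnS; exact: (h (Ordinal ln)).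
  move=> f ff0; rewrite indicE memNset// => hf; move/eqP: ff0; apply.
  apply/ffunP => i; apply/val_inj; rewrite ffunE /= inordK ?ltnS//.
  by rewrite -countsE -hf.
rewrite big1// => f _; rewrite indicE memNset// => hf; move/negP: ni; apply.
by rewrite /number hf// countsE -ltnS.
Qed.

(** The variable [z ^+ survivors] on the event of at most [K] arrivals per
    cell, where it is a finite sum over the counts. *)
Let truncated (K : nat) (w : Omega) : \bar R :=
  (\sum_(f : {ffun 'I_n -> 'I_K.+1})
     \1_(cell_event T g n (counts f)) w * survival_weight (counts f) w)%:E.

Let truncatedE K w :
  truncated K w = ([forall i : 'I_n, (number i w <= K)%N]%:R * z ^+ survivors w)%:E.
Proof.
rewrite /truncated -sum_cell_events mulr_suml; congr EFin; apply: eq_bigr => f _.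
rewrite indicE; have [wf|] := boolP (w \in _); last by rewrite !mul0r.
by rewrite (@survivorsE (counts f))//; rewrite inE in wf.
Qed.

Let measurable_survival_weight a : measurable_fun [set: Omega] (survival_weight a).
Proof.
apply: measurable_prod => k _; set y := threshold a k.
rewrite (_ : (fun w => _) = (fun w => 1 + (z - 1) * (outlives S y k w)%:R)).
  by apply: measurable_funD => //; apply: measurable_funM => //;
    exact: (measurable_outlives S_service).
by apply/funext => w; case: outlives => /=; rewrite ?expr1 ?expr0; ring.
Qed.

Let measurable_truncated_term (a : nat -> nat) : measurable_fun [set: Omega]
  (fun w => (\1_(cell_event T g n a) w * survival_weight a w)%:E).
Proof.
by apply/measurable_EFinP; apply: measurable_funM.
Qed.

Let survival_weight_ge0 a w : 0 <= survival_weight a w.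
Proof. by apply: prodr_ge0 => k _; rewrite exprn_ge0. Qed.

Let truncated_term_ge0 (a : nat -> nat) w :
  0 <= \1_(cell_event T g n a) w * survival_weight a w.
Proof. by rewrite mulr_ge0. Qed.

Let truncated_mass (K : nat) (w : Omega) : R :=
  \prod_(l < n) \sum_(k < K.+1) cell_gf l ^+ k * poisson_mass (intensity l w) k.

Let truncated_integral K :
  (\int[P]_w truncated K w = (\int[P]_w truncated_mass K w)%:E)%E.
Proof.
have -> : (\int[P]_w truncated_mass K w) =
    \sum_(f : {ffun 'I_n -> 'I_K.+1})
      (\prod_(0 <= l < n) cell_gf l ^+ counts f l) * \int[P]_w mass (counts f) w.
  rewrite -Rintegral_lincomb//; apply: eq_Rintegral => w _.
  rewrite /truncated_mass (bigA_distr_bigA (fun (l : 'I_n) (k : 'I_K.+1) =>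
    cell_gf l ^+ k * poisson_mass (intensity l w) k)).
  apply: eq_bigr => f _; rewrite big_split/= big_mkord.
  by congr (_ * _); apply: eq_bigr => l _; rewrite countsE.
rewrite /truncated; under eq_integral do rewrite -sumEFin.
rewrite ge0_integral_sum//; last first.
  by move=> f w _; rewrite lee_fin truncated_term_ge0.
rewrite -sumEFin; apply: eq_bigr => f _.
rewrite [in RHS]EFinM -cell_event_probability [RHS]muleC -cell_event_gf.
rewrite [RHS]integral_mkcond; apply: eq_integral => w _.
rewrite patchE indicE; case: (w \in _); first by rewrite mul1r.
by rewrite mul0r.
Qed.

Let measurable_truncated K : measurable_fun [set: Omega] (truncated K).
Proof.
apply/measurable_EFinP; apply: (@measurable_sum _ _ R) => f.
exact/measurable_EFinP/measurable_truncated_term.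
Qed.

Let truncated_lim w : truncated ^~ w @ \oo --> (z ^+ survivors w)%:E.
Proof.
have : (fun=> (z ^+ survivors w)%:E) @ \oo --> (z ^+ survivors w)%:E by exact: cvg_cst.
apply: cvg_trans; apply: near_eq_cvg; near=> K; rewrite truncatedE.
suff -> : [forall i : 'I_n, (number i w <= K)%N] by rewrite mul1r.
apply/forallP => i; apply: (@leq_trans (\sum_(j < n) number j w)%N).
  by rewrite (bigD1 i)//= leq_addr.
by near: K; exact: nbhs_infty_ge.
Unshelve. all: by end_near. Qed.

Lemma survivors_measurable : measurable_fun [set: Omega] (fun w => z ^+ survivors w).
Proof.
apply/measurable_EFinP; apply: (emeasurable_fun_cvg _ _ measurable_truncated) => w _.
exact: truncated_lim.
Qed.

Let truncated_cvg : (\int[P]_w truncated K w)%E @[K --> \oo] -->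
  (\int[P]_w (z ^+ survivors w)%:E)%E.
Proof.
have trunc0 K w : [set: Omega] w -> (0 <= truncated K w)%E.
  by move=> _; rewrite truncatedE lee_fin mulr_ge0// exprn_ge0.
have nd w : [set: Omega] w -> nondecreasing_seq (truncated ^~ w).
  move=> _ K K' KK'; rewrite !truncatedE lee_fin ler_wpM2r ?exprn_ge0// ler_nat.
  case: forallP => // h; case: forallP => // h'; exfalso; apply: h' => i.
  exact: leq_trans (h i) KK'.
have := @cvg_monotone_convergence _ _ _ P _ measurableT truncated measurable_truncated trunc0 nd.
rewrite (_ : (fun w => limn (truncated ^~ w)) = (fun w => (z ^+ survivors w)%:E))//.
by apply/funext => w; apply/cvg_lim => //; exact: truncated_lim.
Qed.

Let truncated_mass_cvg w : truncated_mass ^~ w @ \oo -->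
  expR ((z - 1) * \sum_(0 <= l < n) expR (- (m * x l)) * intensity l w).
Proof.
rewrite mulr_sumr expR_sum big_mkord.
apply: cvg_big => [|l _]; first exact: mul_continuous.
have -> : (fun K => \sum_(k < K.+1) cell_gf l ^+ k * poisson_mass (intensity l w) k) =
  (fun K => series (exp_coeff (cell_gf l * intensity l w)) K.+1 * expR (- intensity l w)).
  apply/funext => K; rewrite /series/= big_mkord mulr_suml; apply: eq_bigr => k _.
  by rewrite /poisson_mass /exp_coeff/= exprMn !mulrA.
have -> : (z - 1) * (expR (- (m * x l)) * intensity l w) =
    cell_gf l * intensity l w - intensity l w by rewrite /cell_gf; ring.
rewrite expRD; apply: cvgMl.
rewrite (cvg_shiftS (series (exp_coeff (cell_gf l * intensity l w)))).
exact: is_cvg_series_exp_coeff.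
Qed.

Let truncated_mass_bound K w :
  `|truncated_mass K w| <= \prod_(l < n) expR (cell_gf l * C).
Proof.
rewrite normr_prod; apply: ler_prod => l _; rewrite normr_ge0/=.
have /andP[i0 iC] := intensity_itv l w.
rewrite ger0_norm; last first.
  apply: sumr_ge0 => k _; rewrite mulr_ge0 ?exprn_ge0//.
  by have /andP[] := poisson_mass_itv l k w.
apply: (@le_trans _ _ (series (exp_coeff (cell_gf l * intensity l w)) K.+1)).
  rewrite /series/= big_mkord; apply: ler_sum => k _.
  rewrite /poisson_mass /exp_coeff/= exprMn !mulrA ler_piMr ?divr_ge0 ?mulr_ge0 ?exprn_ge0//.
  by rewrite -expR0 ler_expR oppr_le0.
rewrite (le_trans (series_exp_coeff_le _ _)) ?mulr_ge0// ler_expR.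
by rewrite ler_wpM2l.
Qed.

(** Thinning: conditionally on the background, the survivors of the cells are
    independent Poisson variables. *)
Lemma survivors_generating_function :
  (\int[P]_w (z ^+ survivors w)%:E)%E =
  (\int[P]_w expR ((z - 1) * \sum_(0 <= l < n) expR (- (m * x l)) * intensity l w))%:E.
Proof.
have mtm K : measurable_fun [set: Omega] (truncated_mass K).
  rewrite /truncated_mass; under eq_fun do rewrite -(big_mkord xpredT (fun l =>
    \sum_(k < K.+1) cell_gf l ^+ k * poisson_mass (intensity l _) k)).
  apply: measurable_prod => l _; apply: measurable_sum => k.
  by apply: measurable_funM => //; exact: measurable_poisson_mass.
have [_ cv] := @bounded_convergence _ _ _ P _ measurableT finP truncated_mass
  (fun w => expR ((z - 1) * \sum_(0 <= l < n) expR (- (m * x l)) * intensity l w))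
  _ mtm (fun K w _ => truncated_mass_bound K w) (fun w _ => @truncated_mass_cvg w).
have cv' : (\int[P]_w truncated K w)%E @[K --> \oo] -->
  (\int[P]_w expR ((z - 1) * \sum_(0 <= l < n) expR (- (m * x l)) * intensity l w))%:E.
  rewrite (_ : (fun K => _) = fun K => (\int[P]_w truncated_mass K w)%:E).
    by apply: cvg_EFin => //; near=> K.
  by apply/funext => K; exact: truncated_integral.
exact: cvg_unique _ truncated_cvg cv'.
Unshelve. all: by end_near. Qed.

End thinning.

(** * Generating function of the number of jobs *)

Section path_integrals.
Variables (R : realType) (d : nat) (A : 'M[R]_d) (disp : measure_display)
  (Omega : measurableType disp) (P : probability Omega R)
  (J : R -> Omega -> 'I_d).
Hypothesis J_markov : is_markov_process A P J.
Variables (la : 'I_d -> R) (W : R -> R) (a b : R).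
Hypothesis a_ge0 : 0 <= a.
Hypothesis ab : a <= b.
Hypothesis la_ge0 : forall i, 0 <= la i.
Hypothesis W_continuous : continuous W.
Hypothesis W_itv : forall s, a <= s <= b -> 0 <= W s <= 1.
Notation leb := (@lebesgue_measure R).

Definition total_rate : R := \sum_i la i.

Lemma rate_le_total i : la i <= total_rate.
Proof. by rewrite /total_rate (bigD1 i)//= lerDl sumr_ge0. Qed.

Lemma total_rate_ge0 : 0 <= total_rate.
Proof. exact: sumr_ge0. Qed.

Let f (w : Omega) (s : R) : R := W s * la (J s w).

Let f_right w s : a <= s < b -> f w u @[u --> s^'+] --> f w s.
Proof.
move=> /andP[as_ _]; apply: cvgM.
  by apply: cvg_at_right_filter; exact: W_continuous.
have : (fun=> la (J s w)) u @[u --> s^'+] --> la (J s w) by exact: cvg_cst.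
apply: cvg_trans; apply: near_eq_cvg.
have := markov_right_continuous J_markov w (le_trans a_ge0 as_).
by apply: filterS => u ->.
Qed.

Let f_itv w s : a <= s <= b -> 0 <= f w s <= total_rate.
Proof.
move=> /W_itv /andP[W0 W1]; rewrite /f mulr_ge0//=.
apply: le_trans (rate_le_total (J s w)); exact: ler_piMl.
Qed.

Let f_bounded w s : a <= s <= b -> `|f w s| <= total_rate.
Proof. by move=> /(f_itv w) /andP[f0 fL]; rewrite ger0_norm. Qed.

Lemma path_riemann_sum w :
  (fun r => \sum_(0 <= l < r) (b - a) / r%:R *
     (W (subdivision a b r l.+1) * la (J (subdivision a b r l.+1) w))) @ \oo
    --> \int[leb]_(s in `[a, b]) (W s * la (J s w)).
Proof. exact: (right_riemann_sum ab (@f_right w) (@f_bounded w)). Qed.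

Lemma path_integrable w :
  leb.-integrable `[a, b] (EFin \o (fun s => W s * la (J s w))).
Proof. exact: (right_continuous_integrable ab (@f_right w) (@f_bounded w)). Qed.

Lemma path_integral_measurable :
  measurable_fun [set: Omega] (fun w => \int[leb]_(s in `[a, b]) (W s * la (J s w))).
Proof.
apply: (@measurable_fun_cvg _ _ _ _ (fun r w => \sum_(0 <= l < r) (b - a) / r%:R *
     (W (subdivision a b r l.+1) * la (J (subdivision a b r l.+1) w)))); last first.
  by move=> w _; exact: path_riemann_sum.
move=> r; case: r => [|r].
  by under eq_fun do rewrite big_geq//; exact: measurable_cst.
under eq_fun do rewrite big_mkord.
apply: measurable_sum => l; apply: measurable_funM => //; apply: measurable_funM => //.
apply: (measurable_state_function J_markov).
have /andP[+ _] := @subdivision_itv _ a b ab r.+1 l.+1 (ltn_ord l).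
exact: le_trans.
Qed.

Lemma path_integral_itv w :
  0 <= \int[leb]_(s in `[a, b]) (W s * la (J s w)) <= total_rate * (b - a).
Proof.
apply/andP; split.
  by apply: Rintegral_ge0 => s /=; rewrite in_itv/= => /(f_itv w) /andP[].
rewrite -Rintegral_itv_cst//; apply: le_Rintegral => //.
- exact: path_integrable.
- apply: (@integrable_bounded _ _ _ leb _ _ _ _ total_rate) => //.
    exact: (lebesgue_itv_lty true false).
  by move=> s _; rewrite ger0_norm// total_rate_ge0.
- by move=> s /=; rewrite in_itv/= => /(f_itv w) /andP[].
Qed.

End path_integrals.

Section jobs_generating_function.
Variables (R : realType) (d : nat) (A : 'M[R]_d) (md : model)
  (la mu : 'I_d -> R) (m : R)
  (disp : measure_display) (Omega : measurableType disp)
  (P : probability Omega R) (J : R -> Omega -> 'I_d)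
  (T : nat -> Omega -> \bar R) (S : nat -> Omega -> R).
Hypothesis queue : is_modulated_queue md A la mu P J T S.
Hypothesis mu_eq : forall i, mu i = m.
Hypothesis m_gt0 : 0 < m.
Hypothesis la_ge0 : forall i, 0 <= la i.
Variable t : R.
Hypothesis t_ge0 : 0 <= t.
Notation leb := (@lebesgue_measure R).

Let J_markov := queue_background queue.
Let T_poisson := queue_arrivals queue.
Let S_service := queue_services queue.
Let T_gt0 := arrival_gt0 T_poisson.
Let T_nd := arrival_nondecreasing T_poisson.
Let T_fin := arrival_locally_finite T_poisson.

(** The conditional mean of the number of jobs given the background. *)
Definition load (w : Omega) : R :=
  \int[leb]_(s in `[0, t]) (weight m t s * la (J s w)).

Lemma continuous_weight : continuous (weight m t).
Proof.
move=> s; rewrite /weight; apply: (continuous_cvg _ (@continuous_expR R _)).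
apply: cvgN; apply: cvgMr; apply: cvgB; [exact: cvg_cst|exact: cvg_id].
Qed.

Let weight_itv0 s : 0 <= s <= t -> 0 <= weight m t s <= 1.
Proof. by move=> /andP[_ st]; exact: weight_itv. Qed.

Lemma load_itv w : 0 <= load w <= total_rate la * t.
Proof.
have := path_integral_itv J_markov (lexx 0) t_ge0 la_ge0 continuous_weight weight_itv0 w.
by rewrite subr0.
Qed.

Lemma jobs_measurable : measurable_fun [set: Omega] (fun w => (jobs T S t w)%:R : R).
Proof.
pose E k : set Omega := [set w | (T k w <= t%:E)%E] `&` [set w | (t%:E < T k w + (S k w)%:E)%E].
have mT k : measurable_fun [set: Omega] (T k) by exact: (arrival_measurable T_poisson).
have mE k : measurable (E k).
  apply: measurableI.
    by rewrite -[X in measurable X]setTI; exact: emeasurable_fun_infty_c.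
  rewrite -[X in measurable X]setTI; apply: emeasurable_fun_o_infty => //.
  apply: emeasurable_funD => //; apply/measurable_EFinP.
  exact: (service_measurable S_service).
apply: (@measurable_fun_cvg _ _ _ _ (fun K w => \sum_(0 <= k < K) (\1_(E k) w : R))).
  by move=> K; apply: measurable_sum => k; exact: measurable_indic.
move=> w _.
have : (fun=> (jobs T S t w)%:R : R) @ \oo --> ((jobs T S t w)%:R : R) by exact: cvg_cst.
apply: cvg_trans; apply: near_eq_cvg; near=> K.
rewrite (jobsE T_gt0 T_nd T_fin) natr_sum.
have aK : (arrived T t w <= K)%N by near: K; exact: nbhs_infty_ge.
rewrite [RHS](big_cat_nat _ (n := arrived T t w))//= [X in _ = _ + X]big_nat [X in _ = _ + X]big1 ?addr0.
  rewrite !big_nat; apply: eq_bigr => k /andP[_ kt]; rewrite indicE /E.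
  have [h|h] := boolP (t%:E < T k w + (S k w)%:E)%E.
    by rewrite mem_set//=; split => //; rewrite (arrivedP T_gt0 T_nd T_fin).
  by rewrite memNset// => -[_]; exact/negP.
move=> k /andP[tk _]; rewrite indicE memNset// => -[+ _].
by rewrite /= (arrivedP T_gt0 T_nd T_fin) ltnNge tk.
Unshelve. all: by end_near. Qed.

Section cells.
Variable n : nat.
Hypothesis n_gt0 : (0 < n)%N.
Let g := grid t n.

Let g_start : g 0%N = 0.
Proof. by rewrite /g /grid mulr0 mul0r. Qed.

Let g_step l : g l.+1 = g l + t / n%:R.
Proof. by rewrite /g /grid -natr1; ring. Qed.

Let g_nd l : g l <= g l.+1.
Proof. by rewrite g_step lerDl divr_ge0. Qed.

Let g_ge0 l : 0 <= g l.
Proof. by rewrite /g /grid divr_ge0 ?mulr_ge0. Qed.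

(** A job that arrives in the [l]-th cell and outlives [early l] is present at
    time [t], and one that is present at time [t] has outlived [late l]. *)
Let early (l : nat) : R := t - g (minn l n).
Let late (l : nat) : R := t - g (minn l.+1 n).

Let early_ge0 l : 0 <= early l.
Proof. by rewrite subr_ge0; apply: grid_le => //; exact: geq_minr. Qed.

Let late_ge0 l : 0 <= late l.
Proof. by rewrite subr_ge0; apply: grid_le => //; exact: geq_minr. Qed.

Let earlyE l : (l < n)%N -> expR (- (m * early l)) = weight m t (g l).
Proof. by move=> ln; rewrite /early (minn_idPl (ltnW ln)). Qed.

Let lateE l : (l < n)%N ->
  expR (- (m * late l)) = expR (m * (t / n%:R)) * weight m t (g l).
Proof.
move=> ln; rewrite /late (minn_idPl ln) g_step /weight -expRD; congr expR.
ring.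
Qed.

Let jobs_cells w : jobs T S t w =
  (\sum_(0 <= l < n) \sum_(arrived T (g l) w <= k < arrived T (g l.+1) w)
     (t%:E < T k w + (S k w)%:E)%E)%N.
Proof.
rewrite (jobsE T_gt0 T_nd T_fin) -(@sum_nat_cells _ _ addn (fun l => arrived T (g l) w)); last first.
  by move=> l; apply: arrived_le => //.
by rewrite g_start arrived0// /g grid_end.
Qed.

Let early_le_jobs w : (survivors T S g n early w <= jobs T S t w)%N.
Proof.
rewrite jobs_cells /survivors; rewrite !big_nat; apply: leq_sum => l /andP[_ ln].
rewrite !big_nat; apply: leq_sum => k /andP[kl _].
rewrite /outlives /early (minn_idPl (ltnW ln)).
have gT : ((g l)%:E < T k w)%E by rewrite ltNge (arrivedP T_gt0 T_nd T_fin) -leqNgt.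
case: ltP => // lS; rewrite (_ : (t%:E < _)%E)//.
have : (t%:E <= (g l)%:E + (S k w)%:E)%E by rewrite -EFinD lee_fin; lra.
by move=> /le_lt_trans; apply; rewrite lteD2rE.
Qed.

Let jobs_le_late w : (jobs T S t w <= survivors T S g n late w)%N.
Proof.
rewrite jobs_cells /survivors; rewrite !big_nat; apply: leq_sum => l /andP[_ ln].
rewrite !big_nat; apply: leq_sum => k /andP[_ kl].
rewrite /outlives /late (minn_idPl ln).
have Tg : (T k w <= (g l.+1)%:E)%E by rewrite (arrivedP T_gt0 T_nd T_fin).
case: (boolP (t%:E < _)%E) => // h; rewrite (_ : _ < _)//.
have : (t%:E < (g l.+1)%:E + (S k w)%:E)%E by apply: lt_le_trans h _; rewrite leeD2rE.
by rewrite -EFinD lte_fin; lra.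
Qed.

Let Lambda := intensity la J g.

Let Lambda_weight l : Lambda l = (fun w => \int[leb]_(s in `[g l, g l.+1]) (1 * la (J s w))).
Proof. by apply/funext => w; apply: eq_Rintegral => s _; rewrite mul1r. Qed.

Let cst_itv (a b s : R) : a <= s <= b -> 0 <= (1 : R) <= 1.
Proof. by rewrite ler01 lexx. Qed.

Let cst_continuous : continuous (fun _ : R => 1 : R).
Proof. by move=> s; exact: cvg_cst. Qed.

Let Lambda_measurable l : measurable_fun [set: Omega] (Lambda l).
Proof.
rewrite Lambda_weight; apply: (path_integral_measurable J_markov (g_ge0 l) (g_nd l) la_ge0
  cst_continuous).
exact: cst_itv.
Qed.

Let Lambda_itv l w : 0 <= Lambda l w <= total_rate la * (t / n%:R).
Proof.
have := path_integral_itv J_markov (g_ge0 l) (g_nd l) la_ge0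
  cst_continuous (@cst_itv (g l) (g l.+1)) w.
have -> : t / n%:R = g l.+1 - g l by rewrite g_step addrAC subrr add0r.
by rewrite Lambda_weight.
Qed.

Definition cell_load (w : Omega) : R := \sum_(0 <= l < n) weight m t (g l) * Lambda l w.

Let load_cells w : load w =
  \sum_(0 <= l < n) \int[leb]_(s in `[g l, g l.+1]) (weight m t s * la (J s w)).
Proof.
pose F s := weight m t s * la (J s w).
have H k : (k <= n)%N -> \int[leb]_(s in `[0, g k]) F s =
    \sum_(0 <= l < k) \int[leb]_(s in `[g l, g l.+1]) F s.
  elim: k => [|k IH] kn.
    by rewrite g_start big_geq// set_itv1 Rintegral_set1.
  rewrite big_nat_recr//= -IH; last exact: ltnW.
  have gkt : g k.+1 <= t by exact: grid_le.
  have iF : leb.-integrable `[0, g k.+1] (EFin \o F).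
    apply: (path_integrable J_markov (lexx 0) (g_ge0 _) la_ge0 continuous_weight) => s.
    by move=> /andP[s0 sg]; apply: weight_itv0; rewrite s0 (le_trans sg).
  rewrite -[X in _ + X]Rintegral_itv_obnd_cbnd; last first.
    apply: integrableS iF => // s /=; rewrite !in_itv/= => /andP[h1 ->].
    by rewrite andbT (le_trans (g_ge0 k))// ltW.
  rewrite -(@Rintegral_itvB _ F (BLeft 0) (BRight (g k.+1)) (g k))// ?bnd_simp//.
  by rewrite addrC subrK.
by rewrite /load -H// /g grid_end.
Qed.

Let cell_integral l w : (l < n)%N ->
  weight m t (g l) * Lambda l w <=
  \int[leb]_(s in `[g l, g l.+1]) (weight m t s * la (J s w)) <=
  expR (m * (t / n%:R)) * weight m t (g l) * Lambda l w.
Proof.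
move=> ln.
have gt : g l.+1 <= t by exact: grid_le.
have iF : leb.-integrable `[g l, g l.+1] (EFin \o (fun s => weight m t s * la (J s w))).
  apply: (path_integrable J_markov (g_ge0 l) (g_nd l) la_ge0 continuous_weight) => s.
  by move=> /andP[s0 sg]; apply: weight_itv0; rewrite (le_trans (g_ge0 l))//= (le_trans sg).
have iL : leb.-integrable `[g l, g l.+1] (EFin \o (fun s => 1 * la (J s w))).
  apply: (path_integrable J_markov (g_ge0 l) (g_nd l) la_ge0
    cst_continuous).
  exact: cst_itv.
rewrite Lambda_weight -!RintegralZl//.
apply/andP; split; apply: le_Rintegral => //; try exact: (integrableZl _ _ iL).
  move=> s /=; rewrite in_itv/= => /andP[gs sg]; rewrite mul1r ler_wpM2r//.
  by rewrite ler_expR lerN2 ler_wpM2l ?(ltW m_gt0)// lerD2l lerN2.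
move=> s /=; rewrite in_itv/= => /andP[gs sg]; rewrite mul1r ler_wpM2r//.
rewrite -expRD ler_expR.
have : m * (t - g l.+1) <= m * (t - s) by rewrite ler_wpM2l ?(ltW m_gt0)// lerD2l lerN2.
by rewrite g_step; lra.
Qed.

Lemma cell_load_le w : cell_load w <= load w <= expR (m * (t / n%:R)) * cell_load w.
Proof.
rewrite load_cells /cell_load; apply/andP; split.
  rewrite !big_nat; apply: ler_sum => l /andP[_ ln].
  by have /andP[] := cell_integral w ln.
rewrite mulr_sumr !big_nat; apply: ler_sum => l /andP[_ ln].
by rewrite mulrA; have /andP[] := cell_integral w ln.
Qed.

Lemma cell_load_measurable : measurable_fun [set: Omega] cell_load.
Proof. by apply: measurable_sum => l; apply: measurable_funM. Qed.

Variable z : R.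
Hypothesis z_gt0 : 0 < z.

Let early_gf : (\int[P]_w (z ^+ survivors T S g n early w)%:E)%E =
  (\int[P]_w expR ((z - 1) * cell_load w))%:E.
Proof.
have -> : cell_load = (fun w => \sum_(0 <= l < n) expR (- (m * early l)) * Lambda l w).
  apply/funext => w; rewrite /cell_load !big_nat; apply: eq_bigr => l /andP[_ ln].
  by rewrite earlyE.
exact: (survivors_generating_function T_poisson S_service mu_eq n g_start g_nd
  Lambda_measurable Lambda_itv (ltW z_gt0) (ltW m_gt0) early_ge0).
Qed.

Let late_gf : (\int[P]_w (z ^+ survivors T S g n late w)%:E)%E =
  (\int[P]_w expR ((z - 1) * (expR (m * (t / n%:R)) * cell_load w)))%:E.
Proof.
have -> : (fun w => expR ((z - 1) * (expR (m * (t / n%:R)) * cell_load w))) =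
    (fun w => expR ((z - 1) * \sum_(0 <= l < n) expR (- (m * late l)) * Lambda l w)).
  apply/funext => w; congr (expR (_ * _)).
  rewrite /cell_load mulr_sumr !big_nat; apply: eq_bigr => l /andP[_ ln].
  by rewrite lateE// mulrA.
exact: (survivors_generating_function T_poisson S_service mu_eq n g_start g_nd
  Lambda_measurable Lambda_itv (ltW z_gt0) (ltW m_gt0) late_ge0).
Qed.

Lemma power_jobs_measurable : measurable_fun [set: Omega] (fun w => z ^+ jobs T S t w).
Proof.
have -> : (fun w => z ^+ jobs T S t w) = (fun w => expR ((jobs T S t w)%:R * ln z)).
  by apply/funext => w; rewrite expRM_natl lnK// posrE.
apply: measurableT_comp => //; apply: measurable_funM => //.
exact: jobs_measurable.
Qed.

Let le_gf (f1 f2 : Omega -> nat) : measurable_fun [set: Omega] (fun w => z ^+ f1 w) ->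
  measurable_fun [set: Omega] (fun w => z ^+ f2 w) ->
  (forall w, z ^+ f1 w <= z ^+ f2 w) ->
  (\int[P]_w (z ^+ f1 w)%:E <= \int[P]_w (z ^+ f2 w)%:E)%E.
Proof.
move=> m1 m2 h; apply: ge0_le_integral => //.
- by move=> w _; rewrite lee_fin exprn_ge0// ltW.
- exact/measurable_EFinP.
- exact/measurable_EFinP.
- by move=> w _; rewrite lee_fin.
Qed.

Let early_measurable : measurable_fun [set: Omega] (fun w => z ^+ survivors T S g n early w).
Proof.
exact: (survivors_measurable T_poisson S_service n g_start g_nd z).
Qed.

Let late_measurable : measurable_fun [set: Omega] (fun w => z ^+ survivors T S g n late w).
Proof.
exact: (survivors_measurable T_poisson S_service n g_start g_nd z).
Qed.

Lemma jobs_gf_sandwich :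
  let lo := (\int[P]_w expR ((z - 1) * cell_load w))%:E in
  let up := (\int[P]_w expR ((z - 1) * (expR (m * (t / n%:R)) * cell_load w)))%:E in
  let gf := (\int[P]_w (z ^+ jobs T S t w)%:E)%E in
  if 1 <= z then (lo <= gf <= up)%E else (up <= gf <= lo)%E.
Proof.
cbv zeta; rewrite -early_gf -late_gf.
have [z1|z1] := leP 1 z.
  apply/andP; split; apply: le_gf => //; try exact: power_jobs_measurable; move=> w.
    by rewrite ler_weXn2l.
  by rewrite ler_weXn2l.
have mono i j : (i <= j)%N -> z ^+ j <= z ^+ i.
  by move=> ij; rewrite ler_wiXn2l// ltW.
by apply/andP; split; apply: le_gf => //; try exact: power_jobs_measurable; move=> w; apply: mono.
Qed.

End cells.

(** Given the background, the number of jobs is Poisson with mean [load]: on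
    every grid it lies between two thinned counts, whose conditional means
    merge as the grid is refined. *)
Theorem jobs_generating_function z : 0 < z ->
  (\int[P]_w (z ^+ jobs T S t w)%:E)%E = (\int[P]_w expR ((z - 1) * load w))%:E.
Proof.
move=> z0.
have invn : (t / n%:R : R) @[n --> \oo] --> 0.
  by rewrite -(mulr0 t); apply: cvgMr; exact: cvg_natr_inv.
have en : expR (m * (t / n%:R)) @[n --> \oo] --> (1 : R).
  rewrite [X in _ --> X](_ : 1 = expR (m * 0)); last by rewrite mulr0 expR0.
  apply: (continuous_cvg _ (@continuous_expR R _)).
  exact: cvgMr.
set C := total_rate la * t.
have cell_le n w : (0 < n)%N -> cell_load n w <= load w.
  by move=> n0; have /andP[] := cell_load_le n0 w.
have le_cell n w : (0 < n)%N -> load w <= expR (m * (t / n%:R)) * cell_load n w.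
  by move=> n0; have /andP[] := cell_load_le n0 w.
have cl w : cell_load n w @[n --> \oo] --> load w.
  have lowcvg : expR (- (m * (t / n%:R))) * load w @[n --> \oo] --> load w.
    rewrite -[X in _ --> X]mul1r; apply: cvgMl.
    rewrite [X in _ --> X](_ : 1 = expR (- (m * 0))); last by rewrite mulr0 oppr0 expR0.
    apply: (continuous_cvg _ (@continuous_expR R _)).
    by apply: cvgN; exact: cvgMr.
  apply: (squeeze_cvgr _ lowcvg (cvg_cst (load w))).
  near=> n; have n0 : (0 < n)%N by near: n; exact: nbhs_infty_gt.
  rewrite cell_le// andbT expRN ler_pdivrMl ?expR_gt0//; exact: le_cell.
have cell_ge0 n w : (0 < n)%N -> 0 <= cell_load n w.
  move=> n0; rewrite -(pmulr_rge0 _ (expR_gt0 (m * (t / n%:R)))).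
  apply: le_trans (le_cell n w n0); by have /andP[] := load_itv w.
have limit (c : nat -> R) : c @ \oo --> (1 : R) -> (forall n, 0 <= c n <= expR (m * t)) ->
    (\int[P]_w expR ((z - 1) * (c n.+1 * cell_load n.+1 w)))%:E @[n --> \oo] -->
    (\int[P]_w expR ((z - 1) * load w))%:E.
  move=> c1 c_itv; apply: cvg_EFin; first by near=> n.
  have finP : (P [set: Omega] < +oo)%E by rewrite probability_setT ltry.
  apply: (proj2 (@bounded_convergence _ _ _ P _ measurableT finP
    (fun n w => expR ((z - 1) * (c n.+1 * cell_load n.+1 w))) _
    (expR (`|z - 1| * (expR (m * t) * C))) _ _ _)).
  - move=> n; apply: measurableT_comp => //; do 2 apply: measurable_funM => //.
    exact: cell_load_measurable.
  - move=> n w _; rewrite ger0_norm ?expR_ge0// ler_expR.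
    apply: le_trans (ler_norm _) _; rewrite normrM ler_wpM2l//.
    have /andP[c0 cle] := c_itv n.+1.
    rewrite ger0_norm ?mulr_ge0 ?cell_ge0// ler_pM ?cell_ge0//.
    by apply: le_trans (cell_le n.+1 w isT) _; have /andP[] := load_itv w.
  - move=> w _; apply: (continuous_cvg _ (@continuous_expR R _)); apply: cvgMr.
    rewrite -[X in _ --> X]mul1r; apply: cvgM.
      by rewrite (cvg_shiftS c).
    by rewrite (cvg_shiftS (cell_load ^~ w)).
have mt0 : 0 <= m * t by rewrite mulr_ge0// ltW.
have lo : (\int[P]_w expR ((z - 1) * cell_load n.+1 w))%:E @[n --> \oo] -->
    (\int[P]_w expR ((z - 1) * load w))%:E.
  have c_itv (n : nat) : 0 <= (1 : R) <= expR (m * t) by rewrite ler01 -expR0 ler_expR.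
  have : (fun=> 1 : R) @ \oo --> (1 : R) by exact: cvg_cst.
  move=> /limit /(_ c_itv).
  by under eq_fun do under eq_Rintegral do rewrite mul1r.
have en_itv n : 0 <= expR (m * (t / n%:R)) <= expR (m * t).
  rewrite expR_ge0/= ler_expR ler_wpM2l ?(ltW m_gt0)//.
  case: n => [|n]; first by rewrite invr0 mulr0.
  by rewrite ler_piMr// invf_le1// ler1n.
have up := limit _ en en_itv.
have squeeze (u v : nat -> \bar R) (x L : \bar R) : u @ \oo --> L -> v @ \oo --> L ->
    (forall n, (u n <= x <= v n)%E) -> x = L.
  move=> uL vL h; apply/eqP; rewrite eq_le; apply/andP; split.
    by apply: (cvge_to_ge vL); near=> n; have /andP[] := h n.
  by apply: (cvge_to_le uL); near=> n; have /andP[] := h n.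
have sandwich n := @jobs_gf_sandwich n.+1 isT z z0.
have [z1|z1] := leP 1 z.
  by apply: (squeeze _ _ _ _ lo up) => n; have := sandwich n; rewrite z1.
by apply: (squeeze _ _ _ _ up lo) => n; have := sandwich n; rewrite leNgt z1.
Unshelve. all: by end_near. Qed.

End jobs_generating_function.

(** * Tilting by the load of the queue *)

Section load_tilting.
Variables (R : realType) (d : nat) (Q : 'M[R]_d) (nu : R)
  (disp : measure_display) (Omega : measurableType disp)
  (P : probability Omega R) (J : R -> Omega -> 'I_d).
Hypothesis J_markov : is_markov_process (nu *: Q) P J.
Variables (lambda : 'I_d -> R) (m t : R).
Hypothesis lambda_ge0 : forall i, 0 <= lambda i.
Hypothesis m_gt0 : 0 < m.
Hypothesis t_ge0 : 0 <= t.
Variable a : R.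

Let weight01 s : 0 <= s <= t -> 0 <= weight m t s <= 1.
Proof. by move=> /andP[_ st]; exact: weight_itv. Qed.

Let term (r l : nat) (w : Omega) : R :=
  t / r%:R * (weight m t (grid t r l) * lambda (J (grid t r l) w)).

Let riemann_sum (r : nat) (w : Omega) : R := \sum_(0 <= l < r) term r l.+1 w.

Let gridE r l : subdivision 0 t r l = grid t r l.
Proof. by rewrite /subdivision /grid add0r subr0. Qed.

Let riemann_sum_cvg w : riemann_sum r w @[r --> \oo] --> load lambda m J t w.
Proof.
have := path_riemann_sum J_markov (lexx 0) t_ge0 lambda_ge0 (@continuous_weight R m t) weight01.
move=> /(_ w).
by under eq_fun do under eq_bigr do rewrite subr0 gridE.
Qed.

Let grid_ge0 r l : 0 <= grid t r l.
Proof. by rewrite /grid divr_ge0 ?mulr_ge0. Qed.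

Let grid_nd r l : grid t r l <= grid t r l.+1.
Proof. by rewrite /grid ler_wpM2r ?invr_ge0// ler_wpM2l// ler_nat. Qed.

Let grid_start r : grid t r 0%N = 0.
Proof. by rewrite /grid mulr0 mul0r. Qed.

Let riemann_sum_le r w : `|riemann_sum r w| <= t * total_rate lambda.
Proof.
have L0 := total_rate_ge0 lambda_ge0.
apply: (@le_trans _ _ (\sum_(0 <= l < r) t / r%:R * total_rate lambda)).
  rewrite /riemann_sum !big_nat; apply: (le_trans (ler_norm_sum _ _ _)).
  apply: ler_sum => l /andP[_ lr].
  have /andP[w0 w1] : 0 <= weight m t (grid t r l.+1) <= 1.
    by apply: weight_itv => //; exact: grid_le.
  have tr : 0 <= t / r%:R by rewrite divr_ge0.
  rewrite /term ger0_norm ?mulr_ge0// ler_wpM2l//.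
  apply: le_trans (rate_le_total lambda_ge0 (J (grid t r l.+1) w)); exact: ler_piMl.
rewrite sumr_const_nat subn0; case: r => [|r].
  by rewrite mulr0n mulr_ge0.
by rewrite -[leLHS]mulr_natl mulrA mulrCA divff ?pnatr_eq0// mulr1.
Qed.

(** Riemann sums at right endpoints put no weight on time 0. *)
Let tilt (r l : nat) (i : 'I_d) : R :=
  if l is _.+1 then expR (a * weight m t (grid t r l) * lambda i * (t / r%:R)) else 1.

Let tilt_prod r w :
  \prod_(0 <= l < r.+1) tilt r l (J (grid t r l) w) = expR (a * riemann_sum r w).
Proof.
rewrite big_nat_recl//= mul1r /riemann_sum mulr_sumr expR_sum.
by apply: eq_bigr => l _; congr expR; rewrite /term; ring.
Qed.

Definition initial_law (i : 'I_d) : R := fine (P (J 0 @^-1` [set i])).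

Lemma initial_law_ge0 i : 0 <= initial_law i.
Proof. by rewrite fine_ge0. Qed.

Lemma initial_law_sum : \sum_i initial_law i = 1.
Proof.
have := @forward_sum _ _ _ _ _ _ _ J_markov (fun=> 0) erefl (fun=> lexx 0) (fun _ _ => 1) 0.
under eq_Rintegral do rewrite big_nat1.
rewrite Rintegral_cst// (_ : fine _ = 1) ?mul1r; last first.
  exact: (congr1 (@fine R) (probability_setT P)).
move=> ->.
by apply: eq_bigr => i _; rewrite mul1r.
Qed.

(** The law of the background on the grid, tilted by the Riemann sum of the
    load up to the current time. *)
Definition tilted_law (r l : nat) (i : 'I_d) : R :=
  tilt r l i * forward (nu *: Q) P J (grid t r) (tilt r) l i.

Lemma tilted_law_recursion : tilted_recursion Q lambda m nu a t initial_law tilted_law.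
Proof.
have tilt_ge0 r l i : 0 <= tilt r l i by case: l => [|l]; rewrite //= expR_ge0.
move=> r r0; split.
- by apply/funext => i; rewrite /tilted_law/= mul1r.
- move=> l i; rewrite mulr_ge0//; apply: forward_ge0 => //; exact: tilt_ge0.
- move=> l j lr; rewrite /tilted_law /= mulr_sumr; apply: eq_bigr => i _.
  have -> : grid t r l.+1 - grid t r l = t / r%:R.
    by rewrite /grid -mulrBl -mulrBr -natr1 addrAC subrr add0r mulr1.
  by ring.
Qed.

Lemma tilted_law_limit :
  \sum_i tilted_law r r i @[r --> \oo] --> \int[P]_w expR (a * load lambda m J t w).
Proof.
have finP : (P [set: Omega] < +oo)%E by rewrite probability_setT ltry.
have E r : \sum_i tilted_law r r i = \int[P]_w expR (a * riemann_sum r w).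
  rewrite -(forward_sum J_markov (grid_start r) (@grid_nd r) (tilt r) r).
  by apply: eq_Rintegral => w _; exact: tilt_prod.
under eq_fun do rewrite E.
apply: (proj2 (@bounded_convergence _ _ _ P _ measurableT finP
  (fun r w => expR (a * riemann_sum r w)) _
  (expR (`|a| * (t * total_rate lambda))) _ _ _)).
- move=> r; apply: measurableT_comp => //; apply: measurable_funM => //.
  apply: measurable_sum => l; do 2 apply: measurable_funM => //.
  exact: (measurable_state_function J_markov).
- move=> r w _; rewrite ger0_norm ?expR_ge0// ler_expR.
  by apply: le_trans (ler_norm _) _; rewrite normrM ler_wpM2l.
- move=> w _; apply: (continuous_cvg _ (@continuous_expR R _)); apply: cvgMr.
  exact: riemann_sum_cvg.
Qed.

End load_tilting.

(** * Asymptotics of the tilt *)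

Section natural_powers.
Variable R : realType.

Lemma cvg_dominated (f g e : nat -> R) (l : R) : g @ \oo --> l -> e @ \oo --> (0 : R) ->
  (forall n, (0 < n)%N -> `|f n - g n| <= e n) -> f @ \oo --> l.
Proof.
move=> gl e0 fg.
have lo : (fun n => g n - e n) @ \oo --> l by rewrite -[l]subr0; exact: cvgB.
have up : (fun n => g n + e n) @ \oo --> l by rewrite -[l]addr0; exact: cvgD.
apply: (squeeze_cvgr _ lo up); near=> n.
rewrite -ler_distl; apply: fg; near: n; exact: nbhs_infty_gt.
Unshelve. all: by end_near. Qed.

Lemma natr_powR_limit (c : R) : c <= 0 ->
  (N%:R : R) `^ c @[N --> \oo] --> ((c == 0)%:R : R).
Proof.
rewrite le_eqVlt => /predU1P[->|c0].
  by under eq_fun do rewrite powRr0; rewrite eqxx; exact: cvg_cst.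
rewrite lt_eqF// -(cvg_shiftS (fun N : nat => (N%:R : R) `^ c)).
have /cvg_at_rightP h : (b `^ (- c)) @[b --> (0 : R)^'+] --> (0 : R).
  by apply: powR_cvg0; rewrite oppr_gt0.
have /h : (forall n : nat, 0 < (n.+1%:R : R)^-1) /\
    (n.+1%:R : R)^-1 @[n --> \oo] --> (0 : R).
  by split => [n|]; [rewrite invr_gt0|exact: cvg_harmonic].
under eq_fun => n do rewrite -powR_inv1// -powRrM mulN1r opprK.
exact.
Qed.

End natural_powers.

Section tilt_asymptotics.
Variables (R : realType) (alpha theta : R).

Let gamma : R := Num.max (1 - alpha / 2) (1 / 2).
Let p (N : nat) (c : R) : R := N%:R `^ c.

Let pD N c e : (0 < N)%N -> p N (c + e) = p N c * p N e.
Proof. by move=> N0; rewrite /p powRD// pnatr_eq0 -lt0n N0 implybT. Qed.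

Let p_ge0 N c : 0 <= p N c. Proof. exact: powR_ge0. Qed.

Let gamma_gt0 : 0 < gamma.
Proof. by rewrite /gamma lt_max; apply/orP; right. Qed.

(** Tilting the number of jobs by this exponent tilts the variable normalised
    by [N ^ gamma] by [theta]. *)
Definition count_tilt (N : nat) : R := theta / N%:R `^ Num.max (1 - alpha / 2) (1 / 2).
Let x := count_tilt.

Let xE N : x N = theta * p N (- gamma).
Proof. by rewrite /x /count_tilt /p powRN. Qed.

Let x_cvg : x N @[N --> \oo] --> 0.
Proof.
under eq_fun do rewrite xE.
rewrite -(mulr0 theta); apply: cvgMr.
have := @natr_powR_limit R (- gamma) _.
by rewrite oppr_le0 oppr_eq0 gt_eqF// => /(_ (ltW gamma_gt0)).
Qed.

Let error_cvg : `|x N| * expR `|x N| @[N --> \oo] --> 0.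
Proof.
have nx : `|x N| @[N --> \oo] --> (0 : R) by rewrite -(@normr0 _ R); exact: cvg_norm.
rewrite -(mul0r (expR 0)); apply: cvgM => //.
exact: (continuous_cvg _ (@continuous_expR R _)).
Qed.

Let p1 N : p N 1 = N%:R.
Proof. by rewrite /p powRr1. Qed.

(** The exponent of [N] in the leading term is [2 * (1 - gamma) - alpha]; it
    is zero when [alpha <= 1] and negative otherwise. *)
Lemma modulation_tilt_limit :
  (N%:R * (expR (count_tilt N) - 1)) ^+ 2 / (N%:R : R) `^ alpha @[N --> \oo] -->
  theta ^+ 2 * (alpha <= 1)%R%:R.
Proof.
rewrite -/x; pose c := 1 - gamma - alpha / 2.
have c_le0 : c <= 0 by rewrite /c /gamma; case: (leP (1 - alpha / 2) (1 / 2)); lra.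
have c_eq0 : (c == 0) = (alpha <= 1).
  by rewrite /c /gamma; apply/eqP/idP; case: (leP (1 - alpha / 2) (1 / 2)); lra.
have main : theta * p N c @[N --> \oo] --> theta * (alpha <= 1)%R%:R.
  by apply: cvgMr; rewrite -c_eq0; exact: natr_powR_limit.
have lim : N%:R * (expR (x N) - 1) * p N (- (alpha / 2)) @[N --> \oo] -->
    theta * (alpha <= 1)%R%:R.
  apply: (cvg_dominated (e := fun N => `|x N| * expR `|x N| * `|theta * p N c|) main).
    rewrite -(mul0r `|theta * (alpha <= 1)%R%:R|); apply: cvgM => //; exact: cvg_norm.
  move=> N N0.
  have pc : p N c = N%:R * p N (- gamma) * p N (- (alpha / 2)).
    by rewrite -[N%:R in RHS]p1 -!pD.
  rewrite pc (_ : _ - _ = N%:R * p N (- (alpha / 2)) * (expR (x N) - 1 - x N)); last first.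
    by rewrite xE; ring.
  rewrite normrM ger0_norm ?mulr_ge0//.
  apply: (le_trans (ler_wpM2l _ (expR_taylor1 (x N)))); first by rewrite mulr_ge0.
  have -> : theta * (N%:R * p N (- gamma) * p N (- (alpha / 2))) =
     N%:R * p N (- (alpha / 2)) * x N by rewrite xE; ring.
  have q0 : 0 <= N%:R * p N (- (alpha / 2)) by rewrite mulr_ge0.
  rewrite (normrM _ (x N)) (ger0_norm q0) -(real_normK (num_real (x N))).
  by rewrite le_eqVlt; apply/orP; left; apply/eqP; ring.
have -> : theta ^+ 2 * (alpha <= 1)%R%:R =
    (theta * (alpha <= 1)%R%:R) * (theta * (alpha <= 1)%R%:R).
  by case: (alpha <= 1); rewrite ?mulr0 ?mulr1.
apply: cvg_trans (cvgM lim lim); apply: near_eq_cvg; near=> N.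
have N0 : (0 < N)%N by near: N; exact: nbhs_infty_gt.
have : p N (- (alpha / 2)) * p N (- (alpha / 2)) = ((N%:R : R) `^ alpha)^-1.
  by rewrite -pD// -powRN; congr (_ `^ _); lra.
by move=> <-; rewrite /=; ring.
Unshelve. all: by end_near. Qed.

(** The exponent of [N] in the leading term is [1 - 2 * gamma]; it is zero
    when [1 <= alpha] and negative otherwise. *)
Lemma poisson_tilt_limit :
  N%:R * (expR (count_tilt N) - 1 - count_tilt N) @[N --> \oo] --> theta ^+ 2 / 2 * (1 <= alpha)%R%:R.
Proof.
rewrite -/x; pose c := 1 - gamma - gamma.
have c_le0 : c <= 0 by rewrite /c /gamma; case: (leP (1 - alpha / 2) (1 / 2)); lra.
have c_eq0 : (c == 0) = (1 <= alpha).
  by rewrite /c /gamma; apply/eqP/idP; case: (leP (1 - alpha / 2) (1 / 2)); lra.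
have pc : p N c @[N --> \oo] --> ((1 <= alpha)%R%:R : R).
  by rewrite -c_eq0; exact: natr_powR_limit.
apply: (cvg_dominated (g := fun N => theta ^+ 2 / 2 * p N c)
  (e := fun N => `|x N| * expR `|x N| * (theta ^+ 2 * p N c))).
- exact: cvgMr.
- rewrite -(mul0r (theta ^+ 2 * (1 <= alpha)%R%:R)); apply: cvgM => //; exact: cvgMr.
move=> N N0.
have E : theta ^+ 2 * p N c = N%:R * x N ^+ 2.
  by rewrite /c !pD// p1 xE; ring.
have -> : theta ^+ 2 / 2 * p N c = N%:R * (x N ^+ 2 / 2) by rewrite mulrAC E mulrA.
rewrite E -mulrBr normrM ger0_norm//.
apply: (le_trans (ler_wpM2l _ (expR_taylor2 (x N)))) => //.
rewrite -(real_normK (num_real (x N))) le_eqVlt; apply/orP; left; apply/eqP; ring.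
Qed.

End tilt_asymptotics.

(** * Moment generating function of the centered number of jobs *)

Section scaled_queue.
Variables (R : realType) (d : nat) (A : 'M[R]_d) (md : model)
  (K : R) (lambda mu : 'I_d -> R) (m : R)
  (disp : measure_display) (Omega : measurableType disp)
  (P : probability Omega R) (J : R -> Omega -> 'I_d)
  (T : nat -> Omega -> \bar R) (S : nat -> Omega -> R).
Hypothesis queue : is_modulated_queue md A (fun i => K * lambda i) mu P J T S.
Hypothesis mu_eq : forall i, mu i = m.
Hypothesis m_gt0 : 0 < m.
Hypothesis K_ge0 : 0 <= K.
Hypothesis lambda_ge0 : forall i, 0 <= lambda i.
Variable t : R.
Hypothesis t_ge0 : 0 <= t.

Lemma load_scale w : load (fun i => K * lambda i) m J t w = K * load lambda m J t w.
Proof.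
rewrite /load -RintegralZl//; last first.
  apply: (path_integrable (queue_background queue) (lexx 0) t_ge0 lambda_ge0
    (@continuous_weight R m t)) => s /andP[_ st]; exact: weight_itv.
by apply: eq_Rintegral => s _; rewrite mulrCA.
Qed.

Lemma centered_jobs_mgf (b c : R) :
  P.-integrable [set: Omega] (EFin \o (fun w => expR (b * ((jobs T S t w)%:R - c)))) /\
  \int[P]_w expR (b * ((jobs T S t w)%:R - c)) =
  \int[P]_w expR (K * (expR b - 1) * load lambda m J t w) * expR (- (b * c)).
Proof.
have K_lambda_ge0 i : 0 <= K * lambda i by rewrite mulr_ge0.
have gf := jobs_generating_function queue mu_eq m_gt0 K_lambda_ge0 t_ge0 (expR_gt0 b).
have split_exp w : expR (b * ((jobs T S t w)%:R - c)) =
    expR (- (b * c)) * expR b ^+ jobs T S t w.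
  by rewrite -expRM_natl -expRD; congr expR; ring.
have i_power : P.-integrable [set: Omega] (EFin \o (fun w => expR b ^+ jobs T S t w)).
  apply/integrableP; split.
    by apply/measurable_EFinP; apply: power_jobs_measurable queue t _ (expR_gt0 b).
  under eq_integral do rewrite /= ger0_norm ?exprn_ge0 ?expR_ge0//.
  by rewrite gf ltry.
under eq_fun do rewrite split_exp.
split; first exact: (integrableZl _ (expR (- (b * c))) i_power).
rewrite RintegralZl// mulrC; congr (_ * _).
rewrite /Rintegral gf; apply: eq_Rintegral => w _; congr expR.
by rewrite load_scale; ring.
Qed.

End scaled_queue.

(** * The central limit theorem *)

Theorem theorem1 (R : realType) (d : nat) (Q : 'M[R]_d) (pi : 'cV[R]_d)
  (lambda mu : 'I_d -> R) (m alpha : R) (md : model)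
  (Q_rates : is_rate_matrix Q) (Q_irreducible : irreducible_rates Q)
  (pi_stationary : is_stationary Q pi)
  (lambda_ge0 : forall i, 0 <= lambda i)
  (m_gt0 : 0 < m) (mu_eq : forall i, mu i = m) (alpha_gt0 : 0 < alpha)
  (disp : nat -> measure_display)
  (Omega : forall N, measurableType (disp N))
  (P : forall N, probability (Omega N) R)
  (J : forall N, R -> Omega N -> 'I_d)
  (T : forall N, nat -> Omega N -> \bar R)
  (S : forall N, nat -> Omega N -> R)
  (queue : forall N : nat, (0 < N)%N ->
     is_modulated_queue md (N%:R `^ alpha *: Q) (fun i => N%:R * lambda i) mu
       (P N) (@J N) (@T N) (@S N))
  (t : R) (t_ge0 : 0 <= t) :
  let gamma := Num.max (1 - alpha / 2) (1 / 2) in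
  cvg_in_distribution P
    (fun N w => ((jobs (@T N) (@S N) t w)%:R - N%:R * varrho pi lambda m t)
                / N%:R `^ gamma)
    (normal_law 0 (sigma2 Q pi lambda alpha m t)).
Proof.
move=> gamma; set rho := varrho pi lambda m t; set v := sigma2 Q pi lambda alpha m t.
have U_ge0 := U_coef_ge0 Q_rates Q_irreducible pi_stationary lambda.
have rho_ge0 : 0 <= rho.
  have [pi_ge0 _ _] := pi_stationary.
  rewrite /rho /varrho mulr_ge0 ?divr_ge0 ?(ltW m_gt0)//.
    by apply: sumr_ge0 => i _; rewrite mulr_ge0.
  by rewrite subr_ge0 -expR0 ler_expR oppr_le0 mulr_ge0 ?(ltW m_gt0).
have v_ge0 : 0 <= v.
  apply: addr_ge0; apply: mulr_ge0 => //; apply: mulr_ge0 => //.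
  apply: mulr_ge0; first by rewrite invr_ge0 ltW.
  by rewrite subr_ge0 -expR0 ler_expR oppr_le0 !mulr_ge0 ?(ltW m_gt0).
pose b theta N : R := count_tilt alpha theta N.
pose a theta N : R := N%:R * (expR (b theta N) - 1).
pose G theta N := \int[P N]_w expR (a theta N * load lambda m (@J N) t w).
have normalised theta N w : theta * (((jobs (@T N) (@S N) t w)%:R - N%:R * rho) / N%:R `^ gamma)
    = b theta N * ((jobs (@T N) (@S N) t w)%:R - N%:R * rho).
  by rewrite /b /count_tilt -/gamma; ring.
have mgf theta N (N0 : (0 < N)%N) :=
  centered_jobs_mgf (queue N N0) mu_eq m_gt0 (ler0n R N) lambda_ge0 t_ge0
    (b theta N) (N%:R * rho).
apply: mgf_cvg_in_distribution.
- move=> N N0; apply: measurable_funM => //; apply: measurable_funB => //.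
  exact: (jobs_measurable (queue N N0)).
- move=> N theta N0; under eq_fun do rewrite normalised.
  by have [] := mgf theta N N0.
- by move=> theta; exact: normal_law_integrable_expR.
move=> theta.
have -> : \int[normal_law 0 v]_x expR (theta * x) = expR (v * theta ^+ 2 / 2).
  by rewrite /Rintegral normal_law_mgf.
have nu_gt0 N : (0 < N)%N -> 0 < (N%:R : R) `^ alpha.
  by move=> N0; rewrite powR_gt0// ltr0n.
have nu_lim : ((N%:R : R) `^ alpha)^-1 @[N --> \oo] --> (0 : R).
  have := @natr_powR_limit R (- alpha) _.
  rewrite oppr_le0 oppr_eq0 gt_eqF// => /(_ (ltW alpha_gt0)).
  by under eq_fun do rewrite powRN.
have modulated : G theta N * expR (- (a theta N * rho)) @[N --> \oo] -->
    expR (theta ^+ 2 * (alpha <= 1)%R%:R * U_coef Q pi lambda *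
      ((1 - expR (- (2 * m * t))) / (2 * m))).
  pose p0 N := initial_law (P N) (@J N).
  pose y N := tilted_law Q (N%:R `^ alpha) (P N) (@J N) lambda m t (a theta N).
  have chain N : (0 < N)%N -> [/\ forall i, 0 <= p0 N i, \sum_i p0 N i = 1,
      tilted_recursion Q lambda m (N%:R `^ alpha) (a theta N) t (p0 N) (y N) &
      \sum_i y N r r i @[r --> \oo] --> G theta N].
    move=> N0; have J_markov := queue_background (queue N N0); split.
    - exact: initial_law_ge0.
    - exact: (initial_law_sum J_markov).
    - exact: (tilted_law_recursion J_markov).
    - exact: (tilted_law_limit J_markov lambda_ge0 m_gt0 t_ge0).
  exact: (tilted_limit Q_rates Q_irreducible pi_stationary m_gt0 t_ge0 nu_gt0 nu_lim
    (@modulation_tilt_limit R alpha theta) chain).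
have poisson : expR (rho * (N%:R * (expR (b theta N) - 1 - b theta N))) @[N --> \oo] -->
    expR (rho * (theta ^+ 2 / 2 * (1 <= alpha)%R%:R)).
  have lim : rho * (N%:R * (expR (b theta N) - 1 - b theta N)) @[N --> \oo] -->
      rho * (theta ^+ 2 / 2 * (1 <= alpha)%R%:R).
    by have := @poisson_tilt_limit R alpha theta; exact: cvgMr.
  exact: (continuous_cvg _ (@continuous_expR R _) lim).
have -> : expR (v * theta ^+ 2 / 2) =
    expR (theta ^+ 2 * (alpha <= 1)%R%:R * U_coef Q pi lambda *
      ((1 - expR (- (2 * m * t))) / (2 * m))) *
    expR (rho * (theta ^+ 2 / 2 * (1 <= alpha)%R%:R)).
  rewrite -expRD; congr expR; rewrite /v /sigma2 /sigma2_m -/rho; field.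
  by rewrite gt_eqF.
apply: cvg_trans (cvgM modulated poisson); apply: near_eq_cvg; near=> N.
have N0 : (0 < N)%N by near: N; exact: nbhs_infty_gt.
have [_ E] := mgf theta N N0.
transitivity (\int[P N]_w expR (b theta N * ((jobs (@T N) (@S N) t w)%:R - N%:R * rho))).
  rewrite E /= -mulrA -expRD; congr (_ * expR _); rewrite /a; ring.
by apply: eq_Rintegral => w _; rewrite normalised.
Unshelve. all: by end_near. Qed.
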